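(* (i) Every locally mean equicontinuous t.d.s. has zero topological entropy. (ii) There exist a locally mean equicontinuous t.d.s. $(X,T)$ and an ergodic $T$-invariant Borel probability measure $\mu$ on $X$ such that the subsystem $(\operatorname{supp}(\mu),T)$ is not minimal.
   Context: A t.d.s. (topological dynamical system) is a pair $(X,T)$ where $X$ is a non-empty compact metric space with metric $d$ and $T\colon X\to X$ is continuous. A t.d.s. is minimal if every point has dense forward orbit. For $x\in X$, $\operatorname{orb}(x,T)=\{x,Tx,T^2x,\ldots\}$. A point $x$ of a t.d.s. $(X,T)$ is mean equicontinuous if for every $\varepsilon>0$ there is $\delta>0$ such that for every $y\in X$ with $d(x,y)<\delta$ we have $\limsup_{n\to\infty}\frac1n\sum_{i=0}^{n-1}d(T^ix,T^iy)<\varepsilon$. $(X,T)$ is almost mean equicontinuous if the set of its mean equicontinuous points is residual in $X$ (contains a dense $G_\delta$ subset). $(X,T)$ is locally mean equicontinuous if for every $x\in X$ the t.d.s. $(\overline{\operatorname{orb}(x,T)},T)$ is almost mean equicontinuous. The support of an invariant Borel probability measure $\mu$ is $\operatorname{supp}(\mu)=\{x\in X:\mu(U)>0\text{ for every neighbourhood }U\text{ of }x\}$. *)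

(* Defs.v *)
From HB Require Import structures.
From mathcomp Require Import all_boot all_order all_algebra finmap.
From mathcomp Require Import all_classical all_reals all_analysis borel_hierarchy.

Set Implicit Arguments.
Unset Strict Implicit.
Unset Printing Implicit Defensive.
Import Order.TTheory GRing.Theory Num.Theory.
Import numFieldNormedType.Exports.

Local Open Scope classical_set_scope.
Local Open Scope ring_scope.

(* The library gives [set_type A] the initial pseudometric of its inclusion,
   but not the corresponding metric structure. *)
Section set_type_metric.
Context {R : realType} {X : metricType R} (A : set X).

Let dist (x y : A) : R := mdist (set_val x) (set_val y).

Let dist_ge0 x y : 0 <= dist x y.
Proof. exact: mdist_ge0. Qed.

Let dist_positivity x y : dist x y = 0 -> x = y.
Proof. by move=> /mdist_positivity /val_inj. Qed.

Let ballEdist (x : A) e : ball x e = [set y | dist x y < e].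
Proof.
rewrite -(@initial_ballE R A X set_val e x).
by apply/seteqP; split => y; rewrite /= ballEmdist.
Qed.

HB.instance Definition _ := @PseudoMetric_isMetric.Build R (set_type A)
  dist dist_ge0 dist_positivity ballEdist.

End set_type_metric.

Record tds (R : realType) := TDS {
  space :> metricType R;
  tmap : space -> space;
  tds_nonempty : [set: space] !=set0;
  tds_compact : compact [set: space];
  tmap_continuous : continuous tmap }.

Arguments tmap {R} X _ : rename.

Definition orb {R : realType} {X : tds R} (x : X) : set X :=
  [set iter n (tmap X) x | n in [set: nat]].

Definition minimal {R : realType} (X : tds R) : Prop :=
  forall x : X, dense (orb x).

Section subsystem.
Context {R : realType} (X : tds R) (A : set X).
Hypotheses (A0 : A !=set0) (clA : closed A).
Hypothesis TA : forall x, A x -> A (tmap X x).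

Definition restr_map (a : A) : A :=
  exist _ (tmap X (set_val a)) (mem_set (TA (set_valP a))).

Lemma set_type_nonempty : [set: A] !=set0.
Proof. by case: A0 => x Ax; exists (exist _ x (mem_set Ax)). Qed.

Lemma set_type_compact : compact [set: A].
Proof.
have cA : compact A by apply: (subclosed_compact clA (@tds_compact _ X)).
move=> F PF _; pose G := (set_val : A -> X) @ F.
have GA : G A.
  rewrite /G /nbhs/=; apply: (@filterS _ F _ setT); last exact: filterT.
  by move=> a _; exact: set_valP.
have [p [Ap clp]] := cA G _ GA.
exists (exist _ p (mem_set Ap)); split => // U V FU.
case=> _ [] [W oW <-] /= Wp WV.
have GU : G (set_val @` U).
  by rewrite /G /nbhs/=; apply: filterS FU => a Ua; exists a.
have [_ [[a Ua <-] Wa]] := clp _ _ GU (open_nbhs_nbhs (conj oW Wp)).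
by exists a; split => //; exact: WV.
Qed.

Lemma restr_map_continuous : continuous restr_map.
Proof.
move=> a U [] _ [] [W oW <-] /= Wa WU.
have nW : nbhs (tmap X (set_val a)) W by exact: open_nbhs_nbhs.
have nTW := tmap_continuous nW.
have := @initial_continuous A X set_val a _ nTW.
rewrite nbhs_simpl/=; apply: filterS => b Wb; exact: WU.
Qed.

Definition subsystem : tds R :=
  TDS set_type_nonempty set_type_compact restr_map_continuous.

End subsystem.

Section orbit_closure.
Context {R : realType} (X : tds R) (x : X).

Lemma orbit_closure_nonempty : closure (orb x) !=set0.
Proof. by exists x; apply: subset_closure; exists 0%N. Qed.

Lemma orbit_closure_invariant y :
  closure (orb x) y -> closure (orb x) (tmap X y).
Proof.
move=> cy U Uy; have [_ [[n _ <-] Un]] := cy _ (tmap_continuous Uy).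
by exists (tmap X (iter n (tmap X) x)); split => //; exists n.+1.
Qed.

Definition orbit_closure : tds R :=
  subsystem orbit_closure_nonempty (@closed_closure _ (orb x))
    orbit_closure_invariant.

End orbit_closure.

Section mean_equicontinuity.
Context {R : realType}.

Definition mean_dist (X : tds R) (x y : X) (n : nat) : R :=
  n%:R^-1 * \sum_(0 <= i < n) mdist (iter i (tmap X) x) (iter i (tmap X) y).

Definition mean_equicontinuous_at (X : tds R) (x : X) : Prop :=
  forall eps : R, 0 < eps -> exists2 delta : R, 0 < delta &
    forall y : X, mdist x y < delta ->
      (limn_esup (EFin \o mean_dist x y) < eps%:E)%E.

Definition residual (T : topologicalType) (A : set T) : Prop :=
  exists G : set T, [/\ Gdelta G, dense G & G `<=` A].

Definition almost_mean_equicontinuous (X : tds R) : Prop :=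
  residual [set x : X | mean_equicontinuous_at x].

Definition locally_mean_equicontinuous (X : tds R) : Prop :=
  forall x : X, almost_mean_equicontinuous (orbit_closure x).

End mean_equicontinuity.

(* Topological entropy by Bowen's definition with (n, eps)-separated sets; the
   limit as eps -> 0+ is the supremum over eps > 0 since the quantity is
   nonincreasing in eps. *)
Section entropy.
Context {R : realType} (X : tds R).

Definition bowen_dist (n : nat) (x y : X) : R :=
  \big[Num.max/0]_(0 <= i < n)
    mdist (iter i (tmap X) x) (iter i (tmap X) y).

Definition bowen_separated (n : nat) (eps : R) (E : {fset X}) : Prop :=
  forall x y, x \in E -> y \in E -> x != y -> eps < bowen_dist n x y.

Definition separated_number (n : nat) (eps : R) : \bar R :=
  ereal_sup [set (#|` E|%:R)%:E | E in bowen_separated n eps].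

Definition entropy_at_scale (eps : R) : \bar R :=
  limn_esup (fun n => ((n%:R^-1)%:E * lne (separated_number n eps))%E).

Definition topological_entropy : \bar R :=
  ereal_sup [set entropy_at_scale eps | eps in [set e : R | 0 < e]].

End entropy.

(* [measurableType] requires a distinguished point; a point of the nonempty
   phase space is chosen, on which nothing below depends. *)
Section borel.
Context {R : realType} (X : tds R).

Definition pspace : Type := X.

HB.instance Definition _ := Metric.on pspace.
HB.instance Definition _ :=
  isPointed.Build pspace (sval (cid (tds_nonempty X))).

Definition borel := g_sigma_algebraType (@open pspace).

HB.instance Definition _ := Measurable.on borel.

End borel.

Section invariant_measures.
Context {R : realType} (X : tds R) (mu : probability (borel X) R).

Definition invariant_measure : Prop :=
  forall A : set (borel X), measurable A -> mu (tmap X @^-1` A) = mu A.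

Definition ergodic : Prop :=
  forall A : set (borel X), measurable A -> tmap X @^-1` A = A ->
    mu A = 0%E \/ mu A = 1%E.

(* Only measurable neighbourhoods: [mu] is unspecified elsewhere. *)
Definition supp : set X :=
  [set x | forall U : set X, nbhs x U -> measurable (U : set (borel X)) ->
    (0 < mu U)%E].

Lemma open_borel (U : set X) : open U -> measurable (U : set (borel X)).
Proof. by move=> oU; apply: sub_sigma_algebra. Qed.

Lemma notin_suppP (x : X) : ~ supp x ->
  exists U : set X, [/\ open U, U x & mu U = 0%E].
Proof.
move=> /existsNP[U /not_implyP[Ux /not_implyP[mU /negP]]].
rewrite -leNgt => U0; exists U°; split; [exact: open_interior|by []|].
apply/eqP; rewrite eq_le measure_ge0 andbT (le_trans _ U0)//.
have mU' := open_borel (open_interior U).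
exact: (le_measure mu (mem_set mU') (mem_set mU) (@interior_subset _ U)).
Qed.

Lemma supp_closed : closed supp.
Proof.
rewrite -openC openE => x /notin_suppP[U [oU Ux U0]].
rewrite /interior; apply: (@filterS _ _ _ U); last exact: open_nbhs_nbhs.
move=> y Uy /(_ U (open_nbhs_nbhs (conj oU Uy)) (open_borel oU)).
by rewrite U0 ltxx.
Qed.

Lemma supp_nonempty : supp !=set0.
Proof.
apply: contrapT => /set0P/negP/negPn/eqP s0.
pose F : set_system X := almost_everywhere mu.
have PF : ProperFilter F.
  have mu_gt0 : (0 < mu [set: borel X])%E by rewrite probability_setT lte01.
  exact: (ae_properfilter_algebraOfSetsType mu_gt0).
have [p [_ clp]] := @tds_compact _ X F PF filterT.
have /notin_suppP[U [oU Up U0]] : ~ supp p by rewrite s0.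
have FU : F (~` U).
  by exists U; split; [exact: open_borel|exact: U0|rewrite setCK].
by have [q []] := clp _ _ FU (open_nbhs_nbhs (conj oU Up)).
Qed.

Hypothesis Tmu : invariant_measure.

Lemma supp_invariant x : supp x -> supp (tmap X x).
Proof.
move=> sx; apply: contrapT => /notin_suppP[U [oU Ux U0]].
have nTU : nbhs x (tmap X @^-1` U).
  exact: (tmap_continuous (open_nbhs_nbhs (conj oU Ux))).
have mTU : measurable (tmap X @^-1` U : set (borel X)).
  apply: open_borel; apply: open_comp => // y _; exact: tmap_continuous.
by have := sx _ nTU mTU; rewrite Tmu ?U0 ?ltxx//; exact: open_borel.
Qed.

Definition supp_subsystem : tds R :=
  subsystem supp_nonempty supp_closed supp_invariant.

End invariant_measures.

(* Main.v *)
From HB Require Import structures.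
From mathcomp Require Import all_boot all_order all_algebra finmap.
From mathcomp Require Import all_classical all_reals all_analysis measurable_realfun.
From mathcomp Require Import zify ring lra.
Require Import Defs.

Set Implicit Arguments.
Unset Strict Implicit.
Unset Printing Implicit Defensive.
Import Order.TTheory GRing.Theory Num.Theory.
Import numFieldNormedType.Exports.

Local Open Scope classical_set_scope.
Local Open Scope ring_scope.

(** For the vanishing of the entropy, local mean equicontinuity is first turned
into a statement about single orbits.  The closure of the orbit of [x] contains
a mean equicontinuous point [y]; the orbit enters every neighbourhood of [y],
and the mean distance does not see finite shifts.  Hence whenever the orbit of
[x] comes back close enough to [x], the two points stay close in the mean
([mean_returning], [locally_mean_equicontinuous_returning]).

Let [mu] be an invariant probability.  For almost every [x] the orbit of [x] is
totally bounded for the mean distance ([ae_mean_totally_bounded]).  Otherwise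
the orbit contains arbitrarily many points that are pairwise far apart in the
mean.  The return times of [x] to a small ball, translated by the times of these
points, are then disjoint sets of integers, so the return times have density
zero; by dominated convergence a set that each of its points visits with density
zero is null.

Total boundedness makes long orbit segments cheap to describe.  Outside a set of
small measure, each of the first [M] iterates of [x] follows, in the mean over a
long time [N], one of the first [L] iterates, where [L] does not depend on [M].
Cutting [N] into blocks of length [M], it is enough to record a coarse position
at [L] times per block, so that the logarithm of the number of descriptions is a
small multiple of [N] ([block_code], [ln_block_alphabet]).

Suppose now that there are separated sets of at least [expR (h * n)] points for
infinitely many [n].  An ultrafilter limit of their empirical measures is a
finitely additive invariant mean [m] on all subsets; the regular outer measure
that it generates restricts to an invariant Borel probability [mu] with [mu U <=
m U] for open [U] ([mean_probability_invariant], [mean_probability_open]).  The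
set [U] of points with a cheap description can be taken open, so for some large
[n] half of the points of the separated set spend nearly all of their time in
[U].  Their itineraries then take few values, and two points with the same
itinerary are so close in the mean that a few exceptional times separate them.
Counting ([separated_card_bound]) contradicts [h > 0]
([mean_returning_entropy_at_scale]).

The example is a skew product.  Over the 2-adic odometer put [F z = expR (- sum
of height k z)], where [height k] depends on [z] modulo [2 ^ level k], is at
least 1 at residue 0 and is small away from it.  The slopes of the heights are
summable, so [F (osucc z) / F z] extends to a continuous positive function
[multiplier], although the roof [F] itself is only upper semicontinuous.  The
map [(z, c) |-> (osucc z, multiplier z * c)] therefore preserves the compact
region [0 <= c <= F z] and the graph of [F].

The measure carried by this graph over an invariant measure of the odometer is
ergodic.  Its support contains the point of height 0 over zero, near which [F]
is arbitrarily small, and it contains points of positive height, because [F] is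
at least [expR (- 4)] with probability at least 3/4.  Points of height 0 stay at
height 0, so the support is not minimal ([graph_not_minimal]).

For local mean equicontinuity, let [0 < s] (height 0 is elementary, as the
odometer does not expand distances).  The closure of the orbit of [(z, s * F z)]
lies below [s * F], and its points on the graph of [s * F] with positive height
form a dense G-delta set.  They are mean equicontinuous because the average of a
height over an orbit segment is at most 12 times its value at the initial point
([height_average]): if a tail of the series of heights is small at a point, it
is small on average along the whole orbit ([roof_near],
[skew_locally_mean_equicontinuous]). *)

(** * Borel measures from invariant means *)

(** Means are taken on all subsets, so that ultrafilter limits of empirical
measures are available without any topology on the space of measures. *)
Record invariant_mean (R : realType) (X : tds R) := InvariantMean {
  mean_of :> set X -> R ;
  mean_ge0 : forall A, 0 <= mean_of A ;
  meanT : mean_of setT = 1 ;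
  meanU : forall A B, A `&` B = set0 ->
    mean_of (A `|` B) = mean_of A + mean_of B ;
  mean_preimage : forall A, mean_of (tmap X @^-1` A) = mean_of A }.

Section mean_measure.
Context {R : realType} {X : tds R} (m : invariant_mean X).
Local Open Scope ereal_scope.

Lemma mean_le A B : A `<=` B -> (m A <= m B)%R.
Proof.
move=> AB; rewrite -(setDUK AB) meanU ?setDIK//; first by rewrite lerDl mean_ge0.
Qed.

Lemma mean0 : m set0 = 0%R.
Proof.
have := @meanU _ _ m set0 set0; rewrite setI0 setU0 => /(_ erefl).
by move=> /eqP; rewrite -subr_eq0 opprD addrA subrr sub0r oppr_eq0 => /eqP.
Qed.

Lemma meanUle A B : (m (A `|` B) <= m A + m B)%R.
Proof.
have -> : A `|` B = A `|` (B `\` A).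
  apply/seteqP; split=> x /=; last by case=> [|[]]; [left|right].
  by move=> [|Bx]; [left|have [|] := pselect (A x); [left|right]].
rewrite meanU; last by rewrite setIC setDE -setIA setICl setI0.
by rewrite lerD2l mean_le.
Qed.

(** The inner regularization is needed even on open sets: a limit of empirical
measures may charge an open set with mass that escapes to its boundary. *)
Definition inner_mean (U : set (pspace X)) : \bar R :=
  ereal_sup [set (m F)%:E | F in [set F | closed F /\ F `<=` U]].

Definition outer_mean (A : set (pspace X)) : \bar R :=
  ereal_inf [set inner_mean U | U in [set U | open U /\ A `<=` U]].

Let cT : compact [set: pspace X]. Proof. exact: (@tds_compact _ X). Qed.

Let closed_cpt (F : set (pspace X)) : closed F -> compact F.
Proof. by move=> cF; exact: (subclosed_compact cF cT). Qed.

Let hX : hausdorff_space (pspace X). Proof. exact: metric_hausdorff. Qed.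

Let nX : normal_space (pspace X). Proof. exact: compact_normal. Qed.

Lemma inner_meanP (F U : set (pspace X)) : closed F -> F `<=` U ->
  (m F)%:E <= inner_mean U.
Proof. by move=> cF FU; apply: ereal_sup_ubound; exists F. Qed.

Lemma inner_mean_ge0 U : 0 <= inner_mean U.
Proof.
by apply: le_trans (inner_meanP closed0 (@sub0set _ _)); rewrite lee_fin mean_ge0.
Qed.

Lemma inner_mean_le (U : set (pspace X)) : inner_mean U <= (m U)%:E.
Proof.
by apply: ge_ereal_sup => _ [F [cF FU] <-]; rewrite lee_fin mean_le.
Qed.

Lemma inner_mean_fin U : inner_mean U \is a fin_num.
Proof.
rewrite ge0_fin_numE ?inner_mean_ge0//.
by rewrite (le_lt_trans (inner_mean_le U))// ltry.
Qed.

Lemma inner_mean_homo U V : U `<=` V -> inner_mean U <= inner_mean V.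
Proof.
move=> UV; apply: ge_ereal_sup => _ [F [cF FU] <-].
by apply: inner_meanP => //; exact: subset_trans UV.
Qed.

(** Normality separates the part of [F] outside [V] from the complement of [U]. *)
Lemma closed_split (F U V : set (pspace X)) : closed F -> open U -> open V ->
  F `<=` U `|` V -> exists F1 F2, [/\ closed F1, closed F2, F1 `<=` U,
    F2 `<=` V & F = F1 `|` F2].
Proof.
move=> cF oU oV FUV; pose A := F `&` ~` V.
have cA : closed A by apply: closedI => //; exact: open_closedC.
have [|W /set_nbhsP[C [oC AC CW]] WU] := nX cA (_ : set_nbhs A U).
  apply/set_nbhsP; exists U; split => // x [Fx nVx].
  by have [] := FUV _ Fx.
exists (F `&` closure W), (F `&` ~` C); split.
- by apply: closedI => //; exact: closed_closure.
- by apply: closedI => //; exact: open_closedC.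
- by move=> x [_ /WU].
- by move=> x [Fx nCx]; apply: contrapT => nVx; apply: nCx; apply: AC.
- rewrite -setIUr; apply/seteqP; split=> [x Fx|x []//]; split => //.
  have [Cx|] := pselect (C x); [left|by right].
  by apply: subset_closure; exact: CW.
Qed.

Lemma inner_mean_subadditive (U : (set (pspace X))^nat) N F :
  (forall i, open (U i)) -> closed F -> F `<=` \bigcup_(i in `I_N) U i ->
  (m F)%:E <= \sum_(0 <= i < N) inner_mean (U i).
Proof.
move=> oU; elim: N F => [|N ih] F cF.
  rewrite II0 bigcup_set0 subset0 => ->; rewrite mean0.
  by rewrite big_nil.
rewrite IIS bigcup_setU bigcup_set1 => FU.
have [|F1 [F2 [cF1 cF2 F1U F2U ->]]] := closed_split cF _ (oU N) FU.
  by apply: bigcup_open => i _.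
rewrite big_nat_recr//= (le_trans (_ : _ <= (m F1)%:E + (m F2)%:E))//.
  by rewrite -EFinD lee_fin meanUle.
by rewrite leeD// ?ih// inner_meanP.
Qed.

(** A closed set in the union is compact, hence covered by finitely many of the
open sets; finite subadditivity suffices. *)
Lemma inner_mean_sigma_subadditive (U : (set (pspace X))^nat) :
  (forall i, open (U i)) ->
  inner_mean (\bigcup_i U i) <= \sum_(i <oo) inner_mean (U i).
Proof.
move=> oU; apply: ge_ereal_sup => _ [F [cF FU] <-].
have := closed_cpt cF; rewrite compact_cover => /(_ nat setT U) [//|//|D _ FD].
pose N := (\max_(i <- D) i).+1.
have FN : F `<=` \bigcup_(i in `I_N) U i.
  move=> x /FD[i /= iD Uix]; exists i => //=.
  by rewrite ltnS (big_rem i)//= leq_max leqnn.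
apply: (le_trans (inner_mean_subadditive oU cF FN)).
by apply: nneseries_lim_ge => i _ _; exact: inner_mean_ge0.
Qed.

Lemma outer_mean_le (A U : set (pspace X)) : open U -> A `<=` U ->
  outer_mean A <= inner_mean U.
Proof. by move=> oU AU; apply: ereal_inf_lbound; exists U. Qed.

Lemma outer_mean_open U : open U -> outer_mean U = inner_mean U.
Proof.
move=> oU; apply/eqP; rewrite eq_le outer_mean_le//=.
by apply: le_ereal_inf_tmp => _ [V [oV UV] <-]; exact: inner_mean_homo.
Qed.

Lemma outer_mean_ge0 A : 0 <= outer_mean A.
Proof.
by apply: le_ereal_inf_tmp => _ [V _ <-]; exact: inner_mean_ge0.
Qed.

Lemma outer_mean0 : outer_mean set0 = 0.
Proof.
apply/eqP; rewrite eq_le outer_mean_ge0 andbT outer_mean_open; last exact: open0.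
by rewrite (le_trans (inner_mean_le _))// mean0.
Qed.

Lemma outer_mean_homo : {homo outer_mean : A B / A `<=` B >-> A <= B}.
Proof.
move=> A B AB; apply: le_ereal_inf_tmp => _ [V [oV BV] <-].
by apply: outer_mean_le => //; exact: subset_trans BV.
Qed.

Lemma outer_meanT : outer_mean setT = 1.
Proof.
rewrite outer_mean_open; last exact: openT.
apply/eqP; rewrite eq_le (le_trans (inner_mean_le _)) ?meanT//=.
by rewrite -(meanT m) inner_meanP//; exact: closedT.
Qed.

Lemma outer_mean_fin A : outer_mean A \is a fin_num.
Proof.
rewrite ge0_fin_numE ?outer_mean_ge0// (@le_lt_trans _ _ 1)//; last exact: ltry.
by rewrite -outer_meanT outer_mean_homo.
Qed.

Lemma outer_mean_approx A (e : R) : (0 < e)%R ->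
  exists U, [/\ open U, A `<=` U & inner_mean U <= outer_mean A + e%:E].
Proof.
move=> e0; have [_ [U [oU AU] <-] lt] := lb_ereal_inf_adherent e0 (outer_mean_fin A).
by exists U; split => //; exact: ltW.
Qed.

Lemma outer_mean_sigma_subadditive : sigma_subadditive outer_mean.
Proof.
move=> F; apply/lee_addgt0Pr => e e0.
apply: (le_trans _ (@epsilon_trick R (outer_mean \o F) e xpredT
  (fun n => outer_mean_ge0 (F n)) (ltW e0))).
have e2 n : (0 < e / (2 ^ n.+1)%:R)%R by rewrite divr_gt0// ltr0n expn_gt0.
have /choice[U UP] := fun n => outer_mean_approx (F n) (e2 n).
apply: (@le_trans _ _ (inner_mean (\bigcup_n U n))).
  apply: outer_mean_le; first by apply: bigcup_open => i _; have [] := UP i.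
  by apply: subset_bigcup => i _; have [] := UP i.
apply: (le_trans (inner_mean_sigma_subadditive _)) => [i|]; first by have [] := UP i.
apply: lee_nneseries => [i _ _|i _]; first exact: inner_mean_ge0.
by have [_ _ Ui] := UP i; exact: Ui.
Qed.

HB.instance Definition _ := isOuterMeasure.Build R (pspace X) outer_mean
  outer_mean0 outer_mean_ge0 outer_mean_homo outer_mean_sigma_subadditive.

(** Approximate [V `&` U] from inside by a closed [F], then the rest of [V] by a
closed [G] disjoint from [F]: both fit into [V], and finite additivity of the
mean on [F] and [G] gives additivity of the outer measure up to [e]. *)
Lemma outer_mean_caratheodory_open U : open U -> outer_mean.-caratheodory U.
Proof.
move=> oU; apply: le_caratheodory_measurable => A.
apply/lee_addgt0Pr => e e0.
have e3 : (0 < e / 3)%R by rewrite divr_gt0.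
have [V [oV AV Ve]] := outer_mean_approx A e3.
have oVU : open (V `&` U) by exact: openI.
have [_ [F [cF FVU] <-] Fe] := ub_ereal_sup_adherent e3 (inner_mean_fin (V `&` U)).
have oVF : open (V `&` ~` F) by apply: openI => //; exact: closed_openC.
have [_ [G [cG GVF] <-] Ge] := ub_ereal_sup_adherent e3 (inner_mean_fin (V `&` ~` F)).
have FG : F `&` G = set0.
  by rewrite -subset0 => x [Fx /GVF[]].
have FGV : (m F + m G)%:E <= inner_mean V.
  rewrite -meanU//; apply: inner_meanP; first exact: closedU.
  by move=> x [/FVU[]|/GVF[]].
have AU : outer_mean (A `&` U) <= inner_mean (V `&` U).
  by apply: outer_mean_le => //; exact: setSI.
have AUc : outer_mean (A `&` ~` U) <= inner_mean (V `&` ~` F).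
  by apply: outer_mean_le => // x [/AV Vx nUx]; split => // /FVU[].
rewrite lteBlDr// in Fe; rewrite lteBlDr// in Ge.
apply: (le_trans (leeD (le_trans AU (ltW Fe)) (le_trans AUc (ltW Ge)))).
have -> : (m F)%:E + (e / 3)%:E + ((m G)%:E + (e / 3)%:E) =
    (m F + m G)%:E + (e / 3 + e / 3)%:E by rewrite -!EFinD; congr _%:E; lra.
apply: (le_trans (leeD2r _ (le_trans FGV Ve))).
by rewrite -addeA leeD2l// -EFinD lee_fin; lra.
Qed.

Lemma borel_caratheodory (A : set (borel X)) : measurable A ->
  outer_mean.-caratheodory A.
Proof.
apply: (@smallest_sub _ (sigma_algebra setT) (@open (pspace X))
   outer_mean.-caratheodory); last exact: outer_mean_caratheodory_open.
split=> [|B mB|F mF].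
- exact: caratheodory_measurable_set0.
- by rewrite setTD; exact: caratheodory_measurable_setC.
- exact: caratheodory_measurable_bigcup.
Qed.

Definition mean_measure : set (borel X) -> \bar R := outer_mean.

Let mm0 : mean_measure set0 = 0. Proof. exact: outer_mean0. Qed.

Let mm_ge0 A : 0 <= mean_measure A. Proof. exact: outer_mean_ge0. Qed.

Let mm_sigma_additive : semi_sigma_additive mean_measure.
Proof.
move=> F mF tF mUF.
have := @caratheodory_measure_sigma_additive _ _ outer_mean F.
by apply => //; [move=> i; exact: borel_caratheodory|exact: borel_caratheodory].
Qed.

HB.instance Definition _ := isMeasure.Build _ (borel X) R mean_measure
  mm0 mm_ge0 mm_sigma_additive.

Let mmT : mean_measure setT = 1. Proof. exact: outer_meanT. Qed.

HB.instance Definition _ := Measure_isProbability.Build _ (borel X) R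
  mean_measure mmT.

Definition mean_probability : probability (borel X) R := mean_measure.

(** The only comparison with the mean that survives regularization; it carries
statements about the measure back to empirical averages. *)
Lemma mean_probability_open (U : set X) : open U ->
  mean_probability U <= (m U)%:E.
Proof.
move=> oU; rewrite [leLHS](outer_mean_open (oU : @open (pspace X) U)).
exact: inner_mean_le.
Qed.

End mean_measure.

Lemma tmap_open {R : realType} {X : tds R} (U : set X) :
  open U -> open (tmap X @^-1` U).
Proof. by move=> oU; apply: open_comp => // x _; exact: tmap_continuous. Qed.

Lemma preimage_borel {R : realType} {X Y : tds R} (f : X -> Y) :
  (forall U : set Y, open U -> measurable (f @^-1` U : set (borel X))) ->
  forall A : set (borel Y), measurable A -> measurable (f @^-1` A : set (borel X)).
Proof.
move=> fo; apply: (@smallest_sub _ (sigma_algebra setT) (@open (pspace Y))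
   [set A | measurable (f @^-1` A : set (borel X))]); last exact: fo.
split=> [|B mB|F mF] /=.
- by rewrite preimage_set0.
- by rewrite setTD preimage_setC; exact: measurableC.
- by rewrite preimage_bigcup; apply: bigcupT_measurable => i; exact: mF.
Qed.

Lemma tmap_borel {R : realType} {X : tds R} (A : set (borel X)) :
  measurable A -> measurable (tmap X @^-1` A : set (borel X)).
Proof.
by apply: preimage_borel => U oU; apply: open_borel; exact: tmap_open.
Qed.

(** The pi-lambda theorem for a generating class that need not consist of all
open sets. *)
Lemma borel_probability_unique {R : realType} {X : tds R}
    (mu nu : measure (borel X) R) (G : set (set X)) :
  setI_closed G -> G setT -> (forall A, G A -> measurable (A : set (borel X))) ->
  (forall U : set X, open U -> <<s G >> U) ->
  (mu setT < +oo)%E ->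
  (forall A, G A -> mu A = nu A) ->
  forall A : set (borel X), measurable A -> mu A = nu A.
Proof.
move=> GI GT Gm Go muT munu A mA.
apply: (@g_sigma_algebra_measure_unique _ R (borel X) G Gm (fun=> setT)) => //.
  by rewrite bigcup_const.
move: A mA; apply: (@smallest_sub _ (sigma_algebra setT) (@open (pspace X))).
  exact: smallest_sigma_algebra.
exact: Go.
Qed.

Section mean_invariant.
Context {R : realType} {X : tds R} (m : invariant_mean X).

(** On open sets both inequalities come from closed sets: images of closed sets
are closed by compactness, preimages by continuity. *)
Lemma mean_probability_invariant : invariant_measure (mean_probability m).
Proof.
pose mu := mean_probability m.
have mf : measurable_fun setT (tmap X : borel X -> borel X).
  by move=> _ A mA; rewrite setTI; exact: tmap_borel.
move=> A mA; rewrite -[LHS]/(pushforward mu (tmap X : borel X -> borel X) A).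
apply: (@borel_probability_unique _ _ (pushforward mu _) mu (@open X)) => //.
- exact: openI.
- exact: openT.
- by move=> B oB; exact: open_borel.
- by move=> U oU; exact: sub_sigma_algebra.
- rewrite /pushforward (le_lt_trans (probability_le1 mu _)) ?ltry//.
  exact: (tmap_borel (@measurableT _ (borel X))).
move=> U oU; rewrite /pushforward [LHS]outer_mean_open; last exact: tmap_open.
rewrite [RHS]outer_mean_open//; apply/eqP; rewrite eq_le; apply/andP; split.
  apply: ge_ereal_sup => _ [F [cF FU] <-].
  apply: (@le_trans _ _ (m (tmap X @` F))%:E).
    by rewrite lee_fin -(mean_preimage m (tmap X @` F)) mean_le// => x Fx; exists x.
  apply: inner_meanP; last by move=> _ [x Fx <-]; exact: FU.
  apply: (@compact_closed (pspace X)); first exact: metric_hausdorff.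
  apply: (@continuous_compact X X).
    by apply: continuous_subspaceT; exact: tmap_continuous.
  by apply: (subclosed_compact _ (@tds_compact _ X)).
apply: ge_ereal_sup => _ [F [cF FU] <-].
rewrite -(mean_preimage m F); apply: inner_meanP; last first.
  by apply: preimage_subset.
by apply: (@closed_comp X X) => // x _; exact: tmap_continuous.
Qed.

End mean_invariant.

(** * Limits of empirical averages *)

Lemma bounded_ultra_cvg (R : realType) (T : Type) (U : set_system T)
    (f : T -> R) (a b : R) : UltraFilter U -> (forall t, a <= f t <= b) ->
  cvg (f @ U).
Proof.
move=> UU fab; have := @segment_compact R a b.
move=> /(_ (f @ U) _)[].
  by rewrite nbhs_simpl/=; apply: filterE => t; rewrite /= in_itv/=.
move=> p [_ clp]; apply/cvg_ex; exists p => V Vp.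
rewrite nbhs_simpl/=; have [//|UV] := in_ultra_setVsetC (f @^-1` V) UU.
by have [y [nVy Vy]] := clp (~` V) V UV Vp; have := nVy Vy.
Qed.

Section empirical.
Context {R : realType} {X : tds R}.

Definition orbit_count (A : set X) (n : nat) (x : X) : R :=
  \sum_(0 <= i < n) \1_A (iter i (tmap X) x).

Definition empirical (E : seq X) (n : nat) (A : set X) : R :=
  ((size E)%:R * n%:R)^-1 * \sum_(x <- E) orbit_count A n x.

Lemma indic01 (A : set X) x : 0 <= (\1_A x : R) <= 1.
Proof. by rewrite indicE; case: (x \in A); rewrite /= ?lexx ler01. Qed.

Lemma orbit_count_ge0 A n x : 0 <= orbit_count A n x.
Proof. by apply: sumr_ge0 => i _; have /andP[] := indic01 A (iter i (tmap X) x). Qed.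

Lemma orbit_count_le A n x : orbit_count A n x <= n%:R.
Proof.
apply: (@le_trans _ _ (\sum_(0 <= i < n) 1)).
  apply: ler_sum => i _.
  by have /andP[_ h] := indic01 A (iter i (tmap X) x); exact: h.
by rewrite big_const_nat subn0 iter_addr addr0 lexx.
Qed.

Lemma orbit_count_preimage A n x :
  orbit_count (tmap X @^-1` A) n x = orbit_count A n (tmap X x).
Proof.
apply: eq_bigr => i _; rewrite !indicE -iterSr iterS.
by congr (_%:R).
Qed.

Lemma orbit_count_shift A n x :
  `|orbit_count A n (tmap X x) - orbit_count A n x| <= 1.
Proof.
have -> : orbit_count A n (tmap X x) - orbit_count A n x =
    \1_A (iter n (tmap X) x) - \1_A x.
  apply/eqP; rewrite subr_eq addrAC eq_sym subr_eq; apply/eqP.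
  transitivity (orbit_count A n.+1 x).
    by rewrite /orbit_count big_nat_recr//= addrC.
  rewrite /orbit_count big_nat_recl// addrC; congr (_ + _).
  by apply: eq_bigr => i _; rewrite -iterSr.
have := indic01 A (iter n (tmap X) x); have := indic01 A x.
by rewrite ler_norml; lra.
Qed.

Lemma empirical01 E n A : 0 <= empirical E n A <= 1.
Proof.
have s0 : 0 <= \sum_(x <- E) orbit_count A n x.
  by apply: sumr_ge0 => x _; exact: orbit_count_ge0.
rewrite /empirical mulr_ge0 ?invr_ge0 ?mulr_ge0//=.
have [->|p] := eqVneq ((size E)%:R * n%:R : R) 0; first by rewrite invr0 mul0r.
rewrite ler_pdivrMl ?lt_neqAle 1?eq_sym ?p ?mulr_ge0// mulr1.
apply: (le_trans (ler_sum _ (fun x _ => orbit_count_le A n x))).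
by rewrite big_const_seq count_predT iter_addr addr0 mulr_natl.
Qed.

Lemma empirical_preimage E n A : (0 < n)%N ->
  `|empirical E n (tmap X @^-1` A) - empirical E n A| <= n%:R^-1.
Proof.
move=> n0; rewrite /empirical -mulrBr -sumrB normrM.
have [/size0nil ->|E0] := posnP (size E).
  by rewrite big_nil normr0 mulr0.
rewrite ger0_norm ?invr_ge0 ?mulr_ge0// invfM mulrAC -[leRHS]mul1r.
rewrite ler_pM2r ?invr_gt0 ?ltr0n// ler_pdivrMl ?ltr0n// mulr1.
apply: (le_trans (ler_norm_sum _ _ _)).
apply: (@le_trans _ _ (\sum_(x <- E) 1)).
  by apply: ler_sum => x _; rewrite orbit_count_preimage orbit_count_shift.
by rewrite big_const_seq count_predT iter_addr addr0.
Qed.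

(** The limit is along an ultrafilter that refines the eventual filter, so a strict
lower bound on it holds at arbitrarily large indices.  Invariance follows because
shifting an orbit segment of length [n] changes its average by at most [1 / n].  *)
Lemma empirical_mean_exists (E : nat -> seq X) (n : nat -> nat) :
  (forall j, (0 < size (E j))%N) -> (forall j, (j < n j)%N) ->
  exists m : invariant_mean X, forall A c, c < m A ->
    forall j0, exists2 j, (j0 <= j)%N & c < empirical (E j) (n j) A.
Proof.
move=> E0 nj; have [U [UU ooU]] := @ultraFilterLemma nat (\oo) _.
have PU : ProperFilter U := ultra_proper.
pose a A j := empirical (E j) (n j) A.
have ca A : cvg (a A @ U).
  by apply: (@bounded_ultra_cvg _ _ _ _ 0 1) => // j; exact: empirical01.
pose m A : R := lim (a A @ U).
have m0 A : 0 <= m A.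
  by apply: limr_ge => //; apply: filterE => j; have /andP[] := empirical01 (E j) (n j) A.
have mT : m setT = 1.
  apply: cvg_lim => //; rewrite (_ : a setT = cst 1); first exact: cvg_cst.
  apply/funext => j; rewrite /a /empirical.
  under eq_bigr => x _.
    rewrite /orbit_count; under eq_bigr do rewrite indicT /=.
    rewrite big_const_nat subn0 iter_addr addr0; over.
  rewrite big_const_seq count_predT iter_addr addr0 -mulrnA mulnC natrM mulVf//.
  by rewrite mulf_neq0// pnatr_eq0 -lt0n ?E0//; exact: leq_ltn_trans (nj j).
have mU A B : A `&` B = set0 -> m (A `|` B) = m A + m B.
  move=> AB; apply: cvg_lim => //.
  rewrite (_ : a (A `|` B) = a A \+ a B); first exact: cvgD.
  apply/funext => j; rewrite /a /empirical /= -mulrDr -big_split/=; congr (_ * _).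
  apply: eq_bigr => x _; rewrite /orbit_count -big_split/=; apply: eq_bigr => i _.
  rewrite !indicE in_setU; move: (iter _ _ _) => y.
  have [yA|] := boolP (y \in A); have [yB|] := boolP (y \in B); rewrite /= ?addr0 ?add0r//.
  exfalso; have : (A `&` B) y by split; exact/set_mem.
  by rewrite AB.
have mT' A : m (tmap X @^-1` A) = m A.
  apply/eqP; rewrite -subr_eq0; apply/eqP.
  rewrite /m -limB//; apply: cvg_lim => //.
  apply/cvgr0Pnorm_le => e e0.
  have [N _ Ne] := near_infty_natSinv_lt (PosNum e0).
  have : U [set j | (N <= j)%N] by apply: ooU; exists N.
  apply: filterS => j /= Nj; apply: le_trans (ltW (Ne j Nj)).
  apply: (le_trans (empirical_preimage _ _ _)); first exact: leq_ltn_trans (nj j).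
  by rewrite lef_pV2 ?posrE ?ltr0n ?ler_nat//; exact: leq_ltn_trans (nj j).
exists (InvariantMean m0 mT mU mT') => A c cm j0.
have : U [set j | c < a A j] by apply: cvgr_gt cm; exact: ca.
move=> Uc; have Uj : U [set j | (j0 <= j)%N].
  by apply: ooU; exists j0.
by have [j [/= cj jj]] := filter_ex (filterI Uc Uj); exists j.
Qed.
End empirical.

(** * Mean distance and returns *)

Section limsup_eventually.
Context {R : realType}.

Lemma limn_esup_lt_near (u : nat -> \bar R) (c : \bar R) :
  (limn_esup u < c)%E -> \forall n \near \oo, (u n < c)%E.
Proof.
move=> /ereal_inf_lt[_ [A Aoo <-] Ac]; apply: filterS Aoo => n An.
by apply: le_lt_trans Ac; apply: ereal_sup_ubound; exists n.
Qed.

Lemma limn_esup_gt_frequently (u : nat -> \bar R) (c : \bar R) :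
  (c < limn_esup u)%E -> forall N, exists2 n, (N <= n)%N & (c < u n)%E.
Proof.
move=> cu N; have : (c < ereal_sup (u @` [set n | (N <= n)%N]))%E.
  apply: (lt_le_trans cu); apply: ereal_inf_lbound.
  by exists [set n | (N <= n)%N] => //; exists N.
by move=> /ereal_sup_gt[_ [n Nn <-] cn]; exists n.
Qed.

Lemma limn_esup_le_near (u : nat -> \bar R) (c : \bar R) :
  (\forall n \near \oo, (u n <= c)%E) -> (limn_esup u <= c)%E.
Proof.
move=> uc; apply: (@le_trans _ _ (ereal_sup (u @` [set n | (u n <= c)%E]))).
  by apply: ereal_inf_lbound; exists [set n | (u n <= c)%E].
by apply: ge_ereal_sup => _ [n un <-].
Qed.

End limsup_eventually.

Section compact_metric.
Context {R : realType} {X : tds R}.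
Implicit Types x y z : X.

Lemma finite_net (g : R) : 0 < g ->
  exists s : seq X, forall x, exists2 c, c \in s & mdist c x < g.
Proof.
move=> g0; have := @tds_compact _ X : compact [set: pspace X].
rewrite compact_cover => /(_ (pspace X) setT (fun c => (ball c g)°))[].
- by move=> i _; exact: open_interior.
- by move=> x _; exists x => //; exact: nbhsx_ballx.
move=> D _ DX; exists D => x; have [c cD /interior_subset] := DX x I.
by rewrite ballEmdist/=; exists c.
Qed.

Lemma mdist_bounded : exists2 D : R, 0 < D & forall x y, mdist x y <= D.
Proof.
have [s sP] := finite_net ltr01; have [x0 _] := tds_nonempty X.
pose S := \sum_(c <- s) mdist x0 c.
have S0 : 0 <= S by apply: sumr_ge0 => c _; exact: mdist_ge0.
have xS x : mdist x0 x <= S + 1.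
  have [c cs cx] := sP x; apply: (le_trans (metric_triangle _ c _)).
  rewrite lerD//; last exact: ltW.
  by rewrite /S (big_rem c)//= lerDl sumr_ge0// => i _; exact: mdist_ge0.
exists ((S + 1) + (S + 1)); first lra.
move=> x y; apply: (le_trans (metric_triangle _ x0 _)).
by rewrite lerD// metric_sym.
Qed.

Lemma iter_continuous n : continuous (iter n (tmap X)).
Proof.
elim: n => [|n ih] x; first exact: cvg_id.
by rewrite /=; apply: continuous_comp; [exact: ih|exact: tmap_continuous].
Qed.

Lemma mdist_fun_continuous (f g : X -> X) : continuous f -> continuous g ->
  continuous (fun x => mdist (f x) (g x)).
Proof.
move=> cf cg x; apply/cvgrPdist_lt => e e0.
have e2 : 0 < e / 2 by rewrite divr_gt0.
have cfx := @metricType_numDomainType.cvgr_dist_lt R X X (nbhs x) (nbhs_filter x) f _ (cf x) _ e2.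
have cgx := @metricType_numDomainType.cvgr_dist_lt R X X (nbhs x) (nbhs_filter x) g _ (cg x) _ e2.
near=> y; have fxy : mdist (f x) (f y) < e / 2 by near: y.
have gxy : mdist (g x) (g y) < e / 2 by near: y.
have h1 := metric_triangle (f x) (f y) (g x).
have h2 := metric_triangle (f y) (g y) (g x).
have h3 := metric_triangle (f y) (f x) (g y).
have h4 := metric_triangle (f x) (g x) (g y).
rewrite (metric_sym (g y)) in h2; rewrite (metric_sym (f y) (f x)) in h3.
by rewrite ltr_norml; apply/andP; split; lra.
Unshelve. all: by end_near. Qed.

Lemma mdist_ball_open c (e : R) : open (ball c e : set X).
Proof.
rewrite ballEmdist; apply: (@open_comp X R (fun y => mdist c y) [set r | r < e]).
  move=> y _; apply: (@mdist_fun_continuous (cst c) id) => z; last exact: cvg_id.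
  exact: cvg_cst.
exact: open_lt.
Qed.

Lemma mean_distC x y N : mean_dist x y N = mean_dist y x N.
Proof. by congr (_ * _); apply: eq_bigr => i _; rewrite metric_sym. Qed.

Lemma mean_dist_triangle x y z N :
  mean_dist x z N <= mean_dist x y N + mean_dist y z N.
Proof.
rewrite /mean_dist -mulrDr ler_wpM2l ?invr_ge0// -big_split/=.
by apply: ler_sum => i _; exact: metric_triangle.
Qed.

Lemma mean_dist_continuous (f g : X -> X) N : continuous f -> continuous g ->
  continuous (fun x => mean_dist (f x) (g x) N).
Proof.
move=> cf cg x; apply: cvgM; first exact: cvg_cst.
elim: N => [|N ih].
  rewrite big_geq//; under eq_fun do rewrite big_geq//.
  exact: cvg_cst.
rewrite big_nat_recr//=; under eq_fun do rewrite big_nat_recr//=.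
apply: cvgD => //; apply: (@mdist_fun_continuous (iter N (tmap X) \o f)
    (iter N (tmap X) \o g)) => y;
  apply: continuous_comp; [exact: cf|exact: iter_continuous|exact: cg|
  exact: iter_continuous].
Qed.

(** Shifting by one step changes the sum of distances by one term at each end. *)
Lemma mean_dist_shift (D : R) : (forall x y, mdist x y <= D) ->
  forall k x y N, `|mean_dist (iter k (tmap X) x) (iter k (tmap X) y) N -
    mean_dist x y N| <= k%:R * D / N%:R.
Proof.
move=> dD; have d0 := mdist_ge0.
have S1 x y N : `|\sum_(0 <= i < N) mdist (iter i (tmap X) (tmap X x)) (iter i (tmap X) (tmap X y)) -
    \sum_(0 <= i < N) mdist (iter i (tmap X) x) (iter i (tmap X) y)| <= D.
  set a := \sum_(0 <= i < N) _; set b := \sum_(0 <= i < N) _.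
  have : a + mdist x y = b + mdist (iter N (tmap X) x) (iter N (tmap X) y).
    rewrite /b -[RHS](@big_nat_recr _ _ _ _ _ (fun i => mdist (iter i (tmap X) x) (iter i (tmap X) y)))//.
    rewrite big_nat_recl// addrC; congr (_ + _).
    by apply: eq_bigr => i _; rewrite -!iterSr.
  have := dD x y; have := dD (iter N (tmap X) x) (iter N (tmap X) y).
  have := d0 _ _ x y; have := d0 _ _ (iter N (tmap X) x) (iter N (tmap X) y).
  by move=> *; rewrite ler_norml; apply/andP; split; lra.
have M1 x y N : `|mean_dist (tmap X x) (tmap X y) N - mean_dist x y N| <= D / N%:R.
  rewrite /mean_dist -mulrBr normrM ger0_norm ?invr_ge0//.
  by rewrite mulrC ler_wpM2r ?invr_ge0.
elim=> [|k ih] x y N; first by rewrite subrr normr0 !mul0r.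
have := ih x y N; have := M1 (iter k (tmap X) x) (iter k (tmap X) y) N.
rewrite -natr1 !mulrDl mul1r /= !ler_norml => /andP[? ?] /andP[? ?].
by apply/andP; split; lra.
Qed.

End compact_metric.

Section mean_close.
Context {R : realType} {X : tds R}.
Implicit Types x y z : X.

(** Eventual smallness, instead of a bound on the limit superior, turns the
relation into a countable combination of open conditions. *)
Definition mean_close (e : R) x y := \forall N \near \oo, mean_dist x y N < e.

Lemma mean_closeC e x y : mean_close e x y -> mean_close e y x.
Proof. by apply: filterS => N; rewrite mean_distC. Qed.

Lemma mean_close_triangle e1 e2 x y z :
  mean_close e1 x y -> mean_close e2 y z -> mean_close (e1 + e2) x z.
Proof.
move=> xy yz; near=> N; apply: le_lt_trans (mean_dist_triangle x y z N) _.
by apply: ltrD; near: N.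
Unshelve. all: by end_near. Qed.

Let shift_small k (e : R) : 0 < e -> \forall N \near \oo, forall x y,
  `|mean_dist (iter k (tmap X) x) (iter k (tmap X) y) N - mean_dist x y N| < e.
Proof.
move=> e0; have [D D0 dD] := @mdist_bounded R X.
have := @nbhs_infty_gtr R (k%:R * D / e); apply: filterS => N Ne x y.
apply: (le_lt_trans (mean_dist_shift dD k x y N)).
have N0 : 0 < N%:R :> R.
  apply: le_lt_trans Ne; apply: divr_ge0; last exact: ltW.
  by apply: mulr_ge0 => //; exact: ltW.
by rewrite ltr_pdivrMr// [ltRHS]mulrC -ltr_pdivrMr.
Qed.

Lemma mean_close_iter e e' k x y : e < e' -> mean_close e x y ->
  mean_close e' (iter k (tmap X) x) (iter k (tmap X) y).
Proof.
move=> ee xy; have := shift_small k (_ : 0 < e' - e); rewrite subr_gt0 => /(_ ee).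
move=> ss; near=> N.
have h1 : mean_dist x y N < e by near: N.
have : forall x y, `|mean_dist (iter k (tmap X) x) (iter k (tmap X) y) N - mean_dist x y N| < e' - e by near: N.
by move=> /(_ x y); rewrite ltr_norml => /andP[]; lra.
Unshelve. all: by end_near. Qed.

Lemma mean_close_uniter e e' k x y : e < e' ->
  mean_close e (iter k (tmap X) x) (iter k (tmap X) y) -> mean_close e' x y.
Proof.
move=> ee xy; have := shift_small k (_ : 0 < e' - e); rewrite subr_gt0 => /(_ ee).
move=> ss; near=> N.
have h1 : mean_dist (iter k (tmap X) x) (iter k (tmap X) y) N < e by near: N.
have : forall x y, `|mean_dist (iter k (tmap X) x) (iter k (tmap X) y) N - mean_dist x y N| < e' - e by near: N.
by move=> /(_ x y); rewrite ltr_norml => /andP[]; lra.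
Unshelve. all: by end_near. Qed.

End mean_close.

Lemma orbit_closure_iter {R : realType} {X : tds R} (x : X) n (y : orbit_closure x) :
  set_val (iter n (tmap (orbit_closure x)) y) = iter n (tmap X) (set_val y).
Proof. by elim: n => //= n <-. Qed.

Lemma orbit_closure_mean_dist {R : realType} {X : tds R} (x : X) (y z : orbit_closure x) N :
  mean_dist y z N = mean_dist (set_val y : X) (set_val z) N.
Proof.
congr (_ * _); apply: eq_bigr => i _.
by rewrite -!orbit_closure_iter.
Qed.

(** What local mean equicontinuity says about the orbit of each single point. *)
Definition mean_returning {R : realType} (X : tds R) := forall (x : X) (e : R), 0 < e ->
  exists2 d : R, 0 < d & forall k, mdist x (iter k (tmap X) x) < d ->
    mean_close e x (iter k (tmap X) x).

(** Some iterate [p] brings [x], and every point near [x], close to a mean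
equicontinuous point [y] of the orbit closure.  If [x] and its [k]-th iterate are
close, their [p]-th iterates are both mean close to [y], hence to each other, and
the shift by [p] is invisible in the mean. *)
Lemma locally_mean_equicontinuous_returning {R : realType} (X : tds R) :
  locally_mean_equicontinuous X -> mean_returning X.
Proof.
move=> lX x e e0; have [G [_ dG Gme]] := lX x.
have [|y [_ Gy]] := dG setT _ openT; first exact: (tds_nonempty (orbit_closure x)).
have e4 : 0 < e / 4 by rewrite divr_gt0.
have [d d0 yd] := Gme y Gy _ e4.
have [_ [[p _ <-]]] := set_valP y _ (nbhsx_ballx (set_val y : X) _ d0).
move=> py.
have [d' d'0 xd'] : exists2 d', 0 < d' &
    forall z, mdist x z < d' -> mdist (set_val y : X) (iter p (tmap X) z) < d.
  have : nbhs (iter p (tmap X) x) (ball (set_val y : X) d).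
    rewrite ballEmdist/=; rewrite ballEmdist/= in py.
    apply/nbhs_ballP; exists (d - mdist (set_val y : X) (iter p (tmap X) x)).
      by rewrite /= subr_gt0.
    move=> z; rewrite ballEmdist/= => pz.
    by have := metric_triangle (set_val y : X) (iter p (tmap X) x) z; lra.
  move=> /(@iter_continuous _ X p x)/nbhs_ballP[d' d'0 d'x]; exists d' => // z xz.
  by have := d'x z; rewrite /= !ballEmdist/=; exact.
exists d' => // k xk.
have orbx n : closure (orb x) (iter n (tmap X) x).
  by apply: subset_closure; exists n.
have h n : mdist (set_val y : X) (iter n (tmap X) x) < d -> mean_close (e / 4) (set_val y : X) (iter n (tmap X) x).
  move=> yn; have := yd (exist _ (iter n (tmap X) x) (mem_set (orbx n)) : set_type (closure (orb x))) yn.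
  move=> /limn_esup_lt_near; apply: filterS => N /=.
  by rewrite orbit_closure_mean_dist lte_fin.
have : mean_close (e / 4 + e / 4) (iter p (tmap X) x) (iter p (tmap X) (iter k (tmap X) x)).
  apply: (mean_close_triangle (y := set_val y)).
    by apply/mean_closeC/h; rewrite ballEmdist in py.
  by rewrite -iterD; apply: h; rewrite iterD; exact: xd'.
by apply: mean_close_uniter; lra.
Qed.
(** * Total boundedness in the mean *)

(** If translates of a set of integers by the entries of [t] are disjoint, then
[size t] copies of the set fit into an interval that is longer by [m]. *)
Lemma disjoint_translates_bound (P : pred nat) (t : seq nat) (m N : nat) :
  (forall i, (i < size t)%N -> (nth 0%N t i <= m)%N) ->
  (forall i j k l, (i < j < size t)%N -> P k -> P l ->
     (k + nth 0 t i)%N <> (l + nth 0 t j)%N) ->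
  (size t * \sum_(0 <= k < N) P k <= N + m)%N.
Proof.
move=> tm tdisj; set q := size t.
have [->|N0] := posnP N; first by rewrite big_geq// muln0.
pose S := [pred p : 'I_q * 'I_N | P p.2].
pose f (p : 'I_q * 'I_N) : 'I_(N + m).+1 := inord (p.2 + nth 0 t p.1)%N.
have fE p : (f p : nat) = (p.2 + nth 0 t p.1)%N.
  by rewrite inordK// ltnS leq_add ?tm// ltnW.
have finj : {in S &, injective f}.
  move=> [i k] [j l]; rewrite !inE /= => Pk Pl /(congr1 val)/=; rewrite !fE/=.
  have [ij|ji|/val_inj ->] := ltngtP i j => h.
  - by exfalso; apply: (tdisj i j k l _ Pk Pl h); rewrite ij ltn_ord.
  - by exfalso; apply: (tdisj j i l k _ Pl Pk (esym h)); rewrite ji ltn_ord.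
  - by move/addIn: h => /val_inj ->.
have SE : #|S| = (q * \sum_(0 <= k < N) P k)%N.
  rewrite -sum1_card (eq_bigl (fun p : 'I_q * 'I_N => xpredT p.1 && P p.2))//.
  rewrite -(pair_big xpredT (fun k : 'I_N => P k) (fun _ _ => 1%N))/=.
  rewrite sum_nat_const card_ord big_mkord; congr (_ * _)%N.
  by rewrite big_mkcond/=; apply: eq_bigr => k _; case: (P k).
rewrite -SE -(card_in_image finj).
pose W := [pred i : 'I_(N + m).+1 | (i < N + m)%N].
apply: (@leq_trans #|W|).
  apply: subset_leq_card; apply/fintype.subsetP => _ /mapP[[i k] _ ->].
  by rewrite inE fE/= -addSn leq_add ?tm.
rewrite -sum1_card (eq_bigl (fun i : 'I_(N + m).+1 => (i < N + m)%N))//.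
by rewrite big_ord_narrow//= sum1_card card_ord.
Qed.

Section mean_totally_bounded.
Context {R : realType} {X : tds R}.
Implicit Types x y : X.
Local Notation T n := (iter n (tmap X)).

Definition mean_totally_bounded (e : R) x :=
  exists L, forall n, exists2 r, (r < L)%N & mean_close e (T n x) (T r x).

(** The points for which one [d] works in the returning property for [e]; in a
mean returning system these sets exhaust the space as [d] tends to 0. *)
Definition return_domain (e d : R) := [set x : X | forall k,
  mdist x (T k x) < d -> mean_close e x (T k x)].

(** Greedy choice: each new time is not mean close to any time up to the largest
one chosen so far. *)
Lemma not_mean_totally_bounded e x : ~ mean_totally_bounded e x ->
  forall q, exists t : seq nat, size t = q /\
    forall i j, (i < j < size t)%N ->
      ~ mean_close e (T (nth 0%N t i) x) (T (nth 0%N t j) x).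
Proof.
move=> ntb; elim=> [|q [t [tq tP]]]; first by exists [::]; split=> // i j; rewrite andbF.
have [n nP] : exists n, forall r, (r < (\max_(r <- t) r).+1)%N -> ~ mean_close e (T n x) (T r x).
  apply: contrapT => /forallNP h; apply: ntb; exists (\max_(r <- t) r).+1 => n.
  by have /existsNP[r /not_implyP[rL /contrapT]] := h n; exists r.
exists (n :: t); split => [|[|i] [|j]]//=; first by rewrite tq.
  move=> jt; apply: nP; rewrite ltnS.
  by rewrite (big_rem (nth 0%N t j)) ?mem_nth//= leq_max leqnn.
by move=> ij; apply: tP.
Qed.

Definition null_density (A : set X) x := forall e : R, 0 < e ->
  \forall N \near \oo, orbit_count A N x <= e * N%:R.

Lemma orbit_countE (A : set X) N x :
  orbit_count A N x = (\sum_(0 <= k < N) (T k x \in A))%:R :> R.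
Proof. by rewrite natr_sum; apply: eq_bigr => k _; rewrite indicE. Qed.

Lemma orbit_count_iter (A : set X) N k x :
  orbit_count A N x <= orbit_count A N (T k x) + k%:R.
Proof.
elim: k => [|k ih]; first by rewrite addr0.
have := orbit_count_shift A N (T k x); rewrite ler_norml => /andP[h _].
by rewrite -natr1 /=; lra.
Qed.

(** A common point of two translates of the return times, by [ti] and [tj], would
make the iterates of [x] at times [ti] and [tj] mean close, through two returns
to [x]; so the translates by pairwise far times are disjoint, and arbitrarily many
disjoint translates force density zero. *)
Lemma not_mean_totally_bounded_null_density e d c x : 0 < e ->
  ball c (d / 2) x -> return_domain e d x -> ~ mean_totally_bounded (4 * e) x ->
  null_density (return_domain e d `&` ball c (d / 2)) x.
Proof.
move=> e0 cx Dx ntb; set Q := _ `&` _.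
have close k : T k x \in Q -> mean_close e x (T k x).
  rewrite inE => -[_ ck]; apply: Dx; move: cx ck; rewrite !ballEmdist/= => cx ck.
  have := metric_triangle x c (T k x); rewrite (metric_sym x c).
  by move: cx ck; lra.
move=> a a0; pose q := (Num.truncn (2 / a)).+1.
have qa : 2 / a < q%:R by rewrite truncnS_gt.
have [t [tq tP]] := not_mean_totally_bounded ntb q.
pose m := (\max_(r <- t) r)%N.
have bound N : (size t * \sum_(0 <= k < N) (T k x \in Q) <= N + m)%N.
  apply: disjoint_translates_bound => [i it|i j k l ij kQ lQ h].
    by rewrite /m (big_rem (nth 0%N t i)) ?mem_nth//= leq_max leqnn.
  apply: (tP i j ij); set ti := nth 0%N t i in h *; set tj := nth 0%N t j in h *.
  have -> : 4 * e = 2 * e + 2 * e by lra.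
  have e2 : e < 2 * e by lra.
  apply: (@mean_close_triangle _ _ _ _ _ (T (k + ti)%N x)).
    by rewrite addnC iterD; exact: (mean_close_iter _ e2 (close _ kQ)).
  rewrite h addnC iterD; apply: mean_closeC.
  exact: (mean_close_iter _ e2 (close _ lQ)).
exists m => // N /= mN.
have q0 : 0 < q%:R :> R by rewrite ltr0n.
have : q%:R * orbit_count Q N x <= N%:R + N%:R.
  rewrite orbit_countE -natrM -natrD ler_nat -tq.
  by rewrite (leq_trans (bound N))// leq_add2l.
have h : N%:R + N%:R <= q%:R * (a * N%:R).
  have -> : N%:R + N%:R = 2 * N%:R :> R by lra.
  by rewrite mulrA ler_wpM2r//; move: qa; rewrite ltr_pdivrMr// => /ltW.
by move=> /le_trans/(_ h); rewrite ler_pM2l.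
Qed.

Lemma mean_dist_open e N n r : open [set x | mean_dist (T n x) (T r x) N < e].
Proof.
apply: (@open_comp X R (fun x => mean_dist (T n x) (T r x) N) [set y | y < e]).
  by move=> x _; apply: mean_dist_continuous; exact: iter_continuous.
exact: open_lt.
Qed.

Lemma mean_close_measurable e n r :
  measurable ([set x | mean_close e (T n x) (T r x)] : set (borel X)).
Proof.
rewrite (_ : mkset _ = \bigcup_N0 \bigcap_(N in [set N | (N0 <= N)%N])
    [set x | mean_dist (T n x) (T r x) N < e]).
  apply: bigcupT_measurable => N0; apply: bigcap_measurable; first by exists N0; rewrite /= leqnn.
  by move=> N _; apply: open_borel; exact: mean_dist_open.
apply/seteqP; split=> x; first by move=> [N0 _ h]; exists N0.
by move=> [N0 _ h]; exists N0.
Qed.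

Lemma mean_totally_bounded_bigcup e : [set x | mean_totally_bounded e x] =
  \bigcup_L \bigcap_n \bigcup_(r in [set r | (r < L)%N])
    [set x | mean_close e (T n x) (T r x)].
Proof.
apply/seteqP; split=> x.
  by move=> [L h]; exists L => // n _; have [r rL xr] := h n; exists r.
by move=> [L _ h]; exists L => n; have [r rL xr] := h n I; exists r.
Qed.

Lemma uniform_mean_totally_bounded_measurable e L : measurable
  (\bigcap_n \bigcup_(r in [set r | (r < L)%N])
    [set x | mean_close e (T n x) (T r x)] : set (borel X)).
Proof.
apply: bigcapT_measurable => n; apply: bigcup_measurable => r _.
exact: mean_close_measurable.
Qed.

Lemma mean_totally_bounded_measurable e :
  measurable ([set x | mean_totally_bounded e x] : set (borel X)).
Proof.
rewrite mean_totally_bounded_bigcup; apply: bigcupT_measurable => L.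
exact: uniform_mean_totally_bounded_measurable.
Qed.

Lemma return_domain_measurable e d :
  measurable (return_domain e d : set (borel X)).
Proof.
rewrite (_ : return_domain e d = \bigcap_k
  (~` [set x | mdist x (T k x) < d] `|` [set x | mean_close e (T 0 x) (T k x)])).
  apply: bigcapT_measurable => k; apply: measurableU.
    apply: measurableC; apply: open_borel.
    apply: (@open_comp X R (fun x => mdist x (T k x)) [set y | y < d]).
      move=> x _; apply: (@mdist_fun_continuous _ _ id); last exact: iter_continuous.
      by move=> y; exact: cvg_id.
    exact: open_lt.
  exact: mean_close_measurable.
apply/seteqP; split=> [x Dx k _ /=|x Dx k].
  by have [/Dx|] := pselect (mdist x (T k x) < d); [right|left].
by move=> xk; have [] := Dx k I.
Qed.

Section almost_everywhere.
Context (mu : probability (borel X) R) (muT : invariant_measure mu).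

Lemma iter_preimage_measurable (A : set (borel X)) n : measurable A ->
  measurable (iter n (tmap X) @^-1` A : set (borel X)).
Proof.
move=> mA; elim: n => [//|n ih]; rewrite (_ : _ @^-1` _ = tmap X @^-1` (T n @^-1` A)).
  exact: tmap_borel.
by apply/funext => x; rewrite /preimage/mkset iterSr.
Qed.

Lemma iter_preimage_measure (A : set (borel X)) n : measurable A ->
  mu (iter n (tmap X) @^-1` A) = mu A.
Proof.
move=> mA; elim: n => [//|n ih]; rewrite (_ : _ @^-1` _ = tmap X @^-1` (T n @^-1` A)).
  by rewrite muT//; exact: iter_preimage_measurable.
by apply/funext => x; rewrite /preimage/mkset iterSr.
Qed.

Lemma integral_orbit_count (A : set (borel X)) N : measurable A ->
  (\int[mu]_(x in setT) (orbit_count (A : set X) N x)%:E = N%:R%:E * mu A)%E.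
Proof.
move=> mA; under eq_integral do rewrite /orbit_count -sumEFin.
have mA' n := iter_preimage_measurable n mA.
rewrite (@ge0_integral_sum _ (borel X) R mu setT measurableT nat
   (fun n x => (\1_(T n @^-1` A) x)%:E)).
- rewrite (eq_bigr (fun=> mu A)); last first.
    move=> n _; rewrite integral_indic// setIT; exact: iter_preimage_measure.
  elim: N => [|N ih]; first by rewrite big_geq// mul0e.
  by rewrite big_nat_recr//= ih -natr1 EFinD ge0_muleDl ?lee_fin// mul1e.
- move=> n; apply/measurable_EFinP; exact: measurable_indic.
- by move=> n x _; rewrite lee_fin; have /andP[] := indic01 (R := R) (T n @^-1` A) x.
Qed.

Lemma orbit_count_measurable (A : set (borel X)) N : measurable A ->
  measurable_fun setT (orbit_count (A : set X) N : borel X -> R).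
Proof.
move=> mA; apply: (@measurable_sum _ (borel X) R setT nat (index_iota 0 N)
  (fun k (x : borel X) => \1_A (T k x) : R)) => n.
exact: (measurable_indic (iter_preimage_measurable n mA)).
Qed.

(** The frequency of visits to [A] has integral [mu A] at each time, while it tends
to 0 everywhere: a point that never visits [A] has frequency 0, and a point that
does inherits the density of the point of [A] that it reaches. *)
Lemma null_density_measure0 (A : set (borel X)) : measurable A ->
  (forall x, A x -> null_density A x) -> mu A = 0%E.
Proof.
move=> mA A0.
have nd x : null_density A x.
  have [[k Ak]|nA] := pselect (exists k, A (T k x)); last first.
    move=> e e0; apply: nearW => N; rewrite orbit_countE big1.
      exact: mulr_ge0 (ltW e0) (ler0n _ _).
    by move=> k _; apply/eqP; rewrite eqb0; apply/negP; rewrite inE => ?; apply: nA; exists k.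
  move=> e e0; have e2 : 0 < e / 2 by rewrite divr_gt0.
  near=> N; have h1 : orbit_count A N (T k x) <= e / 2 * N%:R by near: N; exact: A0.
  have h2 : k%:R / (e / 2) < N%:R by near: N; exact: nbhs_infty_gtr.
  have := orbit_count_iter A N k x; move: h2; rewrite ltr_pdivrMr//.
  by lra.
pose f N (x : borel X) : \bar R := (N.+1%:R^-1 * orbit_count A N.+1 x)%:E.
have mf N : measurable_fun setT (f N).
  apply/measurable_EFinP; apply: measurable_funM => //.
  exact: orbit_count_measurable.
have f0 x : f ^~ x @ \oo --> 0%E.
  apply/fine_cvgP; split; first exact: nearW.
  apply/cvgr0Pnorm_le => e e0; have [M _ hM] := nd x e e0.
  exists M => // N /= MN; have N0 : 0 < N.+1%:R :> R by rewrite ltr0n.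
  rewrite ger0_norm ?mulr_ge0 ?invr_ge0 ?orbit_count_ge0//.
  by rewrite ler_pdivrMl// mulrC; apply: hM; rewrite /= ltnW.
have f1 N x : (`|f N x| <= (cst 1%E : borel X -> \bar R) x)%E.
  rewrite /f /= lee_fin ger0_norm ?mulr_ge0 ?invr_ge0 ?orbit_count_ge0//.
  by rewrite ler_pdivrMl ?ltr0n// mulr1 orbit_count_le.
have [||||_ _] := @dominated_convergence _ (borel X) R mu setT measurableT f (cst 0%E) (cst 1%E)
  mf.
- exact: measurable_cst.
- by apply: aeW => x _; exact: f0.
- exact: finite_measure_integrable_cst.
- by apply: aeW => x N _; exact: f1.
rewrite integral_cst// mul0e.
have intf N : (\int[mu]_(x in setT) f N x = mu A)%E.
  rewrite /f; under eq_integral do rewrite EFinM.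
  rewrite ge0_integralZl_EFin ?invr_ge0//; first 1 last.
  - by move=> x _; rewrite lee_fin orbit_count_ge0.
  - by apply/measurable_EFinP; exact: orbit_count_measurable.
  by rewrite integral_orbit_count// muleA -EFinM mulVf ?mul1e// pnatr_eq0.
move=> h; rewrite -[RHS](cvg_lim _ h)//; apply/esym/cvg_lim => //.
rewrite (_ : [sequence _]_n = cst (mu A)); first exact: cvg_cst.
by apply/funext => N; rewrite /= intf.
Unshelve. all: by end_near. 
Qed.

Context (Xret : mean_returning X).

(** By [mean_returning] and finite nets, the bad points are covered by countably
many sets to which [not_mean_totally_bounded_null_density] and
[null_density_measure0] apply. *)
Lemma ae_mean_totally_bounded (e : R) : 0 < e ->
  mu [set x | mean_totally_bounded e x] = 1%E.
Proof.
move=> e0; set TB := mkset _.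
have mTB : measurable (TB : set (borel X)) by exact: mean_totally_bounded_measurable.
pose e4 := e / 4; have e40 : 0 < e4 by rewrite divr_gt0.
have e4E : e = 4 * e4 by rewrite /e4; lra.
pose d j : R := j.+1%:R^-1; have d0 j : 0 < d j by rewrite invr_gt0.
have /choice[s sP] := fun j => @finite_net _ X (d j / 2) (divr_gt0 (d0 j) (ltr0Sn R 1)).
suff : mu.-negligible (~` TB : set (borel X)).
  move=> /(measure_negligible (measurableC mTB)) TB0.
  by have := probability_setC mu mTB; rewrite TB0 => /esym/eqP; rewrite sube_eq// add0e => /eqP.
have [x0 _] := tds_nonempty X.
pose B j i := ~` TB `&` (return_domain e4 (d j) `&` ball (nth x0 (s j) i) (d j / 2)).
have mB j i : measurable (B j i : set (borel X)).
  apply: measurableI; first exact: measurableC.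
  apply: measurableI; first exact: return_domain_measurable.
  by apply: open_borel; exact: mdist_ball_open.
have B0 j i : mu (B j i) = 0%E.
  apply: null_density_measure0; first exact: mB.
  move=> x [nx [Dx cx]]; rewrite /TB /= e4E in nx.
  have nd := not_mean_totally_bounded_null_density e40 cx Dx nx.
  move=> a a0; apply: filterS (nd a a0) => N; apply: le_trans.
  apply: ler_sum => k _; rewrite !indicE ler_nat.
  by case: (boolP (_ \in B j i)) => //; rewrite inE => -[_ ?]; rewrite mem_set.
have : mu.-negligible (\bigcup_j \bigcup_i B j i : set (borel X)).
  apply: negligible_bigcup => j; apply: negligible_bigcup => i.
  by exists (B j i); split; [exact: mB|exact: B0|].
apply: negligibleS => x nx.
have [dx dx0 xret] := Xret x e40.
have [j _ jd] := near_infty_natSinv_lt (PosNum dx0).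
have [c cs cx] := sP j x; exists j => //; exists (index c (s j)) => //.
split=> //; split; last by rewrite nth_index// ballEmdist.
by move=> k xk; apply: xret; apply: (lt_trans xk); exact: (jd j (leqnn j)).
Qed.

(** Continuity of the measure makes first [L] and then, for each [M], the time
[N0] uniform outside a set of measure [eta].  The order of the quantifiers is
essential: [L] is chosen before [M]. *)
Lemma uniform_mean_totally_bounded (e eta : R) : 0 < e -> 0 < eta ->
  exists L, forall M, exists N0, forall N, (N0 <= N)%N ->
    ((1 - eta)%:E < mu [set x | forall m, (m < M)%N ->
       exists2 r, (r < L)%N & (mean_dist (T m x) (T r x) N < e)%R])%E.
Proof.
move=> e0 eta0.
pose G L := \bigcap_n \bigcup_(r in [set r | (r < L)%N])
    [set x | mean_close e (T n x) (T r x)] : set (borel X).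
have mG L : measurable (G L) by exact: uniform_mean_totally_bounded_measurable.
have below (F : (set (borel X))^nat) : (forall i, measurable (F i)) ->
    {homo F : n m / (n <= m)%N >-> (n <= m)%O} ->
    ((1 - eta)%:E < mu (\bigcup_n F n))%E -> exists n, ((1 - eta)%:E < mu (F n))%E.
  move=> mF hF lt; have := nondecreasing_cvg_mu (mu := mu) mF (bigcupT_measurable _ mF) hF.
  move=> cF; have [n _ nP] := cF _ (open_nbhs_nbhs (conj (@open_ereal_gt_ereal R _) lt)).
  by exists n; exact: (nP n (leqnn n)).
have [|||L GL] := below G => //.
- move=> L L' LL'; apply/subsetPset => x h n _; have [r rL xr] := h n I.
  by exists r => //; exact: leq_trans LL'.
- rewrite -mean_totally_bounded_bigcup ae_mean_totally_bounded// lte_fin.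
  by rewrite gtrBl.
exists L => M.
pose H N0 := \bigcap_(m in [set m | (m < M)%N]) \bigcup_(r in [set r | (r < L)%N])
  \bigcap_(N in [set N | (N0 <= N)%N]) [set x | mean_dist (T m x) (T r x) N < e].
have mH N0 : measurable (H N0 : set (borel X)).
  apply: bigcap_measurableType => m _; apply: bigcup_measurable => r _.
  apply: bigcap_measurableType => N _.
  by apply: open_borel; exact: mean_dist_open.
have GH : G L `<=` \bigcup_N0 H N0.
  move=> x h.
  have /choice[N NP] m : exists N0, exists2 r, (r < L)%N & forall N, (N0 <= N)%N ->
      mean_dist (T m x) (T r x) N < e.
    by have [r rL [N0 _ hN]] := h m I; exists N0, r.
  exists (\max_(m < M) N m) => // m /= mM; have [r rL hr] := NP m.
  exists r => // n /= nN; apply: hr; apply: leq_trans nN.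
  exact: (leq_bigmax (Ordinal mM)).
have [|||N0 HN0] := below H => //.
- move=> n n' nn'; apply/subsetPset => x h m mM; have [r rL xr] := h m mM.
  by exists r => // N n'N; apply: xr; exact: leq_trans n'N.
- apply: (lt_le_trans GL); apply: le_measure => //; rewrite inE//.
  exact: bigcupT_measurable.
exists N0 => N N0N; apply: (lt_le_trans HN0); apply: le_measure; rewrite ?inE//.
  rewrite (_ : mkset _ = \bigcap_(m in [set m | (m < M)%N]) \bigcup_(r in [set r | (r < L)%N])
     [set x | mean_dist (T m x) (T r x) N < e])//.
  apply: bigcap_measurableType => m _; apply: bigcup_measurable => r _.
  by apply: open_borel; exact: mean_dist_open.
by move=> x h m mM; have [r rL xr] := h m mM; exists r => //; exact: xr.
Qed.

End almost_everywhere.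

End mean_totally_bounded.

(** * Codes of orbit segments *)

Lemma big_nat_blocks (V : nmodType) (M Q : nat) (F : nat -> V) :
  \sum_(0 <= i < Q * M) F i = \sum_(0 <= k < Q) \sum_(0 <= s < M) F (k * M + s)%N.
Proof.
elim: Q => [|Q ih]; first by rewrite mul0n !big_geq.
rewrite big_nat_recr//= -ih mulSn addnC (big_cat_nat _ (n := (Q * M)%N))//=; last first.
  exact: leq_addr.
congr (_ + _); rewrite -{1}[(Q * M)%N]add0n big_addn addKn.
by apply: eq_bigr => i _; rewrite addnC.
Qed.

Lemma sum_le_const (R : realType) (n : nat) (f : nat -> R) (c : R) :
  (forall i, f i <= c) -> \sum_(0 <= i < n) f i <= n%:R * c.
Proof.
move=> fc; apply: (@le_trans _ _ (\sum_(0 <= i < n) c)); first exact: ler_sum.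
by rewrite sumr_const_nat subn0 mulr_natl.
Qed.

Lemma pigeonhole_sum (R : realType) (M : nat) (f : nat -> R) (c : R) : (0 < M)%N ->
  \sum_(0 <= s < M) f s <= M%:R * c -> exists2 s, (s < M)%N & f s <= c.
Proof.
move=> M0 fc; apply: contrapT => nex.
have fs s : (s < M)%N -> c < f s.
  by move=> sM; rewrite ltNge; apply/negP => fsc; apply: nex; exists s.
have : \sum_(0 <= s < M) c < \sum_(0 <= s < M) f s.
  by apply: ltr_sum_nat.
by rewrite sumr_const_nat subn0 -mulr_natl ltNge fc.
Qed.

(** A weighted injection bound: rare symbols get small weight, so the sum over all
words replaces an entropy estimate for the number of words with few rare
symbols. *)
Lemma weighted_card_le (R : realType) (T : eqType) (S : finType) (E : seq T)
    (f : T -> S) (w : S -> R) (a : R) :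
  uniq E -> {in E &, injective f} -> (forall s, 0 <= w s) ->
  (forall x, x \in E -> a <= w (f x)) -> (size E)%:R * a <= \sum_s w s.
Proof.
move=> uE fI w0 aw; apply: (@le_trans _ _ (\sum_(x <- E) w (f x))).
  rewrite mulr_natl -[leLHS]addr0 -iter_addr -count_predT -big_const_seq.
  by rewrite big_seq [leRHS]big_seq; apply: ler_sum.
rewrite -(big_map f xpredT w).
have uf : uniq (map f E) by rewrite map_inj_in_uniq.
rewrite big_uniq//= [leRHS](bigID (fun s => s \in map f E))/= lerDl.
by apply: sumr_ge0 => s _.
Qed.

Section codes.
Context {R : realType} {X : tds R}.
Implicit Types x y : X.
Local Notation T n := (iter n (tmap X)).
Context (D : R) (dD : forall x y, mdist x y <= D).

(** An offset of the blocks, for each position in a block the early iterate that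
it follows, and for each block a coarse position of these [L] iterates. *)
Definition block_alphabet M L Q C : finType :=
  ('I_M * ({ffun 'I_M -> 'I_L} * {ffun 'I_Q * 'I_L -> 'I_C}))%type.

Definition totally_bounded_block (e : R) L M N := [set x : X | forall m, (m < M)%N ->
  exists2 r, (r < L)%N & mean_dist (T m x) (T r x) N < e].

(** The mean over all offsets of the block sums is controlled by the mean distances
over the whole segment, so some offset is at most average. *)
Lemma totally_bounded_block_offset (e : R) L M Q x : (0 < M)%N -> (0 < Q)%N ->
  totally_bounded_block e L M (Q * M) x -> exists (p : 'I_M * {ffun 'I_M -> 'I_L}),
  \sum_(0 <= k < Q) \sum_(m < M) mdist (T (k * M + p.1 + m)%N x) (T (k * M + p.1 + p.2 m)%N x)
   <= (Q * M)%:R * e.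
Proof.
move=> M0 Q0 xU.
have /fin_all_exists[r rP] (m : 'I_M) : exists r : 'I_L, mean_dist (T m x) (T r x) (Q * M) < e.
  by have [r rL ?] := xU m (ltn_ord m); exists (Ordinal rL).
have N0 : 0 < (Q * M)%:R :> R by rewrite ltr0n muln_gt0 Q0.
have [|s sM sP] := @pigeonhole_sum R M (fun s => \sum_(0 <= k < Q) \sum_(m < M)
    mdist (T (k * M + s + m)%N x) (T (k * M + s + r m)%N x)) ((Q * M)%:R * e) M0.
  rewrite exchange_big/=.
  rewrite -(big_nat_blocks _ _ (fun i => \sum_(m < M) mdist (T (i + m)%N x) (T (i + r m)%N x))).
  rewrite exchange_big/= mulr_natl -[X in _ *+ X]card_ord -sumr_const.
  apply: ler_sum => m _; have := ltW (rP m); rewrite /mean_dist ler_pdivrMl//.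
  move=> h; apply: le_trans h.
  by apply: ler_sum => i _; rewrite !iterD.
by exists (Ordinal sM, [ffun m => r m]); under eq_bigr do under eq_bigr do rewrite ffunE.
Qed.

(** On average over the blocks, [x] at position [m] is close to [x] at position [r
m], which shares its cell with [y] at position [r m], which is close to [y] at
position [m].  The incomplete block before the offset costs at most [M * D].  *)
Lemma block_code (e : R) L M Q C (P : X -> 'I_C) : (0 < M)%N -> (0 < Q)%N -> (0 < L)%N ->
  (forall x y, P x = P y -> mdist x y <= e) -> M%:R * D <= (Q * M)%:R * e ->
  exists kappa : X -> block_alphabet M L Q C, forall x y,
    totally_bounded_block e L M (Q * M) x -> totally_bounded_block e L M (Q * M) y ->
    kappa x = kappa y ->
    \sum_(0 <= i < Q * M) mdist (T i x) (T i y) <= (Q * M)%:R * (4 * e).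
Proof.
move=> M0 Q0 L0 Pe MD; set U := totally_bounded_block _ _ _ _.
have /choice[f fP] x : exists p : 'I_M * {ffun 'I_M -> 'I_L}, U x ->
   \sum_(0 <= k < Q) \sum_(m < M) mdist (T (k * M + p.1 + m)%N x) (T (k * M + p.1 + p.2 m)%N x)
   <= (Q * M)%:R * e.
  have [/(totally_bounded_block_offset M0 Q0)[p pP]|nU] := pselect (U x); first by exists p.
  by exists (Ordinal M0, [ffun=> Ordinal L0]).
exists (fun x => ((f x).1, ((f x).2, [ffun q : 'I_Q * 'I_L => P (T (q.1 * M + (f x).1 + q.2)%N x)]))).
move=> x y Ux Uy []; have := fP x Ux; have := fP y Uy.
move: (f x) (f y) => [s r] [s' r'] /= + + ss rr; rewrite -{}ss -{}rr => fy fx /ffunP PP.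
have D0 : 0 <= D by apply: le_trans (mdist_ge0 x y) (dD x y).
have shifted : \sum_(0 <= j < Q * M) mdist (T (s + j)%N x) (T (s + j)%N y) <= 3 * ((Q * M)%:R * e).
  rewrite big_nat_blocks.
  apply: (@le_trans _ _ (\sum_(0 <= k < Q) \sum_(m < M)
    (mdist (T (k * M + s + m)%N x) (T (k * M + s + r m)%N x) + e +
     mdist (T (k * M + s + m)%N y) (T (k * M + s + r m)%N y)))).
    rewrite big_nat_cond [leRHS]big_nat_cond; apply: ler_sum => k /andP[/andP[_ kQ] _].
    rewrite big_mkord; apply: ler_sum => m _.
    rewrite (_ : (s + (k * M + m) = k * M + s + m)%N); last by rewrite addnCA addnA.
    set a := T _ x; set b := T _ y; set a' := T (_ + r m)%N x; set b' := T (_ + r m)%N y.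
    have PE : P a' = P b' by have := PP (Ordinal kQ, r m); rewrite !ffunE.
    have := metric_triangle a a' b; have := metric_triangle a' b' b.
    by have := Pe _ _ PE; rewrite (metric_sym b'); lra.
  under eq_bigr do rewrite !big_split/= sumr_const card_ord.
  rewrite !big_split/= sumr_const_nat subn0 -mulrnA mulnC -(mulr_natl e); lra.
rewrite (le_trans (_ : _ <= s%:R * D + \sum_(0 <= j < Q * M) mdist (T (s + j)%N x) (T (s + j)%N y)))//.
  apply: (@le_trans _ _ (\sum_(0 <= i < s + Q * M) mdist (T i x) (T i y))).
    rewrite [leRHS](big_cat_nat _ (n := (Q * M)%N))//=; last exact: leq_addl.
    by rewrite lerDl sumr_ge0// => i _; exact: mdist_ge0.
  rewrite (big_cat_nat _ (n := s))//=; last exact: leq_addr.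
  rewrite lerD//.
    exact: sum_le_const.
  rewrite -{1}[nat_of_ord s]add0n big_addn addKn.
  by apply: ler_sum => i _; rewrite addnC.
have : s%:R * D <= M%:R * D by rewrite ler_wpM2r// ler_nat ltnW.
by move: shifted MD; lra.
Qed.

End codes.

Section long_codes.
Context {R : realType} {X : tds R}.
Implicit Types x y : X.
Local Notation T n := (iter n (tmap X)).

(** The [N] offsets together visit each time at most once, so one of them is at most
average. *)
Lemma block_offset (A : set X) N J n x : (0 < N)%N -> (J.+1 * N <= n)%N ->
  exists2 t, (t < N)%N &
    N%:R * \sum_(0 <= j < J) (\1_A (T (j * N + t)%N x) : R) <= orbit_count A n x.
Proof.
move=> N0 JNn; have NR : 0 < N%:R :> R by rewrite ltr0n.
have [|t tN tP] := @pigeonhole_sum R N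
  (fun t => \sum_(0 <= j < J) \1_A (T (j * N + t)%N x)) (orbit_count A n x / N%:R) N0.
  rewrite mulrC divfK ?gt_eqF// exchange_big/=.
  rewrite -(big_nat_blocks _ _ (fun i => \1_A (T i x) : R)).
  have JN : (J * N <= n)%N by rewrite (leq_trans _ JNn)// leq_mul2r leqnSn orbT.
  rewrite /orbit_count [leRHS](big_cat_nat _ (n := (J * N)%N))//= lerDl.
  by apply: sumr_ge0 => i _; have /andP[] := indic01 (R := R) A (T i x).
by exists t => //; rewrite mulrC -ler_pdivlMr.
Qed.

(** A block that starts in [U] is described by [kappa], any other one by the coarse
positions of all its points. *)
Definition itinerary_code (W : Type) (U : set X) N J C (kappa : X -> W) (P : X -> 'I_C)
    (t : nat) x : {ffun 'I_J -> W + {ffun 'I_N -> 'I_C}} :=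
  [ffun j : 'I_J => if `[< U (T (j * N + t)%N x) >] then inl (kappa (T (j * N + t)%N x))
     else inr [ffun i : 'I_N => P (T (j * N + t + i)%N x)]].

Lemma itinerary_code_close (W : Type) (U : set X) N J C (kappa : X -> W) (P : X -> 'I_C)
    (D a : R) n t x y : (forall x y, mdist x y <= D) ->
  (t < N)%N -> (J.+1 * N <= n)%N ->
  (forall x y, U x -> U y -> kappa x = kappa y ->
    \sum_(0 <= i < N) mdist (T i x) (T i y) <= N%:R * a) ->
  (forall x y, P x = P y -> mdist x y <= a) ->
  itinerary_code U N J kappa P t x = itinerary_code U N J kappa P t y ->
  \sum_(0 <= i < n) mdist (T i x) (T i y) <= (n - J * N)%:R * D + (J * N)%:R * a.
Proof.
move=> dD tN JNn Ua Pa /ffunP xy.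
have tJN : (t + J * N <= n)%N.
  by rewrite (leq_trans _ JNn)// mulSn leq_add2r ltnW.
rewrite (big_cat_nat _ (n := t))//=; last by rewrite (leq_trans _ tJN)// leq_addr.
rewrite (big_cat_nat _ (n := (t + J * N)%N) (m := t))//=; last exact: leq_addr.
have -> : (n - J * N)%:R = t%:R + (n - (t + J * N))%:R :> R.
  by rewrite -natrD; congr _%:R; lia.
have h1 : \sum_(0 <= i < t) mdist (T i x) (T i y) <= t%:R * D by exact: sum_le_const.
have h3 : \sum_(t + J * N <= i < n) mdist (T i x) (T i y) <= (n - (t + J * N))%:R * D.
  rewrite -{1}[(t + J * N)%N]add0n big_addn; exact: sum_le_const.
have h2 : \sum_(t <= i < t + J * N) mdist (T i x) (T i y) <= (J * N)%:R * a.
  rewrite -{1}[t]add0n big_addn addKn big_nat_blocks natrM -mulrA.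
  rewrite big_mkord mulr_natl -[X in _ *+ X]card_ord -sumr_const.
  apply: ler_sum => j _; have := xy j; rewrite !ffunE.
  case: asboolP => Ux; case: asboolP => Uy // [].
    move=> /(Ua _ _ Ux Uy) h; apply: le_trans h.
    by apply: ler_sum => i _; rewrite -!iterD addnA (addnC i).
  move=> /ffunP PP; apply: (@le_trans _ _ (\sum_(0 <= i < N) a)).
    rewrite big_nat_cond [leRHS]big_nat_cond; apply: ler_sum => i /andP[/andP[_ iN] _].
    apply: Pa; have := PP (Ordinal iN); rewrite !ffunE/=.
    by rewrite addnAC.
  by rewrite sumr_const_nat subn0 mulr_natl.
by rewrite mulrDl; lra.
Qed.

Lemma sum_word_weight (I B : finType) (w : B -> R) :
  \sum_(f : {ffun I -> B}) \prod_i w (f i) = (\sum_b w b) ^+ #|I|.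
Proof. by rewrite -(bigA_distr_bigA (fun _ b => w b))/= prodr_const. Qed.

(** Each [x] of [E] is encoded by its itinerary and by the cells [P'] of its
iterates at the times where it is farther than [eps / 2] from a fixed representative
of its itinerary.  This is injective: two points with the same code differ by more
than [eps] at some time, and at that time at least one of them is far from the
representative, hence both are, and they lie in the same cell, so within [eps].  A
block that starts outside [U] has weight [C%:R ^- N] per word, so that all such
words weigh 1 together, and a far time has weight [expR (- lam)] per cell.  The
number of far times is at most [2 / eps] times the sum of distances to the
representative, by Markov's inequality.  *)
Lemma separated_card_bound (W : finType) (U : set X) N J C C' (kappa : X -> W)
    (P : X -> 'I_C) (P' : X -> 'I_C') (D a bb eps lam : R) n (E : seq X) :
  (0 < N)%N -> (0 < C)%N -> (J.+1 * N <= n)%N -> 0 < eps -> 0 <= lam ->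
  (forall x y, mdist x y <= D) ->
  (forall x y, U x -> U y -> kappa x = kappa y ->
    \sum_(0 <= i < N) mdist (T i x) (T i y) <= N%:R * a) ->
  (forall x y, P x = P y -> mdist x y <= a) ->
  (forall x y, P' x = P' y -> mdist x y <= eps) ->
  uniq E ->
  (forall x y, x \in E -> y \in E -> x != y -> exists2 i, (i < n)%N & eps < mdist (T i x) (T i y)) ->
  (forall x, x \in E -> orbit_count (~` U) n x <= bb) ->
  (size E)%:R * (expR (- (ln C%:R * bb)) *
    expR (- (lam * (2 / eps * ((n - J * N)%:R * D + (J * N)%:R * a)))))
  <= N%:R * (#|W|.+1)%:R ^+ J * (1 + C'%:R * expR (- lam)) ^+ n.
Proof.
move=> N0 C0 JNn eps0 lam0 dD Ua Pa P'e uE Esep Ebad.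
set S0 := _ * D + _ * a.
have /choice[t tP] x : exists t : 'I_N,
    N%:R * \sum_(0 <= j < J) (\1_(~` U) (T (j * N + t)%N x) : R) <= orbit_count (~` U) n x.
  by have [t tN tP] := block_offset (~` U) x N0 JNn; exists (Ordinal tN).
pose code x := (t x, itinerary_code U N J kappa P (t x) x).
have [x0 _] := tds_nonempty X.
have /choice[rep repP] s : exists z, forall x, code x = s -> code z = s.
  have [[z zs]|nz] := pselect (exists z, code z = s); first by exists z.
  by exists x0 => x xs; exfalso; apply: nz; exists x.
have codeP x : \sum_(0 <= i < n) mdist (T i x) (T i (rep (code x))) <= S0.
  have := repP (code x) x erefl; set z := rep _ => -[tz cz].
  apply: (itinerary_code_close dD (ltn_ord (t x)) JNn Ua Pa).
  by rewrite -cz tz.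
pose far x (i : 'I_n) := eps / 2 < mdist (T i x) (T i (rep (code x))).
pose f x := (code x, [ffun i : 'I_n => if far x i then inr (P' (T i x)) else inl tt : unit + 'I_C']).
have fI : {in E &, injective f}.
  move=> x y xE yE [ctx cx /ffunP PP]; have cxy : code x = code y by rewrite /code cx ctx.
  apply: contrapT => /eqP xy; have [i lin] := Esep _ _ xE yE xy.
  have := PP (Ordinal lin); rewrite !ffunE /far/= -cxy.
  set z := rep _; case: ltP => h1; case: ltP => h2 //.
    by move=> [] /P'e; rewrite leNgt => /negP.
  move=> _; have := metric_triangle (T i x) (T i z) (T i y).
  by rewrite (metric_sym (T i z)); lra.
pose w1 (b : W + {ffun 'I_N -> 'I_C}) : R := if b is inl _ then 1 else expR (- (N%:R * ln C%:R)).
pose w2 (b : unit + 'I_C') : R := if b is inl _ then 1 else expR (- lam).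
pose w (s : ('I_N * {ffun 'I_J -> W + {ffun 'I_N -> 'I_C}}) * {ffun 'I_n -> unit + 'I_C'}) : R :=
  (\prod_j w1 (s.1.2 j)) * \prod_i w2 (s.2 i).
have C1 : 0 < C%:R :> R by rewrite ltr0n.
have sum_w1 : \sum_b w1 b = (#|W|.+1)%:R.
  rewrite big_sumType/= !sumr_const -natr1 card_ffun !card_ord; congr (_ + _).
  rewrite expRN expRM_natl lnK ?posrE// -[LHS]mulr_natl natrX mulfV//.
  by rewrite gt_eqF// exprn_gt0.
have sum_w2 : \sum_b w2 b = 1 + C'%:R * expR (- lam).
  by rewrite big_sumType/= !sumr_const card_unit card_ord mulr_natl.
have <- : \sum_s w s = N%:R * (#|W|.+1)%:R ^+ J * (1 + C'%:R * expR (- lam)) ^+ n.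
  rewrite -(pair_big xpredT xpredT
    (fun (p : 'I_N * {ffun 'I_J -> W + {ffun 'I_N -> 'I_C}}) (q : {ffun 'I_n -> unit + 'I_C'}) =>
     (\prod_j w1 (p.2 j)) * \prod_i w2 (q i)))/=.
  under eq_bigr do rewrite -mulr_sumr.
  rewrite -mulr_suml -(pair_big xpredT xpredT
    (fun (_ : 'I_N) (q : {ffun 'I_J -> W + {ffun 'I_N -> 'I_C}}) => \prod_j w1 (q j)))/=.
  by rewrite sumr_const card_ord !sum_word_weight !card_ord sum_w1 sum_w2 -[_ *+ N]mulr_natl.
apply: (weighted_card_le uE fI).
  move=> s; apply: mulr_ge0; apply: prodr_ge0 => i _.
    by rewrite /w1; case: (s.1.2 i) => // ?; exact: expR_ge0.
  by rewrite /w2; case: (s.2 i) => // ?; exact: expR_ge0.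
move=> x xE; rewrite /w /=; apply: ler_pM; rewrite ?expR_ge0//.
  rewrite (eq_bigr (fun j : 'I_J => expR (- (N%:R * ln C%:R) * \1_(~` U) (T (j * N + t x)%N x)))).
    rewrite -expR_sum ler_expR -mulr_sumr mulNr lerN2 [_ * ln _]mulrC -mulrA.
    rewrite ler_wpM2l ?ln_ge0 ?ler1n//.
    rewrite -(big_mkord xpredT (fun j => \1_(~` U) (T (j * N + t x)%N x) : R)).
    exact: le_trans (tP x) (Ebad x xE).
  move=> j _; rewrite ffunE indicE; case: asboolP => Ux /=.
    by rewrite memNset ?mulr0 ?expR0//=; apply.
  by rewrite mem_set ?mulr1.
rewrite (eq_bigr (fun i : 'I_n => expR (- lam * (far x i)%:R))).
  rewrite -expR_sum ler_expR -mulr_sumr mulNr lerN2 ler_wpM2l//.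
  rewrite -ler_pdivrMl ?divr_gt0// invf_div.
  apply: le_trans (codeP x); rewrite big_mkord mulr_sumr; apply: ler_sum => i _.
  rewrite /far; case: ltP => [/ltW|] /=; rewrite ?mulr1 ?mulr0// => _; exact: mdist_ge0.
by move=> i _; rewrite ffunE; case: (far x i); rewrite /= ?mulr1 ?mulr0 ?expR0.
Qed.

End long_codes.

(** * Zero entropy *)

Lemma leq_add3 a b c : [/\ (a <= (a + b + c).+1)%N, (b <= (a + b + c).+1)%N &
  (c <= (a + b + c).+1)%N].
Proof. by split; lia. Qed.

Lemma leq_sum3 a b c j n : (a + b + c <= j)%N -> (j < n)%N ->
  [/\ (a <= n)%N, (b <= n)%N & (c <= n)%N].
Proof. by move=> *; split; lia. Qed.

Lemma floor_blocks n N : (0 < N)%N -> (N <= n)%N ->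
  ((n %/ N).-1.+1 * N <= n)%N /\ (n - (n %/ N).-1 * N <= 2 * N)%N.
Proof.
move=> N0 Nn; have q0 : (0 < n %/ N)%N by rewrite divn_gt0.
rewrite prednK// leq_trunc_div; split => //.
by have := ltn_ceil n N0; rewrite -{1}(prednK q0) !mulSn; lia.
Qed.

Section zero_entropy.
Context {R : realType} {X : tds R}.
Implicit Types x y : X.
Local Notation T n := (iter n (tmap X)).

Lemma nat_above (x : R) : exists n, forall m, (n <= m)%N -> x <= m%:R.
Proof.
exists (Num.truncn x).+1 => m nm; apply: (le_trans (ltW (truncnS_gt x))).
by rewrite ler_nat.
Qed.

Lemma finite_code (g : R) : 0 < g ->
  exists2 C, (0 < C)%N & exists P : X -> 'I_C, forall x y, P x = P y -> mdist x y <= g.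
Proof.
move=> g0; have [s sP] := @finite_net R X (g / 2) (divr_gt0 g0 (ltr0Sn R 1)).
have [x0 _] := tds_nonempty X.
have /choice[c cP] x : exists c, c \in s /\ mdist c x < g / 2.
  by have [c cs cx] := sP x; exists c.
have ix x : (index (c x) s < size s)%N by rewrite index_mem; have [] := cP x.
exists (size s); first exact: leq_ltn_trans (ix x0).
exists (fun x => Ordinal (ix x)) => x y [] xy.
have cxy : c x = c y.
  by rewrite -(nth_index x0 (cP x).1) xy nth_index//; have [] := cP y.
have := metric_triangle x (c x) y; have [_] := cP x; have [_] := cP y.
by rewrite (metric_sym x (c x)) cxy; lra.
Qed.

Lemma lt_bigmax_nat (f : nat -> R) n (c : R) : 0 <= c ->
  c < \big[Num.max/0]_(0 <= i < n) f i -> exists2 i, (i < n)%N & c < f i.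
Proof.
move=> c0; rewrite big_seq; elim/big_ind: _ => [|a b iha ihb|i].
- by rewrite ltNge c0.
- by rewrite lt_max => /orP[].
- by rewrite mem_index_iota => /= ni ci; exists i.
Qed.

(** Strict inequality with a real [h] turns the extended values, including an infinite
separated number, into an actual finite set. *)
Lemma entropy_at_scale_gt0 (eps : R) : (0 < entropy_at_scale X eps)%E ->
  exists2 h : R, 0 < h & forall n0, exists2 n, (n0 < n)%N &
    exists2 E : {fset X}, bowen_separated n eps E & expR (h * n%:R) < #|` E|%:R.
Proof.
move=> ent; have [h h0 hent] : exists2 h : R, 0 < h & (h%:E < entropy_at_scale X eps)%E.
  move: ent; case: (entropy_at_scale X eps) => [r||]//; last by exists 1; rewrite ?ltry.
  rewrite lte_fin => r0; exists (r / 2); first exact: divr_gt0.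
  by rewrite lte_fin ltr_pdivrMr// ltr_pMr// ltr1n.
exists h => // n0; have [n n0n hn] := limn_esup_gt_frequently hent n0.+1.
exists n => //; have n1 : (0 < n)%N by exact: leq_ltn_trans n0n.
have nR : 0 < n%:R :> R by rewrite ltr0n.
have hs : ((expR (h * n%:R))%:E < separated_number X n eps)%E.
  have {hn} : ((h * n%:R)%:E < lne (separated_number X n eps))%E.
    move: hn; case: (lne _) => [r||].
    - by rewrite -EFinM !lte_fin mulrC ltr_pdivlMr.
    - by rewrite ltry.
    - by rewrite gt0_muleNy ?lte_fin ?invr_gt0.
  have : (0 <= separated_number X n eps)%E.
    by apply: ereal_sup_ubound; exists fset0; [|rewrite cardfs0].
  case: (separated_number X n eps) => [r|_ _|]; [|by rewrite ltry|by []].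
  rewrite lee_fin le_eqVlt => /orP[/eqP <-|r0]; first by rewrite le0_lneNy.
  by rewrite lne_EFin// !lte_fin -ltr_expR lnK.
by have [_ [E Esep <-] hE] := ereal_sup_gt hs; exists E.
Qed.

Lemma entropy_at_scale_ge0 (eps : R) : (0 <= entropy_at_scale X eps)%E.
Proof.
apply: le_ereal_inf_tmp => _ [A Aoo <-].
have [n An] := filter_ex Aoo.
apply: (@le_trans _ _ ((n%:R^-1)%:E * lne (separated_number X n eps))%E).
  rewrite mule_ge0 ?lee_fin ?invr_ge0// lne_ge0.
  have [x0 _] := tds_nonempty X.
  apply: ereal_sup_ubound; exists [fset x0]%fset; last by rewrite cardfs1.
  by move=> x y; rewrite !inE => /eqP -> /eqP ->; rewrite eqxx.
by apply: ereal_sup_ubound; exists n.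
Qed.

Lemma card_block_alphabet M L Q C : #|block_alphabet M L Q C| = (M * (L ^ M * C ^ (Q * L)))%N.
Proof. by rewrite !card_prod !card_ffun !card_ord card_prod !card_ord. Qed.

(** The offset and the map to early iterates have bounded cost as [Q] grows, and the
[Q * L] coarse positions cost little as soon as [M] dominates [L * ln C]. *)
Lemma ln_block_alphabet (d : R) M L Q C : (0 < M)%N -> (0 < L)%N -> (0 < C)%N ->
  L%:R * ln C%:R <= M%:R * d ->
  ln 2 + ln M%:R + M%:R * ln L%:R <= d * Q%:R * M%:R ->
  ln (#|block_alphabet M L Q C|.+1)%:R <= 2 * d * (Q * M)%:R.
Proof.
move=> M0 L0 C0 LM MQ.
have p0 (k : nat) : (0 < k)%N -> (0 : R) < k%:R by rewrite ltr0n.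
have W0 : (0 < #|block_alphabet M L Q C|)%N.
  by rewrite card_block_alphabet !muln_gt0 !expn_gt0 M0 L0 C0.
apply: (@le_trans _ _ (ln (2 * #|block_alphabet M L Q C|)%N%:R)).
  have W2 k : (0 < k)%N -> (k.+1 <= 2 * k)%N by lia.
  by rewrite ler_ln ?posrE ?p0 ?muln_gt0 ?W0// ler_nat W2.
have L1 := p0 _ L0; have M1 := p0 _ M0; have C1 := p0 _ C0.
rewrite card_block_alphabet !natrM !natrX.
rewrite !lnM ?posrE ?mulr_gt0 ?exprn_gt0// !lnXn// -[ln L%:R *+ _]mulr_natl -[ln C%:R *+ _]mulr_natl.
have : Q%:R * (L%:R * ln C%:R) <= Q%:R * (M%:R * d) :> R by rewrite ler_wpM2l.
by move: MQ; rewrite natrM; lra.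
Qed.

(** Markov's inequality for the time spent outside [U]. *)
Lemma card_good_orbits (U : set X) (eta : R) (E : seq X) n : (0 < n)%N -> (0 < size E)%N ->
  uniq E -> 0 < eta -> 1 - eta < empirical E n U ->
  (size E)%:R / 2 <= (size [seq x <- E | orbit_count (~` U) n x <= 2 * eta * n%:R])%:R :> R.
Proof.
move=> n0 E0 uE eta0; rewrite /empirical.
have nR : 0 < n%:R :> R by rewrite ltr0n.
have ER : 0 < (size E)%:R :> R by rewrite ltr0n.
rewrite ltr_pdivlMl ?mulr_gt0// => avg.
have compl x : orbit_count (~` U) n x = n%:R - orbit_count U n x.
  apply/eqP; rewrite eq_sym subr_eq /orbit_count -big_split/=; apply/eqP.
  rewrite -[n in LHS]subn0 -(mulr1 (_ - _)%:R) mulr_natl -sumr_const_nat.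
  apply: eq_bigr => i _; rewrite !indicE in_setC.
  by case: (_ \in U); rewrite /= ?add0r ?addr0.
set good := fun x => _ <= _.
have cnt : (size [seq x <- E | good x])%:R + (size [seq x <- E | ~~ good x])%:R = (size E)%:R :> R.
  by rewrite -natrD !size_filter count_predC.
have bad : (2 * eta * n%:R) * (size [seq x <- E | ~~ good x])%:R <= eta * n%:R * (size E)%:R.
  apply: (@le_trans _ _ (\sum_(x <- E) orbit_count (~` U) n x)).
    rewrite (bigID good)/= -[leLHS]add0r lerD//.
      by apply: sumr_ge0 => x _; exact: orbit_count_ge0.
    rewrite -big_filter mulr_natr -[leLHS]addr0 -iter_addr -count_predT -big_const_seq.
    rewrite big_seq [leRHS]big_seq; apply: ler_sum => x.
    by rewrite mem_filter /good -ltNge => /andP[/ltW].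
  under eq_bigr do rewrite compl.
  rewrite sumrB big_const_seq count_predT iter_addr addr0 -mulr_natr; lra.
have : 2 * (size [seq x <- E | ~~ good x])%:R <= (size E)%:R :> R.
  by rewrite -(ler_pM2l (mulr_gt0 eta0 nR)); move: bad; lra.
by lra.
Qed.

Lemma open_forall_lt (A : nat -> set X) M : (forall m, open (A m)) ->
  open [set x | forall m, (m < M)%N -> A m x].
Proof.
move=> oA; elim: M => [|M ih].
  by rewrite (_ : mkset _ = setT); [exact: openT|apply/seteqP; split].
rewrite (_ : mkset _ = [set x | forall m, (m < M)%N -> A m x] `&` A M); first exact: openI.
apply/seteqP; split=> [x xA|x [xA AM] m].
  by split; [move=> m mM; apply: xA; exact: ltnW|exact: xA].
by rewrite ltnS leq_eqVlt => /orP[/eqP ->//|]; exact: xA.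
Qed.

(** Constants are chosen in the order [C'], [lam], [a], [C], [eta], [L], [M], [Q],
[n], so that the exponential costs in [separated_card_bound] add up to at most six
sixteenths of [h * n]. *)
Lemma mean_returning_entropy_at_scale (eps : R) : 0 < eps -> mean_returning X ->
  (entropy_at_scale X eps <= 0)%E.
Proof.
move=> eps0 Xret; rewrite leNgt; apply/negP => /entropy_at_scale_gt0[h h0 big].
have /choice[n nP] j : exists n, (j < n)%N /\ exists E : {fset X},
    bowen_separated n eps E /\ expR (h * n%:R) < #|` E|%:R.
  by have [n ? [E ? ?]] := big j; exists n; split => //; exists E.
have /choice[E EP] j := (nP j).2.
have jn j := (nP j).1.
have E0 j : (0 < size (E j : seq X))%N.
  by rewrite -(ltr0n R) (lt_trans _ (EP j).2)// expR_gt0.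
have [m mP] := empirical_mean_exists E0 jn.
pose mu := mean_probability m.
have muT : invariant_measure mu by exact: mean_probability_invariant.
have [D D0 dD] := @mdist_bounded R X.
have [C' C'0 [P' P'e]] := finite_code eps0.
(* makes the far times cost at most [h / 16] per unit of time *)
pose lam := 16 * C'%:R / h.
have lam0 : 0 <= lam by rewrite divr_ge0 ?mulr_ge0// ltW.
have C'lam : C'%:R * expR (- lam) <= h / 16.
  have lamE (c : R) : c = 16 * c / h * (h / 16) by field; rewrite gt_eqF.
  rewrite (lamE C'%:R) -/lam expRN ler_pdivrMr ?expR_gt0// mulrC ler_wpM2l ?divr_ge0 ?ltW//.
  by have := expR_ge1Dx lam; lra.
clearbody lam; pose a := h * eps / (64 * (lam + 1)).
have a0 : 0 < a by rewrite divr_gt0 ?mulr_gt0//; lra.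
have alam : lam * (2 / eps * (2 * a)) <= h / 16.
  rewrite /a [leLHS](_ : _ = (h / 16) * (lam / (lam + 1))); last first.
    by field; rewrite !gt_eqF//; lra.
  by rewrite ger_pMr ?divr_gt0// ler_pdivrMr; lra.
have e0 : 0 < a / 4 by rewrite divr_gt0.
(* [block_code] loses a factor 4 *)
have [C C0 [P Pe]] := finite_code e0.
have lnC0 : 0 <= ln C%:R :> R by rewrite ln_ge0// ler1n.
pose eta := h / (32 * (ln C%:R + 1)).
have eta0 : 0 < eta by rewrite divr_gt0// mulr_gt0//; lra.
have etaC : ln C%:R * (2 * eta) <= h / 16.
  rewrite /eta; move: (ln _) lnC0 => c c0.
  rewrite [leLHS](_ : _ = (h / 16) * (c / (c + 1))); last first.
    by field; rewrite gt_eqF//; lra.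
  by rewrite ger_pMr ?divr_gt0// ler_pdivrMr; lra.
have [L LP] := uniform_mean_totally_bounded muT Xret e0 eta0.
have [M1 M1P] := nat_above (L.+1%:R * ln C%:R / (h / 16)).
pose M := M1.+1.
have LM : L.+1%:R * ln C%:R <= M%:R * (h / 16).
  by rewrite -ler_pdivrMr ?divr_gt0// M1P// leqnSn.
have [N0 N0P] := LP M.
have [Q1 Q1P] := nat_above ((ln 2 + ln M%:R + M%:R * ln L.+1%:R) / (h / 16 * M%:R)).
have [Q2 Q2P] := nat_above (D / (a / 4)).
(* [Q1] amortizes the fixed part of the block code, [Q2] the incomplete blocks *)
pose Q := (Q1 + Q2 + N0).+1; have [Q1Q Q2Q N0Q] := leq_add3 Q1 Q2 N0.
have MR : 0 < M%:R :> R by rewrite ltr0n.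
have MQ : ln 2 + ln M%:R + M%:R * ln L.+1%:R <= h / 16 * Q%:R * M%:R.
  by rewrite [leRHS]mulrAC [leRHS]mulrC -ler_pdivrMr ?mulr_gt0 ?divr_gt0// Q1P.
have DQ : D <= Q%:R * (a / 4).
  by rewrite -ler_pdivrMr// Q2P.
pose N := (Q * M)%N.
have Npos : (0 < N)%N by rewrite muln_gt0.
have N0N : (N0 <= N)%N by rewrite (leq_trans N0Q)// leq_pmulr.
have MD : M%:R * D <= (Q * M)%:R * (a / 4).
  by rewrite natrM [Q%:R * _]mulrC -mulrA ler_wpM2l.
have [kappa kP] := block_code dD (isT : (0 < M)%N) (isT : (0 < Q)%N) (isT : (0 < L.+1)%N) Pe MD.
pose U := [set x : X | forall m, (m < M)%N ->
       exists2 r, (r < L)%N & (mean_dist (T m x) (T r x) N < a / 4)%R].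
have UL x : U x -> totally_bounded_block (a / 4) L.+1 M N x.
  by move=> Ux k kM; have [r rL xr] := Ux k kM; exists r => //; exact: ltnW.
(* openness transfers the lower bound from [mu] to the mean, hence to some [E j] *)
have oU : open U.
  rewrite (_ : U = [set x | forall m, (m < M)%N ->
    (\bigcup_(r in [set r | (r < L)%N]) [set x | mean_dist (T m x) (T r x) N < a / 4]) x]).
    by apply: open_forall_lt => k; apply: bigcup_open => r _; exact: mean_dist_open.
  by apply/seteqP; split => x Ux k kM; have [r rL xr] := Ux k kM; exists r.
have mU : 1 - eta < m U.
  rewrite -lte_fin; apply: (lt_le_trans (N0P N N0N)).
  exact: mean_probability_open.
have [j1 j1P] := nat_above (2 * N%:R * D / a).
have [j2 j2P] := nat_above ((ln 2 + ln N%:R) / (h / 16)).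
have [j jj javg] := mP _ _ mU (j1 + j2 + N)%N.
have jnj := jn j; set nn := n j in javg jnj.
have [j1n j2n Nn] := leq_sum3 jj jnj.
have nR : 0 < nn%:R :> R by rewrite ltr0n (leq_ltn_trans _ jnj).
have n1 : 2 * N%:R * D <= nn%:R * a.
  by rewrite -ler_pdivrMr// j1P.
have n2 : ln 2 + ln N%:R <= nn%:R * (h / 16).
  by rewrite -ler_pdivrMr ?divr_gt0// j2P.
pose J := (nn %/ N).-1.
have [JN nJ] := floor_blocks Npos Nn.
set E' := [seq x <- E j : seq X | orbit_count (~` U) nn x <= 2 * eta * nn%:R].
have nn0 : (0 < nn)%N by exact: leq_ltn_trans jnj.
have sE' := card_good_orbits nn0 (E0 j) (fset_uniq (E j)) eta0 javg.
have a4 : 4 * (a / 4) = a by lra.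
have bound := @separated_card_bound R X _ U N J C C' kappa P P' D a (2 * eta * nn%:R)
  eps lam nn E' Npos C0 JN eps0 lam0 dD.
have {bound} : (size E')%:R * (expR (- (ln C%:R * (2 * eta * nn%:R))) *
   expR (- (lam * (2 / eps * ((nn - J * N)%:R * D + (J * N)%:R * a))))) <=
   N%:R * #|block_alphabet M L.+1 Q C|.+1%:R ^+ J * (1 + C'%:R * expR (- lam)) ^+ nn.
  apply: bound => [x y Ux Uy xy|x y /Pe xy|//||x y|x].
  - by rewrite -a4; apply: kP => //; exact: UL.
  - by apply: (le_trans xy); lra.
  - by rewrite filter_uniq ?fset_uniq.
  - rewrite !mem_filter => /andP[_ xE] /andP[_ yE] xy.
    by apply: lt_bigmax_nat; [exact: ltW|exact: (EP j).1].
  - by rewrite mem_filter => /andP[].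
apply/negP; rewrite -ltNge; have hE := (EP j).2; rewrite -/nn in hE.
pose z := h / 16 * nn%:R.
have lowC : expR (- z) <= expR (- (ln C%:R * (2 * eta * nn%:R))).
  by rewrite ler_expR lerN2 mulrA ler_wpM2r ?ler0n.
have lowl : expR (- z) <= expR (- (lam * (2 / eps * ((nn - J * N)%:R * D + (J * N)%:R * a)))).
  rewrite ler_expR lerN2; apply: (@le_trans _ _ (lam * (2 / eps * (2 * a)) * nn%:R)); last first.
    by rewrite ler_wpM2r ?ler0n.
  rewrite [leRHS](_ : _ = lam * (2 / eps * (2 * a * nn%:R))); last by rewrite !mulrA.
  rewrite ler_wpM2l// ler_wpM2l ?divr_ge0 ?(ltW eps0)//.
  have : (nn - J * N)%:R * D <= (2 * N)%:R * D by rewrite ler_wpM2r ?ler_nat// ltW.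
  have : (J * N)%:R * a <= nn%:R * a.
    rewrite ler_wpM2r ?ler_nat ?(ltW a0)// (leq_trans _ JN)// leq_mul2r leqnSn orbT//.
  by rewrite natrM; lra.
have upW : #|block_alphabet M L.+1 Q C|.+1%:R ^+ J <= expR (2 * z).
  have := ln_block_alphabet (isT : (0 < M)%N) (isT : (0 < L.+1)%N) C0 LM MQ.
  set W := _.+1; rewrite -ler_expR lnK ?posrE ?ltr0n// => WN.
  apply: (@le_trans _ _ (expR (2 * (h / 16) * (Q * M)%:R) ^+ J)).
    by rewrite lerXn2r ?nnegrE ?ler0n ?expR_ge0.
  rewrite -expRM_natl ler_expR /z [leLHS]mulrCA [leRHS]mulrA.
  rewrite ler_wpM2l ?mulr_ge0 ?divr_ge0 ?(ltW h0)// -natrM ler_nat (leq_trans _ JN)// leq_mul2r leqnSn orbT//.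
have upC : (1 + C'%:R * expR (- lam)) ^+ nn <= expR z.
  apply: (@le_trans _ _ (expR (h / 16) ^+ nn)); last by rewrite /z expRM_natr.
  rewrite lerXn2r ?nnegrE ?expR_ge0 ?addr_ge0 ?mulr_ge0 ?expR_ge0//.
  by apply: le_trans (expR_ge1Dx _); rewrite lerD2l.
have NE : N%:R = expR (ln N%:R) :> R by rewrite lnK// posrE ltr0n.
have up : N%:R * #|block_alphabet M L.+1 Q C|.+1%:R ^+ J * (1 + C'%:R * expR (- lam)) ^+ nn
    <= expR (ln N%:R + 2 * z + z).
  rewrite !expRD -NE; apply: ler_pM; [|by rewrite exprn_ge0// addr_ge0 ?mulr_ge0 ?expR_ge0|
    by rewrite ler_wpM2l|exact: upC].
  by apply: mulr_ge0 => //; exact: exprn_ge0.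
apply: (le_lt_trans up).
apply: (@lt_le_trans _ _ (expR (h * nn%:R) / 2 * (expR (- z) * expR (- z)))); last first.
  apply: ler_pM; rewrite ?mulr_ge0 ?divr_ge0 ?expR_ge0//.
    by apply: le_trans sE'; rewrite ler_pM2r ?invr_gt0// ltW.
  by apply: ler_pM; rewrite ?expR_ge0.
have -> : expR (h * nn%:R) / 2 = expR (h * nn%:R - ln 2).
  by rewrite expRD expRN lnK// posrE.
rewrite -!expRD ltr_expR; have z0 : 0 < h * nn%:R by rewrite mulr_gt0.
have zE : h * nn%:R = 16 * z by rewrite /z; lra.
have n2z : ln 2 + ln N%:R <= z by rewrite /z [leRHS]mulrC.
rewrite zE in z0 *; move: z0 n2z.
by clear; move: (ln 2) (ln N%:R) => v w; clearbody z; lra.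
Qed.

Lemma locally_mean_equicontinuous_entropy0 :
  locally_mean_equicontinuous X -> topological_entropy X = 0%E.
Proof.
move=> /locally_mean_equicontinuous_returning Xret.
apply/eqP; rewrite eq_le; apply/andP; split.
  by apply: ge_ereal_sup => _ [eps eps0 <-]; exact: mean_returning_entropy_at_scale.
apply: (le_trans (entropy_at_scale_ge0 1)).
by apply: ereal_sup_ubound; exists 1 => //=; exact: ltr01.
Qed.

End zero_entropy.

(** * The binary odometer *)

(** A new type, because functions into [bool] already carry a topology; [R] only
serves to make the distance real-valued. *)
Definition odometer (R : realType) : Type := nat -> bool.

HB.instance Definition _ (R : realType) := gen_eqMixin (odometer R).
HB.instance Definition _ (R : realType) := gen_choiceMixin (odometer R).

Section odometer_metric.
Context {R : realType}.
Local Notation Z := (odometer R).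
Implicit Types x y z w : Z.

Definition odist z w : R :=
  if pselect (exists n, z n != w n) is left h then (ex_minn h).+1%:R^-1 else 0.

Lemma odist_spec z w : odist z w = 0 /\ z = w \/
  exists m, [/\ odist z w = m.+1%:R^-1, z m != w m & forall i, (i < m)%N -> z i = w i].
Proof.
rewrite /odist; case: pselect => [h|nh]; last first.
  left; split=> //; apply/funext => n; apply/eqP; apply: contrapT => /negP zw.
  by apply: nh; exists n.
right; case: ex_minnP => m zwm mmin; exists m; split=> // i im; apply/eqP.
by apply: contraTT im => /mmin; rewrite -leqNgt.
Qed.

Lemma odist_ge z w m : z m != w m -> m.+1%:R^-1 <= odist z w.
Proof.
case: (odist_spec z w) => [[_ ->]|[k [-> _ agree]] zwm]; first by rewrite eqxx.
rewrite lef_pV2 ?posrE ?ltr0n// ler_nat ltnS leqNgt; apply/negP => /agree zw.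
by rewrite zw eqxx in zwm.
Qed.

Lemma odist_lt z w n : odist z w < n.+1%:R^-1 <-> forall i, (i <= n)%N -> z i = w i.
Proof.
split=> [zw i ni|agree].
  apply/eqP; apply: contraTT zw => /odist_ge zw; rewrite -leNgt.
  by apply: le_trans zw; rewrite lef_pV2 ?posrE ?ltr0n// ler_nat ltnS.
case: (odist_spec z w) => [[-> _]|[k [-> zwk _]]]; first by rewrite invr_gt0 ltr0n.
rewrite ltf_pV2 ?posrE ?ltr0n// ltr_nat ltnS ltnNge; apply: contra zwk => kn.
by rewrite agree.
Qed.

Let odist0 z : odist z z = 0.
Proof. by case: (odist_spec z z) => [[]//|[k []]]; rewrite eqxx. Qed.

Let odist_ge0 z w : 0 <= odist z w.
Proof. by case: (odist_spec z w) => [[->]//|[k [-> _ _]]]; rewrite invr_ge0. Qed.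

Let odist_eq0 z w : odist z w = 0 -> z = w.
Proof.
case: (odist_spec z w) => [[]//|[k [-> _ _]]] /eqP.
by rewrite invr_eq0 pnatr_eq0.
Qed.

Let odistC z w : odist z w = odist w z.
Proof.
apply/eqP; rewrite eq_le; apply/andP; split.
- case: (odist_spec z w) => [[->]//|[k [-> zw _]]]; apply: odist_ge.
  by rewrite eq_sym.
- case: (odist_spec w z) => [[->]//|[k [-> zw _]]]; apply: odist_ge.
  by rewrite eq_sym.
Qed.

Let odist_triangle y x z : odist x z <= odist x y + odist y z.
Proof.
case: (odist_spec x z) => [[-> _]|[k [-> xz _]]]; first exact: addr_ge0.
have [xy|xy] := eqVneq (x k) (y k).
  by rewrite xy in xz; rewrite (le_trans (odist_ge xz))// lerDr.
by rewrite (le_trans (odist_ge xy))// lerDl.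
Qed.

HB.instance Definition _ := isMetric.Build R Z odist0 odist_eq0 odistC odist_triangle.

Definition residue n z : nat := \sum_(i < n) z i * 2 ^ i.

Lemma residueS n z : residue n.+1 z = (residue n z + z n * 2 ^ n)%N.
Proof. by rewrite /residue big_ord_recr. Qed.

Lemma residue_lt n z : (residue n z < 2 ^ n)%N.
Proof.
elim: n => [|n ih]; first by rewrite /residue big_ord0.
rewrite residueS expnS mul2n -addnn -addSn leq_add//.
by case: (z n); rewrite ?mul1n.
Qed.

Lemma residue_mod m n z : (m <= n)%N -> (residue n z %% 2 ^ m)%N = residue m z.
Proof.
elim: n => [|n ih]; first by rewrite leqn0 => /eqP ->; rewrite modn1 /residue big_ord0.
rewrite leq_eqVlt => /orP[/eqP ->|]; first by rewrite modn_small ?residue_lt.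
rewrite ltnS residueS => mn; rewrite -(ih mn) -(subnK mn) expnD mulnA.
by rewrite addnC modnMDl.
Qed.

Lemma residue_digits n z w : residue n z = residue n w <-> forall i, (i < n)%N -> z i = w i.
Proof.
split; last by move=> zw; apply: eq_bigr => i _; rewrite zw.
elim: n => [//|n ih] zw i; rewrite ltnS leq_eqVlt.
have zw' : residue n z = residue n w.
  by rewrite -(residue_mod z (leqnSn n)) zw residue_mod.
case/orP => [/eqP ->|]; last exact: ih.
move: zw; rewrite !residueS zw' => /addnI/eqP.
by rewrite eqn_pmul2r ?expn_gt0//; case: (z n); case: (w n).
Qed.

Lemma odist_residue n z w : mdist z w < n.+1%:R^-1 <-> residue n.+1 z = residue n.+1 w.
Proof.
split=> [/odist_lt h|/residue_digits h].
  by apply/residue_digits => i; rewrite ltnS; exact: h.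
by apply/odist_lt => i ni; apply: h; rewrite ltnS.
Qed.

(** Digit [n] flips exactly when all lower digits are 1, that is, when a carry
reaches it. *)
Definition osucc z : Z := fun n => z n (+) ((residue n z).+1 == 2 ^ n)%N.

Lemma residue_osucc n z : residue n (osucc z) = ((residue n z).+1 %% 2 ^ n)%N.
Proof.
elim: n => [|n ih]; first by rewrite /residue big_ord0 expn0 modn1.
rewrite !residueS ih {1}/osucc; have := residue_lt n z.
rewrite leq_eqVlt => /orP[/eqP carry|small].
  rewrite carry eqxx modnn add0n -addSn carry addbT expnS mul2n -addnn.
  case: (z n); rewrite /= ?mul1n ?mul0n ?addn0 ?modnn//.
  by rewrite modn_small// -[X in (X < _)%N]addn0 ltn_add2l expn_gt0.
rewrite (ltn_eqF small) addbF modn_small// modn_small//.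
rewrite -addSn expnS mul2n -addnn -addSn leq_add//.
by case: (z n); rewrite ?mul1n.
Qed.

Lemma residue_iter_osucc n j z : residue n (iter j osucc z) = ((residue n z + j) %% 2 ^ n)%N.
Proof.
elim: j => [|j ih]; first by rewrite addn0 modn_small ?residue_lt.
by rewrite iterS residue_osucc ih -addn1 modnDml addn1 addnS.
Qed.

Lemma osucc_contract z w : mdist (osucc z) (osucc w) <= mdist z w.
Proof.
case: (odist_spec (osucc z) (osucc w)) => [[e _]|[m [e diff _]]].
  by rewrite [leLHS]e; exact: mdist_ge0.
rewrite [leLHS]e leNgt; apply/negP => /odist_residue zw; move/negP: diff; apply; apply/eqP.
have : residue m.+1 (osucc z) = residue m.+1 (osucc w) by rewrite !residue_osucc zw.
by move/residue_digits; apply.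
Qed.

Lemma iter_osucc_contract j z w : mdist (iter j osucc z) (iter j osucc w) <= mdist z w.
Proof. by elim: j => //= j; apply: le_trans; exact: osucc_contract. Qed.

Lemma osucc_continuous : continuous osucc.
Proof.
move=> z V /nbhs_ballP[e e0 eV]; apply/nbhs_ballP; exists e => // w.
rewrite ballEmdist/= => zw; apply: eV; rewrite ballEmdist/=.
exact: le_lt_trans (osucc_contract z w) zw.
Qed.

Lemma odometer_compact : compact [set: Z].
Proof.
rewrite compact_ultra => U UU _.
pose z : Z := fun n => `[< U [set w : Z | w n] >].
have Uz n : U [set w : Z | w n = z n].
  have [Un|Un] := in_ultra_setVsetC [set w : Z | w n] UU.
    by rewrite /z asboolT//; apply: filterS Un.
  rewrite /z asboolF; first by apply: filterS Un => w /= /negP/negbTE.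
  by move=> Un'; have [w []] := filter_ex (filterI Un Un').
have Uzn n : U [set w : Z | forall i, (i < n)%N -> w i = z i].
  elim: n => [|n ih]; first exact: filterE.
  apply: filterS (filterI ih (Uz n)) => w [wz wn] i.
  by rewrite ltnS leq_eqVlt => /orP[/eqP ->//|]; exact: wz.
exists z; split=> // V /nbhs_ballP[e e0 eV].
have [n _ ne] := near_infty_natSinv_lt (PosNum e0).
apply: filterS (Uzn n.+1) => w wz; apply: eV; rewrite ballEmdist/=.
apply: lt_trans (ne n (leqnn n)); apply/odist_lt => i ni.
by rewrite wz.
Qed.

Lemma odometer_nonempty : [set: Z] !=set0.
Proof. by exists (fun=> false). Qed.

Definition odometer_tds : tds R := TDS odometer_nonempty odometer_compact osucc_continuous.

Lemma residue_nbhs n z : nbhs z [set w | residue n w = residue n z].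
Proof.
apply/nbhs_ballP; exists n.+1%:R^-1; first by rewrite /= invr_gt0 ltr0n.
move=> w; rewrite ballEmdist/= => /odist_residue zw.
by rewrite -(residue_mod w (leqnSn n)) -zw residue_mod.
Qed.

Lemma residue_open n (A : set nat) : open [set z | A (residue n z)].
Proof.
rewrite openE => z Az; rewrite /interior.
by apply: filterS (residue_nbhs n z) => w /= ->.
Qed.

End odometer_metric.

(** * Slowly varying peaks *)

Section peak.
Context {R : realType} (l : R) (l1 : 1 <= l).

(** An inverse square root is integrable near 0 with primitive comparable to [x]
times its value, which is what makes averages over segments comparable to the
smallest value; the shift by [l] makes it flat at scale 1. *)
Definition decay (x : R) : R := Num.sqrt l / Num.sqrt (l + x).
Definition decay_primitive (x : R) : R := 2 * Num.sqrt l * Num.sqrt (l + x).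
Local Notation psi := decay.
Local Notation sigma := decay_primitive.
Let s (x : R) := Num.sqrt (l + x).

Let s_gt0 x : 0 <= x -> 0 < s x.
Proof. by have l_ge1 := l1; move=> x0; rewrite sqrtr_gt0; lra. Qed.

Let s_sqr x : 0 <= x -> s x * s x = l + x.
Proof. by have l_ge1 := l1; move=> x0; rewrite -expr2 sqr_sqrtr//; lra. Qed.

Let s_le x y : x <= y -> s x <= s y.
Proof. by move=> xy; rewrite ler_wsqrtr// lerD2l. Qed.

Let sl_gt0 : 0 < Num.sqrt l. Proof. by have l_ge1 := l1; rewrite sqrtr_gt0; lra. Qed.

Lemma decay_gt0 x : 0 <= x -> 0 < psi x.
Proof. by move=> x0; rewrite divr_gt0// s_gt0. Qed.

Lemma decay_le x y : 0 <= x -> x <= y -> psi y <= psi x.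
Proof.
have l_ge1 := l1.
move=> x0 xy; rewrite ler_pM2l// lef_pV2 ?posrE; first exact: s_le.
- by apply: s_gt0; lra.
- exact: s_gt0.
Qed.

Lemma decay0 : psi 0 = 1.
Proof. by rewrite /decay addr0 divff// gt_eqF. Qed.

Lemma decay_primitive_le x y : x <= y -> sigma x <= sigma y.
Proof. by move=> xy; rewrite ler_wpM2l ?mulr_ge0 ?(ltW sl_gt0)//; exact: s_le. Qed.

Let sD x n : 0 <= x -> 0 <= n -> (s (x + n) - s x) * (s (x + n) + s x) = n.
Proof.
have l_ge1 := l1.
move=> x0 n0; rewrite mulrC mulrDl !mulrBr s_sqr//; last lra.
have := s_sqr x0; rewrite mulrC; move: (s x) (s (x + n)) => a b; lra.
Qed.

Lemma decay_primitive_diff x n : 0 <= x -> 0 <= n ->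
  sigma (x + n) - sigma x <= 2 * n * psi (x + n).
Proof.
have l_ge1 := l1.
move=> x0 n0; rewrite /sigma -mulrBr /psi -/(s _) -/(s _).
have a0 := s_gt0 x0; have xn0 : 0 <= x + n by lra.
have b0 := s_gt0 xn0.
rewrite [leRHS]mulrACA ler_pM2l ?mulr_gt0// ler_pdivlMr//.
rewrite -[leRHS](sD x0 n0) mulrDr lerDl mulr_ge0 ?(ltW a0)// subr_ge0 s_le//; lra.
Qed.

Lemma decay_le_diff x : 0 <= x -> psi (x + 1) <= sigma (x + 1) - sigma x.
Proof.
have l_ge1 := l1.
move=> x0; rewrite /sigma -mulrBr /psi -/(s _) -/(s _) [leRHS]mulrAC [leRHS]mulrC.
have a0 := s_gt0 x0; have x1 : 0 <= x + 1 by lra.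
have b0 := s_gt0 x1; have ab : s x <= s (x + 1) by apply: s_le; lra.
rewrite ler_pM2l// -[leLHS]mul1r ler_pdivrMr// -[leLHS](sD x0 ler01).
by have : (s (x + 1) - s x) * s x <= (s (x + 1) - s x) * s (x + 1);
  [rewrite ler_wpM2l// subr_ge0|lra].
Qed.

Lemma decay_double x : 0 <= x -> psi x <= 2 * psi (x + 1).
Proof.
have l_ge1 := l1.
move=> x0; have a0 := s_gt0 x0; have x1 : 0 <= x + 1 by lra.
have b0 := s_gt0 x1; rewrite /psi mulrCA ler_pM2l//.
rewrite -[Num.sqrt (l + x)]/(s x) -[Num.sqrt (l + (x + 1))]/(s (x + 1)).
rewrite ler_pdivlMr// mulrC ler_pdivrMr//.
rewrite -ler_sqr ?nnegrE ?mulr_ge0 ?(ltW a0) ?(ltW b0)// exprMn !expr2 !s_sqr//; lra.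
Qed.

Lemma decay_slope x : 0 <= x -> psi x - psi (x + 1) <= (2 * l)^-1.
Proof.
have l_ge1 := l1.
move=> x0; have a0 := s_gt0 x0; have x1 : 0 <= x + 1 by lra.
have b0 := s_gt0 x1; have ab : s x <= s (x + 1) by apply: s_le; lra.
have la : Num.sqrt l <= s x by rewrite ler_wsqrtr; lra.
have l0 : 0 < l by lra.
rewrite /psi -[Num.sqrt (l + x)]/(s x) -[Num.sqrt (l + (x + 1))]/(s (x + 1)).
have -> : Num.sqrt l / s x - Num.sqrt l / s (x + 1) =
    Num.sqrt l / (s x * s (x + 1) * (s (x + 1) + s x)).
  have d0 : 0 < s (x + 1) + s x by lra.
  have e1 : (s (x + 1) - s x) = (s (x + 1) + s x)^-1.
    by apply: (mulIf (lt0r_neq0 d0)); rewrite sD// mulVf// gt_eqF.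
  rewrite -mulrBr; congr (_ * _).
  have -> : (s x)^-1 - (s (x + 1))^-1 = (s (x + 1) - s x) / (s x * s (x + 1)).
    by field; rewrite !gt_eqF.
  by rewrite e1 -invfM mulrC.
rewrite ler_pdivrMr ?mulr_gt0//; last lra.
rewrite mulrC ler_pdivlMr ?mulr_gt0//.
have sl2 : Num.sqrt l * Num.sqrt l = l by rewrite -expr2 sqr_sqrtr// ltW.
rewrite -{2}sl2.
have h1 : Num.sqrt l * Num.sqrt l <= s x * s (x + 1).
  by apply: ler_pM; rewrite ?(ltW sl_gt0)//; exact: le_trans ab.
have h2 : 2 * Num.sqrt l <= s (x + 1) + s x by lra.
rewrite [leLHS](_ : _ = (Num.sqrt l * Num.sqrt l) * (2 * Num.sqrt l)); last ring.
by apply: ler_pM; rewrite ?mulr_ge0 ?(ltW sl_gt0).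
Qed.

Context (b : nat) (b0 : (0 < b)%N).

(** Two decays from the ends of a period [b]; extended periodically, it peaks at the
multiples of [b]. *)
Definition peak (r : nat) : R := psi r%:R + psi (b - r)%:R.

Lemma peak_ge0 r : 0 <= peak r.
Proof. by rewrite addr_ge0// ltW// decay_gt0. Qed.

Lemma peak_ge1 : 1 <= peak 0.
Proof. by rewrite /peak decay0 lerDl ltW// decay_gt0. Qed.

Lemma peak_le x r : 0 <= x -> x <= r%:R -> x <= (b - r)%:R -> peak r <= 2 * psi x.
Proof.
by move=> x0 xr xb; have := decay_le x0 xr; have := decay_le x0 xb; rewrite /peak; lra.
Qed.

Lemma peak_slope r : (r < b)%N -> `|peak (r.+1 %% b) - peak r| <= l^-1.
Proof.
have l_ge1 := l1.
move=> rb; have -> : peak (r.+1 %% b) = peak r.+1.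
  move: rb; rewrite leq_eqVlt => /orP[/eqP ->|rb]; last by rewrite modn_small.
  by rewrite modnn /peak subn0 subnn addrC.
have l0 : 0 < l by lra.
have := decay_slope (ler0n R r); have := @decay_slope (b - r.+1)%:R (ler0n _ _).
have := @decay_le r%:R (r%:R + 1) (ler0n _ _); have := @decay_le (b - r.+1)%:R ((b - r.+1)%:R + 1) (ler0n _ _).
rewrite /peak natr1 natr1 -subSn// subSS => h1 h2; have {}h1 := h1 _; have {}h2 := h2 _.
have {}h1 : psi (b - r)%:R <= psi (b - r.+1)%:R by apply: h1; rewrite ler_nat; lia.
have {}h2 : psi r.+1%:R <= psi r%:R by apply: h2; rewrite ler_nat.
have -> : l^-1 = 2 * (2 * l)^-1 by field; rewrite gt_eqF.
by move=> h3 h4; rewrite ler_norml; apply/andP; split; lra.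
Qed.

Lemma peak_stretch r N : (r + N <= b)%N -> \sum_(0 <= n < N) peak (r + n) <=
  2 * ((sigma (r + N)%:R - sigma r%:R) + (sigma (b - r)%:R - sigma (b - r - N)%:R)).
Proof.
elim: N => [|N ih] rN; first by rewrite big_geq// addn0 subn0 !subrr addr0 mulr0.
rewrite big_nat_recr//=; apply: (le_trans (lerD (ih _) (lexx _))); first lia.
have := decay_double (ler0n R (r + N)); have := decay_le_diff (ler0n R (r + N)).
have := decay_le_diff (ler0n R (b - r - N.+1)).
rewrite !natr1 (_ : (b - r - N.+1).+1 = (b - r - N)%N); last lia.
rewrite /peak (_ : (b - (r + N) = b - r - N)%N); last lia.
have := decay_gt0 (ler0n R (b - r - N)).
rewrite addnS; lra.
Qed.

Lemma peak_stretch_le r N : (r + N <= b)%N ->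
  \sum_(0 <= n < N) peak (r + n) <= 4 * N%:R * peak r.
Proof.
move=> rN; apply: (le_trans (peak_stretch rN)).
have := decay_primitive_diff (ler0n R r) (ler0n R N).
have := decay_primitive_diff (ler0n R (b - r - N)) (ler0n R N).
rewrite -!natrD subnK; last lia.
have : N%:R * psi (r + N)%:R <= N%:R * psi r%:R.
  by rewrite ler_wpM2l// decay_le// ler_nat leq_addr.
by rewrite /peak; lra.
Qed.

Lemma peak_from0 N : (N <= b)%N ->
  \sum_(0 <= n < N) peak n <= 2 * (sigma N%:R - sigma 0) + 4 * N%:R * psi b%:R.
Proof.
move=> Nb; have := @peak_stretch 0 N Nb; rewrite add0n subn0.
have := decay_primitive_diff (ler0n R (b - N)) (ler0n R N).
rewrite -natrD subnK//.
by under eq_bigr do rewrite add0n; lra.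
Qed.

(** A full period adds at most [8 * b * psi b], which the second term absorbs. *)
Lemma peak_from0_periodic N : \sum_(0 <= n < N) peak (n %% b) <=
  2 * (sigma N%:R - sigma 0) + 8 * N%:R * psi b%:R.
Proof.
have psib := decay_gt0 (ler0n R b).
elim/ltn_ind: N => N ih; have [Nb|bN] := ltnP N b.
  rewrite big_nat_cond (eq_bigr peak) -?big_nat_cond; last first.
    by move=> i /andP[/andP[_ iN] _]; rewrite modn_small//; exact: ltn_trans Nb.
  apply: (le_trans (peak_from0 (ltnW Nb))).
  by have : 0 <= N%:R * psi b%:R; [rewrite mulr_ge0// ltW|lra].
rewrite (big_cat_nat _ (n := b))//=.
have -> : \sum_(b <= i < N) peak (i %% b) = \sum_(0 <= i < N - b) peak (i %% b).
  by rewrite -{1}[b]add0n big_addn; apply: eq_bigr => i _; rewrite modnDr.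
have Nb : (N - b < N)%N by lia.
have h2 := ih _ Nb.
have h1 : \sum_(0 <= n < b) peak (n %% b) <= 2 * (sigma b%:R - sigma 0) + 4 * b%:R * psi b%:R.
  rewrite big_nat_cond (eq_bigr peak) -?big_nat_cond; last first.
    by move=> i /andP[/andP[_ ib] _]; rewrite modn_small.
  exact: peak_from0.
have := decay_primitive_diff (lexx 0) (ler0n R b); rewrite add0r => h3.
have h4 : sigma (N - b)%:R <= sigma N%:R by apply: decay_primitive_le; rewrite ler_nat leq_subr.
have NE : N%:R * psi b%:R = (N - b)%:R * psi b%:R + b%:R * psi b%:R.
  by rewrite -mulrDl -natrD subnK.
by move: h1 h2 h3 h4 NE; lra.
Qed.

(** The peaks form an A1 weight: up to the next multiple of [b] the average is
controlled by monotonicity of the decay.  A segment that passes that multiple has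
length at least [b - r], so the mass of the peaks that it crosses, a multiple of
[N * psi N] and of [N * psi b], is controlled by [N * psi (b - r)], a part of
[N * peak r]. *)
Lemma peak_average r N : (r < b)%N ->
  \sum_(0 <= n < N) peak ((r + n) %% b) <= 12 * N%:R * peak r.
Proof.
move=> rb; have psib := decay_gt0 (ler0n R b).
have psir := decay_gt0 (ler0n R r); have psibr := decay_gt0 (ler0n R (b - r)).
have stretch M : (r + M <= b)%N -> \sum_(0 <= n < M) peak ((r + n) %% b) <= 4 * M%:R * peak r.
  move=> rM; apply: le_trans (peak_stretch_le rM); rewrite le_eqVlt; apply/orP; left; apply/eqP.
  have [rMb|] := ltnP (r + M) b.
    rewrite big_nat_cond [RHS]big_nat_cond; apply: eq_bigr => i /andP[/andP[_ iM] _].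
    rewrite modn_small//; lia.
  move=> brM; rewrite big_nat_cond [RHS]big_nat_cond; apply: eq_bigr => i /andP[/andP[_ iM] _].
  by rewrite modn_small//; lia.
have [Nb|bN] := leqP (r + N) b.
  apply: (le_trans (stretch N Nb)); have := peak_ge0 r.
  by have := mulr_ge0 (ler0n R N) (peak_ge0 r); lra.
have aN : (b - r <= N)%N by lia.
rewrite (big_cat_nat _ (n := (b - r)%N))//=.
have -> : \sum_(b - r <= n < N) peak ((r + n) %% b) =
    \sum_(0 <= i < N - (b - r)) peak (i %% b).
  rewrite -{1}[(b - r)%N]add0n big_addn; apply: eq_bigr => i _.
  by rewrite addnCA subnKC ?(ltnW rb)// modnDr.
have {stretch} := stretch (b - r)%N; rewrite subnKC ?(ltnW rb)// => /(_ (leqnn _)) h1.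
have h2 := peak_from0_periodic (N - (b - r)).
have h3 : sigma (N - (b - r))%:R <= sigma N%:R.
  by apply: decay_primitive_le; rewrite ler_nat leq_subr.
have := decay_primitive_diff (lexx 0) (ler0n R N); rewrite add0r => h4.
have h5 : N%:R * psi N%:R <= N%:R * psi (b - r)%:R.
  by rewrite ler_wpM2l// decay_le// ler_nat.
have h6 : (N - (b - r))%:R * psi b%:R <= (N - (b - r))%:R * psi (b - r)%:R.
  by rewrite ler_wpM2l// decay_le// ler_nat leq_subr.
have NE x : N%:R * x = (N - (b - r))%:R * x + (b - r)%:R * x :> R.
  by rewrite -mulrDl -natrD subnK.
have := mulr_ge0 (ler0n R (b - r)) (ltW psibr); have := mulr_ge0 (ler0n R (N - (b - r))) (ltW psibr).
have := mulr_ge0 (ler0n R (b - r)) (ltW psir); have := mulr_ge0 (ler0n R (N - (b - r))) (ltW psir).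
have := NE (psi r%:R); have := NE (psi (b - r)%:R).
by move: h1 h2 h3 h4 h5 h6; rewrite /peak; lra.
Qed.

End peak.

(** * Heights over the odometer *)

Section geometric_cauchy.
Context {R : realType}.

Lemma geometric_cauchy_cvg (u : nat -> R) : (forall n, `|u n.+1 - u n| <= 2 ^- n) ->
  cvgn u /\ forall n, `|limn u - u n| <= 2 * 2 ^- n.
Proof.
move=> du; pose v n := 2 * 2 ^- n : R.
have vS n : v n.+1 = 2 ^- n by rewrite /v exprS invfM mulrA divff// mul1r.
have v0 n : 0 <= v n by rewrite mulr_ge0// invr_ge0 exprn_ge0.
have v_cvg : v @ \oo --> 0.
  rewrite -[X in _ --> X](mulr0 2); apply: cvgM; first exact: cvg_cst.
  rewrite (_ : (fun n => 2 ^- n) = (fun n => 2^-1 ^+ n)); last by apply/funext => n; rewrite exprVn.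
  by apply: cvg_expr; rewrite ger0_norm ?invr_ge0// invf_lt1// ltr1n.
have dec : nonincreasing_seq (u + v).
  apply/nonincreasing_seqP => n; rewrite /= !fctE vS.
  by have := du n; rewrite ler_norml /v => /andP[]; lra.
have inc : nondecreasing_seq (u - v).
  apply/nondecreasing_seqP => n; rewrite /= !fctE vS.
  by have := du n; rewrite ler_norml /v => /andP[]; lra.
have lb n : u 0%N - v 0%N <= (u + v) n.
  by apply: (le_trans (inc 0%N n (leq0n n))); rewrite !fctE; have := v0 n; lra.
have ub n : (u - v) n <= u 0%N + v 0%N.
  by apply: le_trans (dec 0%N n (leq0n n)); rewrite !fctE; have := v0 n; lra.
have cuv : cvgn (u + v).
  by apply: nonincreasing_is_cvgn => //; exists (u 0%N - v 0%N) => _ [n _ <-].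
have uE : u = (u + v) - v by apply/funext => n; rewrite !fctE addrK.
have cu : u @ \oo --> limn (u + v).
  by rewrite {1}uE -[X in _ --> X]subr0; apply: cvgB.
have limE : limn u = limn (u + v) by apply: cvg_lim cu.
split; first by apply/cvg_ex; exists (limn (u + v)).
move=> n; rewrite -/(v n) ler_norml; apply/andP; split; last first.
  have := nonincreasing_cvgn_ge dec cuv n; rewrite -limE !fctE; lra.
have cumv : u - v @ \oo --> limn u.
  by rewrite limE -[X in _ --> X]subr0; apply: cvgB.
have := nondecreasing_cvgn_le inc (cvgP _ cumv) n.
by rewrite (cvg_lim _ cumv)// !fctE; lra.
Qed.

End geometric_cauchy.

Section heights.
Context {R : realType}.

Lemma expRN_contract (a b : R) : 0 <= a -> 0 <= b -> `|expR (- a) - expR (- b)| <= `|a - b|.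
Proof.
have half (u v : R) : 0 <= u -> u <= v -> expR (- u) - expR (- v) <= v - u.
  move=> u0 uv; have -> : expR (- v) = expR (- u) * expR (u - v).
    by rewrite -expRD; congr expR; lra.
  have h1 : expR (- u) <= 1 by rewrite -expR0 ler_expR; lra.
  have h2 := expR_ge1Dx (u - v).
  have h3 : expR (- u) * (1 + (u - v)) <= expR (- u) * expR (u - v).
    by rewrite ler_wpM2l ?expR_ge0.
  have h4 : expR (- u) * (v - u) <= 1 * (v - u) by rewrite ler_wpM2r// subr_ge0.
  by move: h3 h4; lra.
move=> a0 b0; have [ab|/ltW ba] := leP a b.
  rewrite ger0_norm ?subr_ge0 ?ler_expR ?lerN2// ler0_norm ?subr_le0// opprB.
  exact: half.
rewrite ler0_norm ?subr_le0 ?ler_expR ?lerN2// ger0_norm ?subr_ge0// opprB.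
exact: half.
Qed.

Local Notation Z := (odometer R).
Implicit Types z w : Z.

(** Peaks of flatness [2 ^ k] with period [16 ^ k.+1]: the slopes [2 ^- k] are
summable, and the residues within [8 ^ k] of a peak have frequency [2 ^- k / 8],
which is summable too. *)
Definition level k := (4 * k + 4)%N.

Definition height k z : R := peak (2 ^+ k) (2 ^ level k) (residue (level k) z).

Let two1 k : 1 <= 2 ^+ k :> R. Proof. by rewrite exprn_ege1// ler1n. Qed.

Let period_gt0 k : (0 < 2 ^ level k)%N. Proof. by rewrite expn_gt0. Qed.

Lemma height_ge0 k z : 0 <= height k z. Proof. exact: peak_ge0. Qed.

Lemma height_residue k z w : residue (level k) z = residue (level k) w ->
  height k z = height k w.
Proof. by rewrite /height => ->. Qed.

Lemma height_slope k z : `|height k (osucc z) - height k z| <= 2 ^- k.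
Proof. by rewrite /height residue_osucc; apply: peak_slope => //; exact: residue_lt. Qed.

Lemma height_average k z N :
  \sum_(0 <= n < N) height k (iter n osucc z) <= 12 * N%:R * height k z.
Proof.
under eq_bigr do rewrite /height residue_iter_osucc.
by apply: peak_average => //; exact: residue_lt.
Qed.

Lemma height_peak k z : residue (level k) z = 0%N -> 1 <= height k z.
Proof. by rewrite /height => ->; exact: peak_ge1. Qed.

Lemma decay_bound (l x c : R) : 0 < l -> 0 <= x -> 0 < c -> l * c ^+ 2 <= l + x ->
  decay l x <= c^-1.
Proof.
move=> l0 x0 c0 lx; rewrite /decay ler_pdivrMr; last by rewrite sqrtr_gt0; lra.
rewrite [leRHS]mulrC ler_pdivlMr//.
have -> : Num.sqrt l * c = Num.sqrt (l * c ^+ 2).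
  by rewrite sqrtrM ?(ltW l0)// sqrtr_sqr ger0_norm// ltW.
by rewrite ler_wsqrtr.
Qed.

Lemma height_off_peak k z : (8 ^ k <= residue (level k) z)%N ->
  (residue (level k) z + 8 ^ k <= 2 ^ level k)%N -> height k z <= 2 * 2 ^- k.
Proof.
move=> kr rk; have e80 : 0 <= (8 ^ k)%:R :> R by [].
apply: (@le_trans _ _ (2 * decay (2 ^+ k) (8 ^ k)%:R)).
  by apply: peak_le; rewrite ?ler_nat//; lia.
rewrite ler_pM2l//; apply: decay_bound => //; rewrite ?exprn_gt0//.
rewrite natrX (_ : 8%:R = 2 * (2 * 2) :> R); last by lra.
by rewrite [(2 * (2 * 2)) ^+ k]exprMn -expr2 -!exprM mulnC lerDr exprn_ge0.
Qed.

Definition total K z : R := \sum_(0 <= k < K) height k z.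

Definition envelope K z : R := expR (- total K z).

Lemma total_ge0 K z : 0 <= total K z.
Proof. by apply: sumr_ge0 => k _; exact: height_ge0. Qed.

Lemma level_le j k : (j <= k)%N -> (level j <= level k)%N.
Proof. by rewrite /level; lia. Qed.

Lemma total_residue K z w : residue (level K) z = residue (level K) w -> total K z = total K w.
Proof.
move=> zw; rewrite /total big_nat_cond [RHS]big_nat_cond.
apply: eq_bigr => k /andP[/andP[_ kK] _]; apply: height_residue.
have lkK := level_le (ltnW kK).
by rewrite -(residue_mod z lkK) zw residue_mod.
Qed.

Lemma total_split K K' z : (K <= K')%N ->
  total K' z = total K z + \sum_(K <= k < K') height k z.
Proof. by move=> KK'; rewrite /total (big_cat_nat _ (n := K)). Qed.

Lemma envelope_gt0 K z : 0 < envelope K z. Proof. exact: expR_gt0. Qed.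

Lemma envelope_le1 K z : envelope K z <= 1.
Proof. by rewrite -expR0 ler_expR oppr_le0 total_ge0. Qed.

Lemma envelope_noninc z : nonincreasing_seq (envelope ^~ z).
Proof.
apply/nonincreasing_seqP => K; rewrite ler_expR lerN2 /total big_nat_recr//= lerDl.
exact: height_ge0.
Qed.

Lemma envelope_cvg z : cvgn (envelope ^~ z).
Proof.
apply: nonincreasing_is_cvgn; first exact: envelope_noninc.
by exists 0 => _ [K _ <-]; exact/ltW/envelope_gt0.
Qed.

Definition roof z : R := limn (envelope ^~ z).

Lemma roof_ge0 z : 0 <= roof z.
Proof. by apply: limr_ge; [exact: envelope_cvg|apply: nearW => K; exact/ltW/envelope_gt0]. Qed.

Lemma roof_le K z : roof z <= envelope K z.
Proof. exact: nonincreasing_cvgn_ge (@envelope_noninc z) (@envelope_cvg z) K. Qed.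

Lemma roof_ge c z : (forall K, c <= envelope K z) -> c <= roof z.
Proof. by move=> cF; apply: limr_ge; [exact: envelope_cvg|exact: nearW]. Qed.

Definition drift K z : R := total K (osucc z) - total K z.

Definition drift_lim z : R := limn (drift ^~ z).

Lemma drift_cvg z : cvgn (drift ^~ z) /\
  forall K, `|drift_lim z - drift K z| <= 2 * 2 ^- K.
Proof.
apply: geometric_cauchy_cvg => K; rewrite /drift /total !big_nat_recr//=.
rewrite [X in `|X|](_ : _ = height K (osucc z) - height K z); first exact: height_slope.
by set u := \sum_(_ <= _ < _) _; set v := \sum_(_ <= _ < _) _; lra.
Qed.

Definition multiplier z : R := expR (- drift_lim z).

Lemma multiplier_gt0 z : 0 < multiplier z. Proof. exact: expR_gt0. Qed.

(** The limit of the drifts exists even where the total height diverges, so the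
identity also holds, trivially, where the roof vanishes. *)
Lemma roof_osucc z : roof (osucc z) = multiplier z * roof z.
Proof.
apply: cvg_lim => //; rewrite (_ : envelope ^~ (osucc z) =
    (fun K => expR (- drift K z)) \* (envelope ^~ z)).
  apply: cvgM; last exact: envelope_cvg.
  apply: continuous_cvg; first exact: continuous_expR.
  by apply: cvgN; exact: (drift_cvg z).1.
by apply/funext => K /=; rewrite -expRD /drift; congr expR; lra.
Qed.

Lemma drift_lim_near K z w : residue (level K) z = residue (level K) w ->
  `|drift_lim z - drift_lim w| <= 4 * 2 ^- K.
Proof.
move=> zw; have := (drift_cvg z).2 K; have := (drift_cvg w).2 K.
have -> : drift K w = drift K z.
  by rewrite /drift (total_residue zw) (@total_residue _ (osucc z) (osucc w))// !residue_osucc zw.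
by rewrite !ler_norml => /andP[? ?] /andP[? ?]; apply/andP; split; lra.
Qed.

Lemma envelope_residue K z w : residue (level K) z = residue (level K) w ->
  envelope K z = envelope K w.
Proof. by move=> zw; rewrite /envelope (total_residue zw). Qed.

Lemma envelope_contract K z w :
  `|envelope K z - envelope K w| <= `|total K z - total K w|.
Proof. exact: expRN_contract (total_ge0 _ _) (total_ge0 _ _). Qed.

(** Where the partial envelope is nearly the roof, the remaining heights are small. *)
Lemma height_tail K K' z (c : R) : (K <= K')%N ->
  envelope K z <= roof z * expR c -> \sum_(K <= k < K') height k z <= c.
Proof.
move=> KK' h; have : envelope K z <= envelope K' z * expR c.
  by apply: (le_trans h); rewrite ler_pM2r ?expR_gt0// roof_le.
by rewrite -expRD ler_expR (total_split _ KK'); lra.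
Qed.

Lemma envelope_peak K z : residue (level K) z = 0%N -> envelope K z <= expR (- K%:R).
Proof.
move=> z0; rewrite ler_expR lerN2 /total.
apply: (@le_trans _ _ (\sum_(0 <= k < K) 1)); first by rewrite sumr_const_nat subn0.
rewrite big_nat_cond [leRHS]big_nat_cond; apply: ler_sum => k /andP[/andP[_ kK] _].
by apply: height_peak; rewrite -(residue_mod z (level_le (ltnW kK))) z0 mod0n.
Qed.

Lemma envelope_off_peak K z : (forall k, (k < K)%N ->
    (8 ^ k <= residue (level k) z)%N /\ (residue (level k) z + 8 ^ k <= 2 ^ level k)%N) ->
  expR (- 4) <= envelope K z.
Proof.
move=> off; rewrite ler_expR lerN2.
suff : total K z <= 4 - 4 * 2 ^- K.
  by move/le_trans; apply; rewrite gerBl mulr_ge0// invr_ge0 exprn_ge0.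
elim: K off => [|K ih] off; first by rewrite /total big_geq// expr0 invr1 mulr1 subrr.
rewrite /total big_nat_recr//=; have [h1 h2] := off K (leqnn _).
have := height_off_peak h1 h2; have := ih (fun k kK => off k (ltnW kK)).
have -> : 2 ^- K.+1 = 2 ^- K / 2 :> R by rewrite exprS invfM mulrC.
by rewrite /total; move: (2 ^- K) => t; lra.
Qed.

Lemma two_exprN_small (e : R) : 0 < e -> exists K, 2 ^- K < e.
Proof.
move=> e0; have [K _ KP] := near_infty_natSinv_lt (PosNum e0).
exists K; apply: le_lt_trans (KP K (leqnn K)).
rewrite lef_pV2 ?posrE ?exprn_gt0 ?ltr0n// -natrX ler_nat.
exact: ltn_expl.
Qed.

Lemma residue_locally_constant (n : nat) (T : topologicalType) (f : Z -> T) :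
  (forall z w, residue n z = residue n w -> f z = f w) -> continuous f.
Proof.
move=> fn z V Vz; apply: filterS (residue_nbhs n z) => w zw.
by rewrite /= (fn w z)//; exact: nbhs_singleton.
Qed.

Lemma envelope_continuous K : continuous (envelope K).
Proof.
exact: (residue_locally_constant (@envelope_residue K)).
Qed.

Lemma multiplier_continuous : continuous multiplier.
Proof.
have dc : continuous drift_lim.
  move=> z; apply/(@cvgrPdist_le _ _ _ _ (nbhs_filter z)) => e e0.
  have [K Ke] := two_exprN_small (divr_gt0 e0 (ltr0Sn R 3)).
  apply: filterS (residue_nbhs (level K) z) => w zw.
  apply: (le_trans (drift_lim_near (esym zw))); lra.
move=> z; apply: (@continuous_comp _ _ _ (fun w => - drift_lim w) expR).
  by apply: continuousN; exact: dc.
exact: continuous_expR.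
Qed.

End heights.

(* Conversion would otherwise unfold the limits behind these functions. *)
Opaque height total envelope roof multiplier.

(** * The skew product under the roof *)

Section product_metric.
Context {R : realType} {M N : metricType R}.

Definition pair_dist (p q : M * N) : R := Num.max (mdist p.1 q.1) (mdist p.2 q.2).

Let pair_dist_ge0 p q : 0 <= pair_dist p q.
Proof. by rewrite le_max mdist_ge0. Qed.

Let pair_dist_eq0 p q : pair_dist p q = 0 -> p = q.
Proof.
move=> pq; have : pair_dist p q <= 0 by rewrite pq.
case: p q {pq} => [p1 p2] [q1 q2]; rewrite ge_max /= => /andP[h1 h2].
by congr (_, _); apply/mdist_positivity/eqP; rewrite eq_le mdist_ge0 andbT.
Qed.

Let ball_pair_dist p e : ball p e = [set q | pair_dist p q < e].
Proof.
apply/seteqP; split => q; rewrite /= gt_max.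
  by move=> [] /=; rewrite !ballEmdist /= => -> ->.
by move=> /andP[h1 h2]; split; rewrite ballEmdist.
Qed.

HB.instance Definition _ := @PseudoMetric_isMetric.Build R (M * N)%type
  pair_dist pair_dist_ge0 pair_dist_eq0 ball_pair_dist.

End product_metric.

(** The ambient product with the line is not compact, so the phase space has to be
cut out of a plain metric space. *)
Section compact_subset_tds.
Context {R : realType} {M : metricType R} (A : set M) (f : M -> M).
Context (A0 : A !=set0) (cptA : compact A).
Context (cf : continuous f) (fA : forall x, A x -> A (f x)).

Definition restriction (a : A) : A :=
  exist _ (f (set_val a)) (mem_set (fA (set_valP a))).

Lemma subset_nonempty : [set: A] !=set0.
Proof. by case: A0 => x Ax; exists (exist _ x (mem_set Ax)). Qed.

Lemma subset_compact : compact [set: A].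
Proof.
move=> F PF _; pose G := (set_val : A -> M) @ F.
have GA : G A.
  rewrite /G nbhs_simpl/=; apply: (@filterS _ F _ setT); last exact: filterT.
  by move=> a _; exact: set_valP.
have [p [Ap clp]] := cptA _ GA.
exists (exist _ p (mem_set Ap)); split => // U V FU.
case=> _ [] [W oW <-] /= Wp WV.
have GU : G (set_val @` U).
  by rewrite /G nbhs_simpl/=; apply: filterS FU => a Ua; exists a.
have [_ [[a Ua <-] Wa]] := clp _ _ GU (open_nbhs_nbhs (conj oW Wp)).
by exists a; split => //; exact: WV.
Qed.

Lemma restriction_continuous : continuous restriction.
Proof.
move=> a U [] _ [] [W oW <-] /= Wa WU.
have nW : nbhs (f (set_val a)) W by exact: open_nbhs_nbhs.
have nfW := cf nW.
have := @initial_continuous A M set_val a _ nfW.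
rewrite nbhs_simpl/=; apply: filterS => b Wb; exact: WU.
Qed.

Definition subset_tds : tds R := TDS subset_nonempty subset_compact restriction_continuous.

End compact_subset_tds.

Section skew_product.
Context {R : realType}.
Local Notation Z := (odometer R).
Local Notation ZR := (Z * R^o)%type.

Definition skew (p : ZR) : ZR := (osucc p.1, multiplier p.1 * p.2).

(** The envelopes instead of the roof: each condition is visibly closed. *)
Definition region : set ZR := [set p | 0 <= p.2 /\ forall K, p.2 <= envelope K p.1].

Lemma region_roof p : region p <-> 0 <= p.2 <= roof p.1.
Proof.
split=> [[-> h]|/andP[p0 h]]; first by rewrite roof_ge.
by split=> // K; apply: (le_trans h); exact: roof_le.
Qed.

Lemma skew_region p : region p -> region (skew p).
Proof.
move/region_roof => /andP[p0 pr]; apply/region_roof; rewrite /= roof_osucc.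
by rewrite mulr_ge0 ?(ltW (multiplier_gt0 _))//= ler_pM2l ?multiplier_gt0.
Qed.

Let fst_continuous : continuous (fst : ZR -> Z).
Proof. by move=> p; exact: cvg_fst. Qed.

Let snd_continuous : continuous (snd : ZR -> R).
Proof. by move=> p; exact: cvg_snd. Qed.

Let comp_fst_continuous (T : topologicalType) (h : Z -> T) :
  continuous h -> continuous (fun p : ZR => h p.1).
Proof. by move=> ch p; apply: continuous_comp; [exact: fst_continuous|exact: ch]. Qed.

Lemma skew_continuous : continuous skew.
Proof.
move=> p; have h1 := @comp_fst_continuous _ _ osucc_continuous p.
have h2 : (fun q : ZR => multiplier q.1 * q.2 : R) @ p --> multiplier p.1 * p.2.
  apply: cvgM; last exact: snd_continuous.
  exact: (@comp_fst_continuous _ _ multiplier_continuous p).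
exact: (cvg_pair h1 h2).
Qed.

Lemma under_envelope_closed (s : R) K : closed [set p : ZR | p.2 <= s * envelope K p.1].
Proof.
rewrite (_ : mkset _ = (fun p : ZR => s * envelope K p.1 - p.2) @^-1` [set x | 0 <= x]).
  apply: (@closed_comp ZR R); last exact: closed_ge.
  move=> p _; apply: cvgB; last exact: snd_continuous.
  apply: cvgM; first exact: cvg_cst.
  exact: (@comp_fst_continuous _ _ (@envelope_continuous R K) p).
by apply/seteqP; split=> p; rewrite /= subr_ge0.
Qed.

Lemma region_closed : closed region.
Proof.
rewrite (_ : region = [set p : ZR | 0 <= p.2] `&`
    \bigcap_K [set p : ZR | p.2 <= 1 * envelope K p.1]).
  apply: closedI; last by apply: closed_bigI => K _; exact: under_envelope_closed.
  apply: (@closed_comp ZR R snd [set x | 0 <= x]); last exact: closed_ge.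
  by move=> p _; exact: snd_continuous.
apply/seteqP; split=> p [p0 h]; split=> // K; first by move=> _ /=; rewrite mul1r; exact: h.
by have := h K I; rewrite /= mul1r.
Qed.

Lemma region_compact : compact region.
Proof.
apply: (@subclosed_compact _ _ ([set: Z] `*` (`[0, 1]%classic : set R^o))).
- exact: region_closed.
- by apply: compact_setX; [exact: odometer_compact|exact: segment_compact].
move=> p [p0 h]; split=> //=; rewrite in_itv/= p0.
exact: le_trans (h 0%N) (envelope_le1 _ _).
Qed.

Lemma region_zero z : region (z, 0).
Proof. by split=> //= K; exact/ltW/envelope_gt0. Qed.

Lemma region_graph z : region (z, roof z).
Proof. by apply/region_roof; rewrite /= roof_ge0 lexx. Qed.

Definition skew_tds : tds R :=
  subset_tds (ex_intro region (fun=> false, 0) (region_zero _)) region_compact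
    skew_continuous skew_region.

Definition point p (rp : region p) : skew_tds := (exist _ p (mem_set rp) : set_type region).

End skew_product.

(** * Local mean equicontinuity of the skew product *)

Section roof_averages.
Context {R : realType}.
Local Notation Z := (odometer R).
Implicit Types z w : Z.

Lemma cvg_sum_nat (u : nat -> nat -> R) (l : nat -> R) N :
  (forall n, u n @ \oo --> l n) ->
  (fun K => \sum_(0 <= n < N) u n K) @ \oo --> \sum_(0 <= n < N) l n.
Proof.
move=> ul; elim: N => [|N ih].
  by rewrite big_geq//; under eq_fun do rewrite big_geq//; exact: cvg_cst.
by rewrite big_nat_recr//=; under eq_fun do rewrite big_nat_recr//=; exact: cvgD.
Qed.

Lemma roof_iter_gt0 n z : 0 < roof z -> 0 < roof (iter n osucc z).
Proof.
by move=> z0; elim: n => [//|n ih]; rewrite iterS roof_osucc mulr_gt0// multiplier_gt0.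
Qed.

(** The heights below level [K] agree along both orbits.  The tails at the later
times are controlled on average by the tails at the initial points, through
[height_average]; the exponential is a contraction on nonpositive numbers. *)
Lemma roof_average z w K t u N : residue (level K) z = residue (level K) w ->
  (forall K', (K <= K')%N -> \sum_(K <= k < K') height k z <= t) ->
  (forall K', (K <= K')%N -> \sum_(K <= k < K') height k w <= u) ->
  \sum_(0 <= n < N) `|roof (iter n osucc z) - roof (iter n osucc w)| <= 12 * N%:R * (t + u).
Proof.
move=> zw tz uw.
have cv : (fun K' => \sum_(0 <= n < N) `|envelope K' (iter n osucc z) - envelope K' (iter n osucc w)|) @ \oo
    --> \sum_(0 <= n < N) `|roof (iter n osucc z) - roof (iter n osucc w)|.
  apply: (@cvg_sum_nat (fun n K' => `|envelope K' (iter n osucc z) - envelope K' (iter n osucc w)|)) => n.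
  by apply: cvg_norm; apply: cvgB; exact: envelope_cvg.
rewrite -(cvg_lim _ cv)//; apply: limr_le; first by apply/cvg_ex; eexists; exact: cv.
exists K => // K' /= KK'.
apply: (@le_trans _ _ (\sum_(0 <= n < N) \sum_(K <= k < K')
   (height k (iter n osucc z) + height k (iter n osucc w)))).
  apply: ler_sum => n _; apply: (le_trans (envelope_contract _ _ _)).
  rewrite !(total_split _ KK') (@total_residue _ K (iter n osucc z) (iter n osucc w)); last first.
    by rewrite !residue_iter_osucc zw.
  set e := total _ _; rewrite [leRHS]big_split/=.
  set a := \sum_(_ <= _ < _) _; set b := \sum_(_ <= _ < _) _.
  have a0 : 0 <= a by apply: sumr_ge0 => k _; exact: height_ge0.
  have b0 : 0 <= b by apply: sumr_ge0 => k _; exact: height_ge0.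
  by rewrite ler_norml; apply/andP; split; lra.
rewrite exchange_big/=.
apply: (@le_trans _ _ (\sum_(K <= k < K') (12 * N%:R * height k z + 12 * N%:R * height k w))).
  by apply: ler_sum => k _; rewrite big_split/=; apply: lerD; exact: height_average.
rewrite big_split/= -!mulr_sumr -mulrDr ler_wpM2l ?mulr_ge0//.
by apply: lerD; [exact: tz|exact: uw].
Qed.

(** A point [(w, y)] below [s * roof w] and close to [(z, s * roof z)] has
[roof w >= y / s] close to [roof z] from below, and from above by upper
semicontinuity.  So the tail of heights at [w] is small as well, and [y] is a
multiple of [roof w] with a factor near [s]. *)
Lemma roof_near z (s e : R) : 0 < roof z -> 0 < s <= 1 -> 0 < e ->
  exists2 d : R, 0 < d & forall w y, mdist z w < d -> `|y - s * roof z| < d ->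
    0 <= y <= s * roof w -> forall N, exists2 s', y = s' * roof w &
    \sum_(0 <= n < N) `|s * roof (iter n osucc z) - s' * roof (iter n osucc w)| <= N%:R * e.
Proof.
move=> a0 /andP[s0 s1] e0; set a := roof z in a0 *.
(* 2 for the difference of the factors and 12 * 3 for the tails *)
pose eta := e / 38; have eta0 : 0 < eta by rewrite divr_gt0.
have [K KP] : exists K, envelope K z <= a * expR eta.
  have : a < a * expR eta by rewrite ltr_pMr// expR_gt1.
  move=> /(cvgr_lt _ (@envelope_cvg R z))[K _ KP].
  by exists K; apply: ltW; exact: (KP K (leqnn K)).
pose d0 := s * a * (1 - expR (- eta)).
have d00 : 0 < d0 by rewrite !mulr_gt0// subr_gt0 expR_lt1 oppr_lt0.
exists (Num.min d0 (level K).+1%:R^-1).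
  by rewrite lt_min d00/= invr_gt0 ltr0n.
move=> w y; rewrite !lt_min => /andP[_ zw] /andP[yd _] /andP[y0 yw] N.
have {}zw : residue (level K) z = residue (level K) w.
  move/odist_residue : zw => zw.
  by rewrite -(residue_mod z (leqnSn _)) zw residue_mod.
have EE : envelope K w = envelope K z by apply: envelope_residue.
have yge : s * a * expR (- eta) <= y.
  by move: yd; rewrite ltr_norml /d0 => /andP[]; lra.
have wge : a * expR (- eta) <= roof w.
  by rewrite -(ler_pM2l s0) mulrA; exact: le_trans yw.
have w0 : 0 < roof w by apply: lt_le_trans wge; rewrite mulr_gt0 ?expR_gt0.
have wle : roof w <= a * expR eta.
  by apply: le_trans KP; rewrite -EE; exact: roof_le.
exists (y / roof w); first by rewrite divfK// gt_eqF.
set s' := y / roof w.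
have s's : s' <= s by rewrite ler_pdivrMr.
have ss' : s - s' <= 2 * eta.
  have h1 : s * expR (- (2 * eta)) <= s'.
    rewrite ler_pdivlMr//; apply: le_trans yge.
    apply: (@le_trans _ _ (s * expR (- (2 * eta)) * (a * expR eta))).
      by rewrite ler_wpM2l// mulr_ge0 ?expR_ge0// ltW.
    rewrite mulrACA -expRD (_ : - (2 * eta) + eta = - eta)//; lra.
  have h2 : s * (1 - 2 * eta) <= s * expR (- (2 * eta)).
    by rewrite ler_pM2l//; exact: expR_ge1Dx.
  have h3 : s * eta <= 1 * eta by rewrite ler_pM2r.
  by move: h1 h2 h3; lra.
have avg := @roof_average z w K eta (2 * eta) N zw.
have {avg} avg : \sum_(0 <= n < N) `|roof (iter n osucc z) - roof (iter n osucc w)| <=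
    12 * N%:R * (eta + 2 * eta).
  apply: avg => K' KK'; apply: height_tail => //.
  rewrite EE; apply: (le_trans KP).
  have -> : a * expR eta = a * expR (- eta) * expR (2 * eta).
    by rewrite -mulrA -expRD; congr (_ * expR _); lra.
  exact: (ler_wpM2r (expR_ge0 _) wge).
apply: (@le_trans _ _ (\sum_(0 <= n < N) (2 * eta + `|roof (iter n osucc z) - roof (iter n osucc w)|))).
  apply: ler_sum => n _; set A := roof _; set B := roof _.
  have B0 : 0 <= B by exact: roof_ge0.
  have B1 : B <= 1 by apply: le_trans (roof_le 0 _) (envelope_le1 _ _).
  have -> : s * A - s' * B = s * (A - B) + (s - s') * B by lra.
  apply: (le_trans (ler_normD _ _)); rewrite addrC !normrM lerD//.
    rewrite (ger0_norm B0) ger0_norm ?subr_ge0//.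
    by rewrite -[leRHS]mulr1; apply: ler_pM; rewrite ?subr_ge0.
  by rewrite (gtr0_norm s0) ler_piMl.
rewrite big_split/= sumr_const_nat subn0 -mulr_natl.
have eE : e = 38 * eta by rewrite /eta; lra.
by rewrite eE; move: avg; lra.
Qed.

End roof_averages.

Section skew_local.
Context {R : realType}.
Local Notation Z := (odometer R).
Local Notation ZR := (Z * R^o)%type.
Local Notation X := (@skew_tds R).

Definition base (x : X) : Z := (set_val x).1.
Definition fiber (x : X) : R := (set_val x).2.

Lemma skew_mdist (x y : X) : mdist x y = Num.max (mdist (base x) (base y)) `|fiber y - fiber x|.
Proof. by []. Qed.

Lemma fiber_ge0 (x : X) : 0 <= fiber x.
Proof. by have /region_roof/andP[] := set_valP x. Qed.

Lemma fiber_le_roof (x : X) : fiber x <= roof (base x).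
Proof. by have /region_roof/andP[] := set_valP x. Qed.

Lemma base_tmap (x : X) : base (tmap X x) = osucc (base x).
Proof. by []. Qed.

Lemma fiber_tmap (x : X) : fiber (tmap X x) = multiplier (base x) * fiber x.
Proof. by []. Qed.

Lemma base_iter n (x : X) : base (iter n (tmap X) x) = iter n osucc (base x).
Proof. by elim: n => [//|n ih]; rewrite !iterS base_tmap ih. Qed.

Lemma fiber_iter n (x : X) s : fiber x = s * roof (base x) ->
  fiber (iter n (tmap X) x) = s * roof (iter n osucc (base x)).
Proof.
move=> xs; elim: n => [|n ih]; first exact: xs.
by rewrite !iterS fiber_tmap base_iter ih roof_osucc mulrCA.
Qed.

Lemma fiber_eq0 (x : X) (r : R) : fiber x <= 0 * r -> fiber x = 0 * r.
Proof.
by move=> x0; apply/eqP; rewrite eq_le x0 /=; move: x0; rewrite mul0r fiber_ge0.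
Qed.

Let norm_le (a b c : R) : 0 <= c -> `|b - a| <= c + `|a - b|.
Proof. by move=> c0; rewrite distrC lerDr. Qed.

Let zero_sum N (f g : nat -> R) : \sum_(0 <= n < N) `|0 * f n - 0 * g n| = 0.
Proof. by rewrite big1// => n _; rewrite !mul0r subrr normr0. Qed.

Let quarters (e : R) : 0 < e ->
  [/\ 0 < e / 4, e / 4 <= e / 2, e / 2 < e & e / 2 = e / 4 + e / 4].
Proof. by move=> e0; split; lra. Qed.

Lemma base_continuous : continuous base.
Proof.
move=> x; apply: (@continuous_comp X ZR Z set_val fst).
  exact: initial_continuous.
exact: cvg_fst.
Qed.

Lemma fiber_continuous : continuous fiber.
Proof.
move=> x; apply: (@continuous_comp X ZR R set_val snd).
  exact: initial_continuous.
exact: cvg_snd.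
Qed.

(** Each envelope condition is closed and holds along the orbit. *)
Lemma orbit_closure_under (x : X) s : 0 <= s -> fiber x = s * roof (base x) ->
  forall y : X, closure (orb x) y -> fiber y <= s * roof (base y).
Proof.
move=> s0 xs y cy.
have h K : fiber y <= s * envelope K (base y).
  have clK : closed [set y : X | fiber y <= s * envelope K (base y)].
    apply: (@closed_comp X ZR set_val [set p | p.2 <= s * envelope K p.1]).
      by move=> u _; exact: initial_continuous.
    exact: under_envelope_closed.
  apply: clK; apply: (closure_subset _ cy) => _ [n _ <-] /=.
  by rewrite (fiber_iter n xs) base_iter ler_wpM2l// roof_le.
move: s0; rewrite le_eqVlt => /orP[/eqP s0|s0].
  by have := h 0%N; rewrite -s0 !mul0r.
by rewrite -ler_pdivrMl//; apply: roof_ge => K; rewrite ler_pdivrMl.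
Qed.

Lemma skew_mean_dist (x y : X) s s' N : fiber x = s * roof (base x) ->
  fiber y = s' * roof (base y) ->
  mean_dist x y N <= mdist (base x) (base y) + N%:R^-1 *
    \sum_(0 <= n < N) `|s * roof (iter n osucc (base x)) - s' * roof (iter n osucc (base y))|.
Proof.
move=> xs ys; have [->|N0] := posnP N.
  by rewrite /mean_dist invr0 !mul0r addr0 mdist_ge0.
have NR : 0 < N%:R :> R by rewrite ltr0n.
rewrite /mean_dist -ler_pdivlMl ?invr_gt0// invrK mulrDr mulrA divff ?gt_eqF// mul1r.
apply: (@le_trans _ _ (\sum_(0 <= n < N) (mdist (base x) (base y) +
  `|s * roof (iter n osucc (base x)) - s' * roof (iter n osucc (base y))|))).
  apply: ler_sum => n _; rewrite skew_mdist (fiber_iter n xs) (fiber_iter n ys) !base_iter.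
  rewrite ge_max; apply/andP; split.
    by apply: (le_trans (iter_osucc_contract _ _ _)); rewrite lerDl.
  exact: norm_le (mdist_ge0 _ _).
by rewrite big_split/= sumr_const_nat subn0 mulr_natl.
Qed.

(** Over an orbit of height 0 only the odometer moves, which does not expand
distances; at positive height [roof_near] applies, as the whole orbit closure lies
below [s * roof].  *)
Lemma mean_equicontinuous_orbit_closure (x : X) s (y : orbit_closure x) :
  0 <= s -> fiber x = s * roof (base x) -> fiber (set_val y) = s * roof (base (set_val y)) ->
  s = 0 \/ 0 < fiber (set_val y) -> mean_equicontinuous_at y.
Proof.
move=> s0 xs ys hy eps eps0.
have under (v : orbit_closure x) : fiber (set_val v) <= s * roof (base (set_val v)).
  by apply: (orbit_closure_under s0 xs); exact: set_valP.
have [e4 e42 e2 esplit] := quarters eps0.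
suff [d d0 dP] : exists2 d : R, 0 < d & forall v : orbit_closure x, mdist y v < d ->
    forall N, mean_dist y v N <= eps / 2.
  exists d => // v /dP vN; apply: (@le_lt_trans _ _ (eps / 2)%:E).
    by apply: limn_esup_le_near; apply: nearW => N; rewrite /= lee_fin.
  by rewrite lte_fin.
have base_le (v : orbit_closure x) d : mdist y v < d ->
    mdist (base (set_val y)) (base (set_val v)) < d /\ `|fiber (set_val v) - fiber (set_val y)| < d.
  by rewrite (_ : mdist y v = mdist (set_val y) (set_val v))// skew_mdist gt_max => /andP[].
case: hy => [sz|yfib].
  exists (eps / 4) => // v /base_le[yv _] N; rewrite orbit_closure_mean_dist.
  move: ys (under v); rewrite sz => ys /fiber_eq0 vs.
  apply: (le_trans (skew_mean_dist _ ys vs)); rewrite zero_sum mulr0 addr0.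
  exact: le_trans (ltW yv) e42.
have r0 : 0 < roof (base (set_val y)) by exact: lt_le_trans yfib (fiber_le_roof _).
have s1 : 0 < s <= 1.
  apply/andP; split; first by move: yfib; rewrite ys pmulr_lgt0.
  by have := fiber_le_roof (set_val y); rewrite ys ger_pMl.
have [d d0 dP] := roof_near r0 s1 e4.
exists (Num.min d (eps / 4)); first by rewrite lt_min d0.
move=> v /base_le[]; rewrite !lt_min => /andP[yv yv4] /andP[fv _] N.
rewrite ys in fv; have [|s' vs' sum_le] := dP _ _ yv fv _ N.
  by rewrite fiber_ge0 under.
rewrite orbit_closure_mean_dist; apply: (le_trans (skew_mean_dist _ ys vs')).
rewrite esplit; apply: lerD; first exact: ltW.
have [->|N0] := posnP N; first by rewrite invr0 mul0r ltW.
by rewrite ler_pdivrMl ?ltr0n.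
Qed.

(** On an orbit of positive height, the points of the closure on the graph of
[s * roof] with positive height contain the orbit, so they are dense.  They form a
G-delta set since [s * roof] is an infimum of continuous functions: equality means
that for each [n] some envelope is less than [1 / n.+1] above. *)
Lemma skew_locally_mean_equicontinuous : locally_mean_equicontinuous X.
Proof.
move=> x; have := fiber_ge0 x; rewrite le_eqVlt => /orP[/eqP x0|x0].
  exists setT; split => // [||y _].
  - by exists (fun=> setT) => [_|]; [exact: openT|rewrite bigcapT].
  - by move=> O [y Oy] _; exists y.
  have xs : fiber x = 0 * roof (base x) by rewrite mul0r.
  apply: (mean_equicontinuous_orbit_closure (lexx 0) xs); last by left.
  exact: fiber_eq0 (orbit_closure_under (lexx 0) xs (set_valP y)).
have r0 : 0 < roof (base x) by exact: lt_le_trans (fiber_le_roof x).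
pose s := fiber x / roof (base x); have s0 : 0 < s by rewrite divr_gt0.
have xs : fiber x = s * roof (base x) by rewrite divfK// gt_eqF.
have under (v : orbit_closure x) : fiber (set_val v) <= s * roof (base (set_val v)).
  by apply: (orbit_closure_under (ltW s0) xs); exact: set_valP.
pose V n := [set y : X | 0 < fiber y] `&` \bigcup_K [set y : X | s * envelope K (base y) < fiber y + n.+1%:R^-1].
have oV n : open (V n).
  apply: openI.
    apply: (@open_comp X R fiber [set r | 0 < r]); last exact: open_gt.
    by move=> y _; exact: fiber_continuous.
  apply: bigcup_open => K _.
  rewrite (_ : mkset _ = (fun y => fiber y + n.+1%:R^-1 - s * envelope K (base y)) @^-1` [set r | 0 < r]).
    apply: (@open_comp X R); last exact: open_gt.
    move=> y _; have cfy := @fiber_continuous y.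
    have cby : {for y, continuous (envelope K \o base)}.
      by apply: continuous_comp; [exact: base_continuous|exact: envelope_continuous].
    apply: (@cvgB R R X (nbhs y) _ (fun y => fiber y + n.+1%:R^-1) (fun y => s * envelope K (base y))).
      by apply: cvgD; [exact: cfy|exact: cvg_cst].
    by apply: cvgM; [exact: cvg_cst|exact: cby].
  by apply/seteqP; split=> y; rewrite /= subr_gt0.
pose G : set (orbit_closure x) := \bigcap_n (set_val @^-1` V n).
have GP y : G y <-> 0 < fiber (set_val y) /\ s * roof (base (set_val y)) <= fiber (set_val y).
  split=> [Gy|[y0 sy] n _].
    split; first by have [] := Gy 0%N I.
    apply/ler_addgt0Pr => e e0; have [n _ ne] := near_infty_natSinv_lt (PosNum e0).
    have [_ [K _ /= h]] := Gy n I.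
    have h1 : s * roof (base (set_val y)) <= s * envelope K (base (set_val y)).
      by rewrite ler_pM2l// roof_le.
    apply: (le_trans h1); apply: (le_trans (ltW h)); rewrite lerD2l.
    exact: ltW (ne n (leqnn n)).
  split=> //; have n0 : 0 < n.+1%:R^-1 :> R by rewrite invr_gt0 ltr0n.
  have lt : roof (base (set_val y)) < (fiber (set_val y) + n.+1%:R^-1) / s.
    by rewrite ltr_pdivlMr// mulrC (le_lt_trans sy)// ltrDl.
  have [K _ KP] := cvgr_lt _ (@envelope_cvg R (base (set_val y))) _ lt.
  by exists K => //=; have := KP K (leqnn K); rewrite /= ltr_pdivlMr// mulrC.
exists G; split.
- exists (fun n => set_val @^-1` V n) => // n.
  by exists (V n).
- move=> O [y Oy] [W oW WO]; have Wy : W (set_val y) by rewrite -WO in Oy.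
  have [_ [[n _ <-] Wn]] := set_valP y _ (open_nbhs_nbhs (conj oW Wy)).
  have cn : closure (orb x) (iter n (tmap X) x) by apply: subset_closure; exists n.
  exists (exist _ (iter n (tmap X) x) (mem_set cn) : set_type (closure (orb x))).
  split; first by rewrite -WO.
  apply/GP; rewrite /= (fiber_iter n xs) base_iter; split; last exact: lexx.
  exact: mulr_gt0 s0 (roof_iter_gt0 _ r0).
- move=> y /GP[y0 sy]; apply: (mean_equicontinuous_orbit_closure (ltW s0) xs); last by right.
  by apply/eqP; rewrite eq_le under.
Qed.

End skew_local.

(** * Invariant measures of the odometer *)

Section odometer_measure.
Context {R : realType}.
Local Notation Z := (odometer_tds : tds R).
Context (mu : probability (borel Z) R) (muT : invariant_measure mu).
Local Open Scope ereal_scope.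

Lemma residue_measurable n (S : set nat) :
  measurable ([set z : Z | S (residue n z)] : set (borel Z)).
Proof. by apply: open_borel; exact: residue_open. Qed.

Lemma osucc_preimage_residue n a : (a.+1 < 2 ^ n)%N ->
  tmap Z @^-1` [set z : Z | residue n z = a.+1] = [set z : Z | residue n z = a].
Proof.
move=> an; apply/seteqP; split=> z; rewrite /= residue_osucc; last first.
  by move=> ->; rewrite modn_small.
have := residue_lt n z; rewrite leq_eqVlt => /orP[/eqP ->|rn]; first by rewrite modnn.
by rewrite modn_small// => -[].
Qed.

(** The odometer permutes the residue classes cyclically, so an invariant set meets
all of them in the same measure. *)
Lemma invariant_residue_lt (A : set (borel Z)) n k : measurable A ->
  tmap Z @^-1` A = A -> (k <= 2 ^ n)%N ->
  mu (A `&` [set z : Z | (residue n z < k)%N]) =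
  k%:R%:E * mu (A `&` [set z : Z | residue n z = 0%N]).
Proof.
move=> mA TA; have mC a : measurable (A `&` [set z : Z | residue n z = a] : set (borel Z)).
  by apply: measurableI => //; exact: (residue_measurable n [set a]).
have step a : (a < 2 ^ n)%N -> mu (A `&` [set z : Z | residue n z = a]) =
    mu (A `&` [set z : Z | residue n z = 0%N]).
  elim: a => [//|a ih] an; rewrite -ih; last exact: ltnW.
  by rewrite -(muT (mC a.+1)) preimage_setI TA osucc_preimage_residue.
elim: k => [|k ih] kn.
  by rewrite mul0e (_ : _ `&` _ = set0) ?measure0//; apply/seteqP; split=> z //= [].
rewrite (_ : A `&` [set z : Z | (residue n z < k.+1)%N] =
    (A `&` [set z : Z | (residue n z < k)%N]) `|` (A `&` [set z : Z | residue n z = k])).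
  rewrite measureU//.
  - rewrite -natr1 EFinD ge0_muleDl ?lee_fin// mul1e.
    by congr (_ + _); [exact: ih (ltnW kn)|exact: step].
  - by apply: measurableI => //; exact: (residue_measurable n [set r | (r < k)%N]).
  - by apply/seteqP; split=> z //= [[_ h1] [_ h2]]; rewrite h2 ltnn in h1.
rewrite -setIUr; congr (_ `&` _); apply/seteqP; split=> z /=.
  by rewrite ltnS leq_eqVlt => /orP[/eqP ->|]; [right|left].
by case=> [/ltnW//|->].
Qed.

Lemma invariant_cylinder (A : set (borel Z)) n a : measurable A ->
  tmap Z @^-1` A = A -> (a < 2 ^ n)%N ->
  mu A = (2 ^ n)%:R%:E * mu (A `&` [set z : Z | residue n z = a]).
Proof.
move=> mA TA an; have mC b : measurable (A `&` [set z : Z | residue n z = b] : set (borel Z)).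
  by apply: measurableI => //; exact: (residue_measurable n [set b]).
have -> : mu (A `&` [set z : Z | residue n z = a]) = mu (A `&` [set z : Z | residue n z = 0%N]).
  elim: a an => [//|a ih] an; rewrite -ih; last exact: ltnW.
  by rewrite -(muT (mC a.+1)) preimage_setI TA osucc_preimage_residue.
rewrite -invariant_residue_lt//; congr (mu _); apply/seteqP; split=> [z Az|z []//].
by split => //; exact: residue_lt.
Qed.

Lemma cylinder_measure n a : (a < 2 ^ n)%N ->
  mu [set z : Z | residue n z = a] = ((2 ^ n)%:R^-1)%:E.
Proof.
move=> an; have := @invariant_cylinder setT n a measurableT (preimage_setT _) an.
have mC : measurable ([set z : Z | residue n z = a] : set (borel Z)).
  exact: (residue_measurable n [set a]).
rewrite setTI probability_setT -(fineK (fin_num_measure mu _ mC)) -EFinM => -[h].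
have b0 : ((2 ^ n)%:R != 0 :> R)%R by rewrite pnatr_eq0 -lt0n expn_gt0.
by congr _%:E; apply: (mulfI b0); rewrite mulfV.
Qed.

Lemma residue_lt_measure n k : (k <= 2 ^ n)%N ->
  mu [set z : Z | (residue n z < k)%N] = (k%:R / (2 ^ n)%:R)%:E.
Proof.
move=> kn; have := @invariant_residue_lt setT n k measurableT (preimage_setT _) kn.
by rewrite !setTI cylinder_measure ?expn_gt0// -EFinM.
Qed.

(** The empty set makes the class stable under intersection. *)
Definition cylinders : set (set Z) :=
  [set C | C = set0 \/ exists n a, (a < 2 ^ n)%N /\ C = [set z : Z | residue n z = a]].

Lemma cylindersI : setI_closed cylinders.
Proof.
have sub n m a b : (n <= m)%N -> (b < 2 ^ m)%N -> cylinders
    ([set z : Z | residue n z = a] `&` [set z : Z | residue m z = b]).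
  move=> nm bm; have [ab|ab] := eqVneq (b %% 2 ^ n)%N a.
    right; exists m, b; split=> //; apply/seteqP; split=> [z []//|z /= zb].
    by split=> //; rewrite -ab -zb residue_mod.
  left; apply/seteqP; split=> z //= [za zb]; move/eqP: ab; apply.
  by rewrite -zb residue_mod.
move=> C D [->|[n [a [an ->]]]]; first by rewrite set0I; left.
move=> [->|[m [b [bm ->]]]]; first by rewrite setI0; left.
have [nm|/ltnW mn] := leqP n m; first exact: sub.
by rewrite setIC; exact: sub.
Qed.

Lemma cylinders_open (U : set Z) : open U -> <<s cylinders >> U.
Proof.
move=> oU; pose C n a := [set z : Z | residue n z = a].
have -> : U = \bigcup_n \bigcup_(a in [set a | (a < 2 ^ n)%N /\ C n a `<=` U]) C n a.
  apply/seteqP; split=> [z Uz|z [n _ [a [_ aU]]]]; last exact: aU.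
  have /nbhs_ballP[e e0 eU] := open_nbhs_nbhs (conj oU Uz).
  have [n _ ne] := near_infty_natSinv_lt (PosNum e0).
  exists n.+1 => //; exists (residue n.+1 z) => //; split; first exact: residue_lt.
  move=> w wz; apply: eU; rewrite ballEmdist/=; apply: lt_trans (ne n (leqnn n)).
  exact/odist_residue.
have sig : sigma_algebra setT <<s cylinders >> by exact: smallest_sigma_algebra.
have [s0 sC sU] := sig.
apply: (sU) => n.
pose G a := if pselect ((a < 2 ^ n)%N /\ C n a `<=` U) is left _ then C n a else set0.
rewrite (_ : \bigcup_(a in _) _ = \bigcup_a G a).
  apply: sU => a; rewrite /G; case: pselect => [[an _]|_]; last exact: s0.
  by apply: sub_sigma_algebra; right; exists n, a.
apply/seteqP; split=> z [a].
  by move=> aP Ca; exists a => //; rewrite /G; case: pselect.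
by move=> _; rewrite /G; case: pselect => // aP Ca; exists a.
Qed.

(** An invariant set is independent of every cylinder, hence of every Borel set, hence
of itself. *)
Lemma odometer_ergodic : ergodic mu.
Proof.
move=> A mA TA.
have fA : mu A \is a fin_num by exact: fin_num_measure.
pose r : {nonneg R} := NngNum (fine_ge0 (measure_ge0 mu A)).
have mC n a : measurable ([set z : Z | residue n z = a] : set (borel Z)).
  exact: (residue_measurable n [set a]).
have : mrestr mu mA A = mscale r mu A.
  apply: (@borel_probability_unique R Z (mrestr mu mA) (mscale r mu) cylinders).
  - exact: cylindersI.
  - right; exists 0%N, 0%N; split=> //; apply/seteqP; split=> // z _ /=.
    by rewrite /residue big_ord0.
  - by move=> C [->|[n [a [_ ->]]]]; [exact: measurable0|exact: mC].
  - exact: cylinders_open.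
  - apply: (le_lt_trans (probability_le1 mu _)); last exact: ltry.
    exact: measurableI.
  - move=> C [->|[n [a [an ->]]]]; first by rewrite !measure0.
    rewrite -[LHS]/(mu ([set z : Z | residue n z = a] `&` A)).
    rewrite -[RHS]/((fine (mu A))%:E * mu [set z : Z | residue n z = a]).
    rewrite fineK// setIC (cylinder_measure an).
    have b0 : ((2 ^ n)%:R != 0 :> R)%R by rewrite pnatr_eq0 -lt0n expn_gt0.
    by rewrite [mu A](invariant_cylinder mA TA an) muleAC -EFinM (mulfV b0) mul1e.
  - exact: mA.
rewrite -[LHS]/(mu (A `&` A)) -[RHS]/((fine (mu A))%:E * mu A) setIid.
rewrite -{1 3}(fineK fA) -EFinM -(fineK fA) => -[h].
have : (fine (mu A) * (1 - fine (mu A)) = 0)%R by rewrite mulrBr mulr1 -h subrr.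
move=> /eqP; rewrite mulf_eq0 subr_eq0 => /orP[/eqP ->|/eqP <-]; [by left|by right].
Qed.

End odometer_measure.

(** * The graph measure *)

(** Cover [D] by finitely many null open sets. *)
Lemma supp_compact_null {R : realType} (X : tds R) (mu : probability (borel X) R) (D : set X) :
  closed D -> (forall x, D x -> ~ supp mu x) -> mu.-negligible (D : set (borel X)).
Proof.
move=> cD Dsupp.
have /choice[f fP] (x : pspace X) : exists U : set (pspace X),
    [/\ open U, mu U = 0%E & D x -> U x].
  have [/Dsupp/notin_suppP[U [oU Ux U0]]|nDx] := pselect (D x); first by exists U.
  by exists set0; split; [exact: open0|rewrite measure0|].
have : compact (D : set (pspace X)) by exact: (subclosed_compact cD (@tds_compact _ X)).
rewrite compact_cover => /(_ (pspace X) D f)[].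
- by move=> x _; have [] := fP x.
- by move=> x Dx; exists x => //; have [_ _] := fP x; apply.
move=> D' _ DD'; suff : mu.-negligible (cover [set` D'] f : set (borel X)) by exact: negligibleS.
rewrite /cover bigcup_fset; elim/big_ind: _ => [||x _].
- exact: negligible_set0.
- by move=> A B; exact: negligibleU.
- have [oU U0 _] := fP x; exists (f x); split => //; exact: open_borel.
Qed.

(** A point belongs to the preimage of [W] if and only if, for some [j], almost all
[f K x] are at distance at least [1 / j.+1] from the complement of [W]. *)
Lemma pointwise_limit_preimage {R : realType} (X : tds R) (Y : metricType R)
    (f : nat -> X -> Y) (g : X -> Y) (W : set Y) :
  (forall K, continuous (f K)) -> (forall x, f ^~ x @ \oo --> g x) -> open W ->
  measurable (g @^-1` W : set (borel X)).
Proof.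
move=> cf fg oW.
pose C j := \bigcup_(q in ~` W) ball q j.+1%:R^-1 : set Y.
have mC K j : measurable (~` (f K @^-1` C j) : set (borel X)).
  apply: measurableC; apply: open_borel; apply: open_comp => [x _|]; first exact: cf.
  apply: bigcup_open => q _; rewrite ballEmdist.
  rewrite openE => p pq; apply/nbhs_ballP.
  exists (j.+1%:R^-1 - mdist q p); first by rewrite /= subr_gt0.
  move=> u; rewrite ballEmdist/= ltrBrDl => pu.
  exact: le_lt_trans (metric_triangle _ p _) pu.
rewrite (_ : g @^-1` W = \bigcup_j \bigcup_K0 \bigcap_(K in [set K | (K0 <= K)%N]) ~` (f K @^-1` C j)).
  apply: bigcupT_measurable => j; apply: bigcupT_measurable => K0.
  exact: bigcap_measurableType.
have near x e : 0 < e -> exists K0, forall K, (K0 <= K)%N -> mdist (g x) (f K x) < e.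
  move=> e0; have [K0 _ h] := fg x _ (nbhsx_ballx (g x) e e0).
  by exists K0 => K /h; rewrite /= ballEmdist.
apply/seteqP; split => x.
  move=> Wx; have /nbhs_ballP[e e0 eW] := open_nbhs_nbhs (conj oW Wx).
  have [j _ je] := near_infty_natSinv_lt (PosNum (divr_gt0 e0 (ltr0Sn R 1))).
  have {je} je := je j (leqnn j); rewrite /= in je.
  have [K0 K0P] := near x _ (divr_gt0 e0 (ltr0Sn R 1)).
  exists j => //; exists K0 => // K /K0P gK [q nWq]; rewrite ballEmdist/= => qK.
  apply: nWq; apply: eW; rewrite ballEmdist/=.
  apply: (le_lt_trans (metric_triangle _ (f K x) _)); rewrite (metric_sym (f K x)).
  by rewrite [ltRHS]splitr ltrD// (lt_trans qK).
move=> [j _ [K0 _ h]]; apply: contrapT => nW.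
have j0 : 0 < j.+1%:R^-1 :> R by rewrite invr_gt0 ltr0n.
have [K1 K1P] := near x _ j0.
apply: (h (maxn K0 K1)); first exact: leq_maxl.
by exists (g x) => //; rewrite ballEmdist; exact/K1P/leq_maxr.
Qed.

Section graph_measure.
Context {R : realType}.
Local Notation Z := (odometer_tds : tds R).
Local Notation X := (@skew_tds R).
Local Notation ZR := (odometer R * R^o)%type.
Context (P : probability (borel Z) R) (PT : invariant_measure P).

(** The inclusion of the odometer as the graph of the roof; it is Borel but
discontinuous where the roof is. *)
Definition graph (z : Z) : X := point (region_graph z).

Lemma graph_tmap z : tmap X (graph z) = graph (tmap Z z).
Proof.
apply: val_inj; rewrite -[LHS]/(skew (z, roof z)) -[RHS]/(osucc z, roof (osucc z)).
by rewrite /skew/= roof_osucc.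
Qed.

Lemma graph_measurable (A : set (borel X)) : measurable A ->
  measurable (graph @^-1` A : set (borel Z)).
Proof.
apply: preimage_borel => _ [W oW <-].
apply: (@pointwise_limit_preimage R Z ZR (fun K z => (z, envelope K z)) (fun z => (z, roof z))) => //.
  move=> K z; have h1 : (fun w : odometer R => w) @ z --> z by exact: cvg_id.
  exact: (cvg_pair h1 (@envelope_continuous R K z)).
move=> z; have h1 : (fun K : nat => z : odometer R) @ \oo --> (z : odometer R).
  exact: cvg_cst.
exact: (cvg_pair h1 (@envelope_cvg R z)).
Qed.

Definition graph_measure (A : set (borel X)) : \bar R := P (graph @^-1` A).

Let gm0 : graph_measure set0 = 0%E.
Proof. by rewrite /graph_measure preimage_set0 measure0. Qed.

Let gm_ge0 A : (0 <= graph_measure A)%E. Proof. exact: measure_ge0. Qed.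

Let gm_sigma_additive : semi_sigma_additive graph_measure.
Proof.
move=> F mF tF mUF; rewrite /graph_measure preimage_bigcup.
apply: measure_semi_sigma_additive.
- by move=> n; exact: graph_measurable.
- apply/trivIsetP => /= i j _ _ ij; rewrite -preimage_setI.
  by move/trivIsetP : tF => /(_ _ _ _ _ ij) ->//; rewrite preimage_set0.
- by rewrite -preimage_bigcup; exact: graph_measurable.
Qed.

HB.instance Definition _ := isMeasure.Build _ (borel X) R graph_measure
  gm0 gm_ge0 gm_sigma_additive.

Let gmT : graph_measure setT = 1%E.
Proof. by rewrite /graph_measure preimage_setT probability_setT. Qed.

HB.instance Definition _ := Measure_isProbability.Build _ (borel X) R graph_measure gmT.

Definition graph_probability : probability (borel X) R := graph_measure.

Lemma graph_preimage (A : set X) : graph @^-1` (tmap X @^-1` A) = tmap Z @^-1` (graph @^-1` A).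
Proof. by apply/funext => z; rewrite /preimage /mkset graph_tmap. Qed.

Lemma graph_invariant : invariant_measure graph_probability.
Proof.
move=> A mA; rewrite -[LHS]/(P (graph @^-1` (tmap X @^-1` A))) graph_preimage.
by rewrite PT//; exact: graph_measurable.
Qed.

Lemma graph_ergodic : ergodic graph_probability.
Proof.
move=> A mA TA; apply: (odometer_ergodic PT (graph_measurable mA)).
by rewrite -graph_preimage TA.
Qed.

(** Over the cylinder of residue 0 at level [K] the roof is at most [expR (- K)]. *)
Lemma bottom_in_supp : supp graph_probability (point (region_zero (fun=> false))).
Proof.
move=> U /nbhs_ballP[e e0 eU] mU.
have [n _ ne] := near_infty_natSinv_lt (PosNum e0).
have [K0 _ Ke] := near_infty_natSinv_lt (PosNum e0).
pose K := (n + K0).+1.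
have nK : (n.+1 <= level K)%N by rewrite /level /K; lia.
have z0 m : residue m (fun=> false : bool) = 0%N.
  by rewrite /residue big1.
have sub : [set z : Z | residue (level K) z = 0%N] `<=` graph @^-1` U.
  move=> z zK; apply: eU; rewrite ballEmdist/= skew_mdist gt_max; apply/andP; split.
    apply: lt_trans (ne n (leqnn n)); apply/odist_residue; rewrite z0.
    by rewrite -(residue_mod z nK) zK mod0n.
  rewrite /fiber/= subr0 ger0_norm ?roof_ge0//.
  apply: le_lt_trans (Ke K0 (leqnn K0)); apply: (le_trans (roof_le K z)).
  apply: (le_trans (envelope_peak zK)).
  rewrite expRN lef_pV2 ?posrE ?expR_gt0 ?ltr0n//.
  apply: le_trans (expR_ge1Dx _); rewrite -natr1 addrC lerD2l ler_nat /K; lia.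
have mC : measurable ([set z : Z | residue (level K) z = 0%N] : set (borel Z)).
  exact: (residue_measurable _ [set 0%N]).
apply: (@lt_le_trans _ _ (P [set z : Z | residue (level K) z = 0%N])); last first.
  exact: (le_measure P (mem_set mC) (mem_set (graph_measurable mU)) sub).
by rewrite (cylinder_measure PT) ?lte_fin ?invr_gt0 ?ltr0n ?expn_gt0.
Qed.

(** The complement of the set on which [height_off_peak] bounds [height k]. *)
Let bad k := [set z : Z | (residue (level k) z < 8 ^ k)%N \/
  (2 ^ level k < residue (level k) z + 8 ^ k)%N].

Let bad_measurable k : measurable (bad k : set (borel Z)).
Proof. exact: (residue_measurable _ [set r | (r < 8 ^ k)%N \/ (2 ^ level k < r + 8 ^ k)%N]). Qed.

Let bad_measure k : (P (bad k) <= (2 ^- k / 8)%:E)%E.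
Proof.
set b := (2 ^ level k)%N.
have e8b : (8 ^ k <= b)%N.
  rewrite /b /level expnD expnM (@leq_trans (16 ^ k))//; last by rewrite leq_pmulr.
  by elim: (k) => // j ih; rewrite !expnS leq_mul.
have b0 : 0 < b%:R :> R by rewrite ltr0n expn_gt0.
pose S1 := [set z : Z | (residue (level k) z < 8 ^ k)%N].
pose S2 := [set z : Z | (residue (level k) z < (b - 8 ^ k).+1)%N].
have mS1 : measurable (S1 : set (borel Z)) by exact: (residue_measurable _ [set r | (r < 8 ^ k)%N]).
have mS2 : measurable (S2 : set (borel Z)) by exact: (residue_measurable _ [set r | (r < (b - 8 ^ k).+1)%N]).
have badE : bad k = S1 `|` ~` S2.
  apply/seteqP; split=> z /= [|h]; [by left|right|by left|right].
    by apply/negP; rewrite -leqNgt; lia.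
  by move/negP: h; rewrite -leqNgt; lia.
have mU := measureU2 P mS1 (measurableC mS2).
rewrite badE; apply: (le_trans mU) => {mU}.
have PS1 : P S1 = ((8 ^ k)%:R / b%:R)%:E by exact: (residue_lt_measure PT e8b).
have b8 : ((b - 8 ^ k).+1 <= b)%N by rewrite ltn_subrL !expn_gt0.
have PS2 : P S2 = ((b - 8 ^ k).+1%:R / b%:R)%:E by exact: (residue_lt_measure PT b8).
have PC2 : P (~` S2) = (1 - (b - 8 ^ k).+1%:R / b%:R)%:E.
  by have := probability_setC P mS2; move=> ->; rewrite EFinB; congr (1 - _)%E.
apply: (@le_trans _ _ (((8 ^ k)%:R / b%:R)%:E + (1 - (b - 8 ^ k).+1%:R / b%:R)%:E)%E).
  by apply: leeD; [rewrite -PS1|rewrite -PC2].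
rewrite -EFinD lee_fin.
have -> : (b - 8 ^ k).+1%:R = b%:R - (8 ^ k)%:R + 1 :> R by rewrite -natr1 natrB.
have -> : 1 - (b%:R - (8 ^ k)%:R + 1) / b%:R = ((8 ^ k)%:R - 1) / b%:R :> R.
  by field; rewrite gt_eqF.
rewrite -mulrDl ler_pdivrMr//.
have -> : b%:R = 16 * 2 ^+ k * (8 ^ k)%:R :> R.
  have -> : b = (16 * 2 ^ k * 8 ^ k)%N.
    by rewrite /b /level expnD mulnC expnM -[(2 ^ 4)%N]/(2 * 8)%N expnMn mulnA.
  by rewrite natrM natrM natrX.
have t0 : 2 ^+ k != 0 :> R by rewrite gt_eqF// exprn_gt0.
have -> : 2 ^- k / 8 * (16 * 2 ^+ k * (8 ^ k)%:R) = 2 * (8 ^ k)%:R :> R.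
  by move: (8 ^ k)%:R => y; field.
lra.
Qed.

Let envelope_lt_measurable K c : measurable ([set z : Z | envelope K z < c] : set (borel Z)).
Proof.
apply: open_borel; apply: (@open_comp Z R (envelope K) [set r | r < c]).
  by move=> z _; exact: envelope_continuous.
exact: open_lt.
Qed.

Lemma envelope_small_measure K : (P [set z : Z | (envelope K z < expR (- 4))%R] <= (1 / 4)%R%:E)%E.
Proof.
pose B K := [set z : Z | exists2 k, (k < K)%N & bad k z].
have BS j : B j.+1 = B j `|` bad j.
  apply/seteqP; split=> [z [k]|z [[k kj ?]|?]]; [|by exists k => //; exact: ltnW|by exists j].
  by rewrite ltnS leq_eqVlt => /orP[/eqP ->|kj ?]; [right|left; exists k].
have mB j : measurable (B j : set (borel Z)).
  elim: j => [|j ih]; last by rewrite BS; exact: measurableU.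
  by rewrite (_ : B _ = set0); [exact: measurable0|apply/seteqP; split=> z // []].
have PB j : (P (B j) <= ((1 - 2 ^- j) / 4)%R%:E)%E.
  elim: j => [|j ih].
    by rewrite (_ : B _ = set0); [rewrite measure0 lee_fin expr0 invr1 subrr mul0r|apply/seteqP; split=> z // []].
  rewrite BS; apply: (le_trans (measureU2 _ (mB j) (bad_measurable j))).
  apply: (le_trans (leeD ih (bad_measure j))); rewrite -EFinD lee_fin.
  have -> : 2 ^- j.+1 = 2 ^- j / 2 :> R by rewrite exprS invfM mulrC.
  by move: (2 ^- j) => t; lra.
have sub : [set z : Z | envelope K z < expR (- 4)] `<=` B K.
  move=> z; apply: contraPP => nB /=; apply/negP; rewrite -leNgt.
  apply: envelope_off_peak => k kK; split; rewrite leqNgt; apply/negP => h.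
    by apply: nB; exists k => //; left.
  by apply: nB; exists k => //; right.
have mE : measurable ([set z : Z | envelope K z < expR (- 4)] : set (borel Z)).
  exact: envelope_lt_measurable.
apply: (le_trans (le_measure P (mem_set mE) (mem_set (mB K)) sub)).
apply: (le_trans (PB K)); rewrite lee_fin.
have : 0 <= 2 ^- K :> R by rewrite invr_ge0 exprn_ge0.
by move: (2 ^- K) => t; lra.
Qed.

(** Otherwise the points of height at least [expR (- 4)] would form a null set, but
each envelope falls below that bound with probability at most 1/4. *)
Lemma positive_in_supp : exists2 x : X, supp graph_probability x & 0 < fiber x.
Proof.
apply: contrapT => nex.
pose D := [set x : X | expR (- 4) <= fiber x].
have cD : closed D.
  apply: (@closed_comp X R fiber [set r | expR (- 4) <= r]); last exact: closed_ge.
  by move=> x _; exact: fiber_continuous.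
have : graph_probability.-negligible (D : set (borel X)).
  apply: supp_compact_null => // x Dx sx; apply: nex; exists x => //.
  by apply: lt_le_trans Dx; exact: expR_gt0.
have mD : measurable (D : set (borel X)).
  by rewrite -(setCK D); apply: measurableC; apply: open_borel; exact: closed_openC.
move=> /(measure_negligible mD); rewrite -[LHS]/(P (graph @^-1` D)) => PD.
pose E K := [set z : Z | envelope K z < expR (- 4)].
have mE K : measurable (E K : set (borel Z)).
  exact: envelope_lt_measurable.
have EU : \bigcup_K E K = ~` (graph @^-1` D).
  apply/seteqP; split=> z.
    by move=> [K _ /= zK] Dz; have := le_lt_trans (le_trans Dz (roof_le K z)) zK; rewrite ltxx.
  apply: contra_notP => nE /=; apply: roof_ge => K; rewrite leNgt; apply/negP => zK.
  by apply: nE; exists K.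
have hE : {homo E : n m / (n <= m)%N >-> (n <= m)%O}.
  move=> n m nm; apply/subsetPset => z /=; apply: le_lt_trans.
  exact: envelope_noninc.
have cvE := nondecreasing_cvg_mu (mu := P) mE (bigcupT_measurable _ mE) hE.
have : (P (\bigcup_K E K) <= (1 / 4)%:E)%E.
  rewrite -(cvg_lim _ cvE)//; apply: lime_le; first by apply/cvg_ex; eexists; exact: cvE.
  by apply: nearW => K; exact: envelope_small_measure.
rewrite EU probability_setC ?PD ?sube0 ?lee_fin; first lra.
exact: graph_measurable.
Qed.

(** The orbit of the bottom point stays at height 0 and misses a nonempty open set of
points of positive height. *)
Lemma graph_not_minimal : ~ minimal (supp_subsystem graph_invariant).
Proof.
pose S := supp_subsystem graph_invariant.
move=> minS; have [x1 sx1 x1pos] := positive_in_supp.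
pose inS (x : X) (sx : supp graph_probability x) : S :=
  @exist X (fun x => x \in supp graph_probability) x (mem_set sx).
pose x0 : S := inS _ bottom_in_supp.
pose O : set S := [set y | 0 < fiber (set_val y)].
have oO : open O.
  exists [set x : X | 0 < fiber x] => //.
  apply: (@open_comp X R fiber [set r | 0 < r]); last exact: open_gt.
  by move=> y _; exact: fiber_continuous.
have O0 : O !=set0 by exists (inS _ sx1).
have [y [Oy [n _ yn]]] := minS x0 O O0 oO; rewrite -{y}yn in Oy.
pose p0 : X := point (region_zero (fun=> false)).
have itE m : set_val (iter m (tmap S) x0) = iter m (tmap X) p0.
  by elim: m => //= m <-.
have f0 : fiber p0 = 0 * roof (base p0) by rewrite mul0r.
by move: Oy; rewrite /O /mkset itE (fiber_iter n f0) mul0r ltxx.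
Qed.

End graph_measure.

Lemma odometer_invariant_exists (R : realType) :
  exists P : probability (borel (odometer_tds : tds R)) R, invariant_measure P.
Proof.
have [m _] := @empirical_mean_exists R odometer_tds (fun=> [:: (fun=> false) : odometer R])
  succn (fun=> isT) leqnn.
by exists (mean_probability m); exact: mean_probability_invariant.
Qed.

Theorem theorem1p7 (R : realType) :
  (forall X : tds R, locally_mean_equicontinuous X ->
     topological_entropy X = 0%E) /\
  (exists X : tds R, locally_mean_equicontinuous X /\
     exists (mu : probability (borel X) R) (muT : invariant_measure mu),
       ergodic mu /\ ~ minimal (supp_subsystem muT)).
Proof.
split; first by move=> X; exact: locally_mean_equicontinuous_entropy0.
have [P PT] := odometer_invariant_exists R.
exists (@skew_tds R); split; first exact: skew_locally_mean_equicontinuous.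
exists (graph_probability P), (graph_invariant PT); split.
  exact: graph_ergodic.
exact: graph_not_minimal.
Qed.
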